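(* Let $\Gamma$ be a discrete torsion-free subgroup of $G=\mathrm{GSp}_4(F)$ with $\Gamma\subset G_0$ and $\Gamma\backslash G/Z$ compact, and let $X_\Gamma=\Gamma\backslash X$. Then the zeta function $Z(X_\Gamma,u)$ is a rational function of $u$, given by $$Z(X_\Gamma,u)=\frac{1}{\det(I-L_{P_1}u)\,\det(I-L_{P_2}u^2)},$$ where $L_{P_1}$ acts on the finite-dimensional space $C(\Gamma\backslash G/P_1Z)$ and $L_{P_2}$ on $C(\Gamma\backslash G/P_2Z)$.
   Context: $F$ is a non-archimedean local field with ring of integers $\mathcal O$, maximal ideal $\mathcal P$, uniformizer $\pi$, residue field of order $q$. $V=F^4$ with basis $e_1,e_2,f_1,f_2$ and alternating form with Gram matrix $J=\begin{pmatrix}0&0&0&1\\0&0&1&0\\0&-1&0&0\\-1&0&0&0\end{pmatrix}$. $G=\mathrm{GSp}_4(F)=\{g\in GL_4(F):g^tJg=\lambda(g)J,\ \lambda(g)\in F^\times\}$, $Z$ = center (scalars), $G_0=\{g\in G:\mathrm{ord}_\pi\det g\equiv0\bmod 4\}$. $K=G\cap GL_4(\mathcal O)$; $I$ = elements of $K$ that are upper triangular modulo $\mathcal P$; $s_1=\begin{pmatrix}0&1&0&0\\1&0&0&0\\0&0&0&1\\0&0&1&0\end{pmatrix}$, $s_2=\begin{pmatrix}1&0&0&0\\0&0&1&0\\0&-1&0&0\\0&0&0&1\end{pmatrix}$; $P_1=I\cup Is_1I$ (Siegel congruence subgroup), $P_2=I\cup Is_2I$ (Klingen congruence subgroup). For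 $f$ in $C(\Gamma\backslash G/P_1Z)$ (complex functions on $G$ left $\Gamma$-invariant and right $P_1Z$-invariant), $L_{P_1}f(g)=\sum_{g_iP_1\in P_1\mathrm{diag}(1,1,\pi,\pi)P_1/P_1}f(gg_i)$; for $f\in C(\Gamma\backslash G/P_2Z)$, $L_{P_2}f(g)=\sum_{h_jP_2\in P_2\mathrm{diag}(1,\pi,\pi,\pi^2)P_2/P_2}f(gh_j)$. Building: a lattice is a free rank-4 $\mathcal O$-submodule of $V$; $L$ is primitive if $\langle L,L\rangle\subset\mathcal O$ and the form is non-degenerate on $L/\pi L$; $L'$ is incident to primitive $L$ if $\pi L\subset L'\subset L$ and $\langle L',L'\rangle\subset\mathcal P$. The building $X$ of $\mathrm{Sp}_4(F)$ has as vertices the homothety classes $[L]$ of primitive lattices and of lattices incident to primitive ones; two vertices are adjacent if represented by $L',L''$, one containing the other, with $\pi L\subset L',L''\subset L$ for a primitive $L$; three vertices form a chamber if represented by $L$ primitive and $\pi L\subset L'\subset L''\subset L$. $G$ acts by $g[L]=[gL]$. For a basis $u_1,u_2,w_1,w_2$ with $\langle u_1,w_2\rangle=\langle u_2,w_1\rangle=1$ and all other pairings among $u_i,w_j$ zero, the corresponding apartment is the subcomplex with vertices $[\mathcal O\pi^{a_1}u_1+\mathcal O\pi^{a_2}u_2+\mathcal O\pi^{b_1}w_1+\mathcal O\pi^{b_2}w_2]$; it is a Euclidean plane tiled by isosceles right triangles (the chambers), and $X$ carries the metric induced from these Euclidean structures. $X_\Gamma=\Gamma\backslash X$. Zeta function: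 a cycle in $X_\Gamma$ is a closed path $v_0\to v_1\to\cdots\to v_n=v_0$ of consecutively adjacent vertices in the 1-skeleton (with starting point and orientation; repetition allowed), of length $n$. It is geodesic if it lifts to a geodesic path of $X$, i.e. a path lying along a straight line in some apartment; tailless if it remains geodesic after every shift of its starting vertex; primitive if it is not a cycle traversed more than once; two cycles are equivalent if one is obtained from the other by shifting the starting vertex. $Z(X_\Gamma,u)=\prod_{[C]}(1-u^{l([C])})^{-1}$, the product over equivalence classes of tailless primitive geodesic cycles in the 1-skeleton of $X_\Gamma$, $l([C])$ the length.
   Formalization: ''Torsion-free'' is taken modulo the center: the image of Γ in G/Z has no nontrivial element of finite order (torsion-freeness in G alone makes the claim false); cycles in X_Γ are recorded by the edges they traverse, since Γ\X may have several edges between two vertices. *)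

(* Defs.v *)
From HB Require Import structures.
From mathcomp Require Import all_boot all_order all_algebra.
From mathcomp Require Import finmap complex.
From mathcomp Require Import boolp classical_sets functions cardinality fsbigop reals.

Set Implicit Arguments.
Unset Strict Implicit.
Unset Printing Implicit Defensive.

Import Order.TTheory GRing.Theory Num.Theory.
Local Open Scope classical_set_scope.
Local Open Scope ring_scope.

Section LocalField.
Variables (F : fieldType) (ord : F -> int).

(* The fractional ideal P^n; the value [ord 0] is irrelevant throughout. *)
Definition in_Pn (n : int) (x : F) : bool := (x == 0) || (n <= ord x).

Record nonarch_local_field : Prop := {
  ordM : forall x y, x != 0 -> y != 0 -> ord (x * y) = ord x + ord y;
  ordD : forall x y, x != 0 -> y != 0 -> x + y != 0 ->
    Num.min (ord x) (ord y) <= ord (x + y);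
  ord_normalized : exists2 x, x != 0 & ord x = 1;
  residue_field_finite : exists s : seq F,
    forall x, in_Pn 0 x -> exists2 y, y \in s & in_Pn 1 (x - y);
  ord_complete : forall u : nat -> F,
    (forall N : int, exists n0 : nat, forall m n : nat,
       (n0 <= m)%N -> (n0 <= n)%N -> in_Pn N (u m - u n)) ->
    exists l, forall N : int, exists n0 : nat, forall n : nat,
       (n0 <= n)%N -> in_Pn N (u n - l) }.

Definition uniformizer (pi : F) : Prop := pi != 0 /\ ord pi = 1.

End LocalField.

Definition mx4 (F : nzRingType) (rows : seq (seq F)) : 'M[F]_4 :=
  \matrix_(i < 4, j < 4) nth 0 (nth [::] rows i) j.

Definition diag4 (F : nzRingType) (a b c d : F) : 'M[F]_4 :=
  diag_mx (\row_(i < 4) nth 0 [:: a; b; c; d] i).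

Section Group.
Variables (F : fieldType) (ord : F -> int).
Local Notation in_Pn := (in_Pn ord).
Implicit Types (g h : 'M[F]_4) (A B Gamma : set 'M[F]_4).

Definition Jmx : 'M[F]_4 := mx4
  [:: [:: 0; 0; 0; 1];
      [:: 0; 0; 1; 0];
      [:: 0; -1; 0; 0];
      [:: -1; 0; 0; 0]].

Definition GSp4 : set 'M[F]_4 :=
  [set g | g \in unitmx /\ exists2 l : F, l != 0 & g^T *m Jmx *m g = l *: Jmx].

Definition center : set 'M[F]_4 := [set g | exists2 a : F, a != 0 & g = a%:M].

Definition G0 : set 'M[F]_4 := [set g | GSp4 g /\ (4 %| ord (\det g))%Z].

Definition GL4O : set 'M[F]_4 :=
  [set g | [/\ g \in unitmx, forall i j, in_Pn 0 (g i j)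
             & forall i j, in_Pn 0 (invmx g i j)]].

Definition Kmax : set 'M[F]_4 := GSp4 `&` GL4O.

Definition Iwahori : set 'M[F]_4 :=
  [set g | Kmax g /\ forall i j : 'I_4, (j < i)%N -> in_Pn 1 (g i j)].

Definition s1 : 'M[F]_4 := mx4
  [:: [:: 0; 1; 0; 0];
      [:: 1; 0; 0; 0];
      [:: 0; 0; 0; 1];
      [:: 0; 0; 1; 0]].

Definition s2 : 'M[F]_4 := mx4
  [:: [:: 1; 0; 0; 0];
      [:: 0; 0; 1; 0];
      [:: 0; -1; 0; 0];
      [:: 0; 0; 0; 1]].

Definition double_coset A g : set 'M[F]_4 :=
  [set x | exists a b, [/\ A a, A b & x = a *m g *m b]].

Definition P1 : set 'M[F]_4 := Iwahori `|` double_coset Iwahori s1.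
Definition P2 : set 'M[F]_4 := Iwahori `|` double_coset Iwahori s2.

Definition is_subgroup Gamma : Prop :=
  [/\ Gamma `<=` GSp4, Gamma 1%:M,
      forall g h, Gamma g -> Gamma h -> Gamma (g *m h)
    & forall g, Gamma g -> Gamma (invmx g)].

(* The topology of GSp_4(F) is the one induced by the entries. *)
Definition mx_close (n : int) g h : Prop := forall i j, in_Pn n (g i j - h i j).

Definition discrete Gamma : Prop :=
  forall g, Gamma g -> exists n : int, forall h, Gamma h -> mx_close n h g -> h = g.

(* The image of Gamma in GSp_4(F)/Z, the group acting on the building, has no
   nontrivial element of finite order. *)
Definition torsion_free_mod_center Gamma : Prop :=
  forall (g : 'M[F]_4) (n : nat), Gamma g -> (0 < n)%N ->
    center (g ^+ n) -> center g.

Definition open_in_GSp4 (U : set 'M[F]_4) : Prop :=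
  U `<=` GSp4 /\
  forall g, U g -> exists n : int, forall h, GSp4 h -> mx_close n h g -> U h.

(* Compactness of Gamma\G/Z for the quotient topology: the open subsets of the
   quotient are the open subsets of G stable under Gamma and Z. *)
Definition cocompact_mod_center Gamma : Prop :=
  forall C : set (set 'M[F]_4),
    (forall U, C U -> open_in_GSp4 U) ->
    (forall U gam g z, C U -> Gamma gam -> center z -> U g -> U (gam *m g *m z)) ->
    GSp4 `<=` \bigcup_(U in C) U ->
    exists D : set (set 'M[F]_4),
      [/\ finite_set D, D `<=` C & GSp4 `<=` \bigcup_(U in D) U].

End Group.

Section Operators.
Variables (F : fieldType) (R : realType).
Implicit Types (Gamma P : set 'M[F]_4) (f : 'M[F]_4 -> R[i]).

(* Functions on G are encoded as functions on all matrices vanishing off G. *)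
Definition automorphic Gamma P : set ('M[F]_4 -> R[i]) :=
  [set f | (forall g, ~ GSp4 g -> f g = 0) /\
           forall gam g p z, Gamma gam -> GSp4 g -> P p -> center z ->
             f (gam *m g *m (p *m z)) = f g].

Definition left_cosets D P : set (set 'M[F]_4) :=
  [set C | exists2 a, D a & C = [set a *m p | p in P]].

(* The sum over the cosets in P d P / P; [xget] picks a representative of each. *)
Definition Hecke P (d : 'M[F]_4) f : 'M[F]_4 -> R[i] :=
  fun g => \sum_(C \in left_cosets (double_coset P d) P) f (g *m xget 1%:M C).

Definition is_basis (W : set ('M[F]_4 -> R[i])) n
    (b : 'I_n -> 'M[F]_4 -> R[i]) : Prop :=
  [/\ forall i, W (b i),
      forall c : 'I_n -> R[i], (forall g, \sum_i c i * b i g = 0) -> forall i, c i = 0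
    & forall f, W f -> exists c : 'I_n -> R[i], forall g, f g = \sum_i c i * b i g].

(* D(u) = det(I - p(u) L) for the endomorphism L of the finite-dimensional
   space W. *)
Definition is_det_1sub (W : set ('M[F]_4 -> R[i]))
    (L : ('M[F]_4 -> R[i]) -> 'M[F]_4 -> R[i]) (p D : {poly R[i]}) : Prop :=
  exists n (b : 'I_n -> 'M[F]_4 -> R[i]) (A : 'M[R[i]]_n),
    [/\ is_basis W b,
        forall j g, L (b j) g = \sum_i A i j * b i g
      & D = \det (1%:M - p *: map_mx polyC A)].

End Operators.

Definition L_P1 (F : fieldType) (ord : F -> int) (pi : F) (R : realType) :=
  Hecke (R := R) (P1 ord) (diag4 1 1 pi pi).

Definition L_P2 (F : fieldType) (ord : F -> int) (pi : F) (R : realType) :=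
  Hecke (R := R) (P2 ord) (diag4 1 pi pi (pi ^+ 2)).

Arguments L_P1 {F} ord pi {R}.
Arguments L_P2 {F} ord pi {R}.

Section Building.
Variables (F : fieldType) (ord : F -> int) (pi : F).
Local Notation in_Pn := (in_Pn ord).
Local Notation V := 'cV[F]_4.
Local Notation vertex := (set (set V)).
Local Notation edge := (set (vertex * vertex)).
Implicit Types (L M : set V) (v w : vertex) (Gamma : set 'M[F]_4).

Definition form (x y : V) : F := (x^T *m Jmx F *m y) 0 0.

Definition span_cols (g : 'M[F]_4) : set V :=
  [set g *m x | x in [set x : V | forall i, in_Pn 0 (x i 0)]].

Definition is_lattice L : Prop := exists2 g, g \in unitmx & L = span_cols g.

Definition dilate (c : F) L : set V := [set c *: x | x in L].

Definition primitive_lattice L : Prop :=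
  [/\ is_lattice L,
      forall x y, L x -> L y -> in_Pn 0 (form x y)
    & forall x, L x -> (forall y, L y -> in_Pn 1 (form x y)) -> dilate pi L x].

Definition incident M L : Prop :=
  [/\ is_lattice M, dilate pi L `<=` M, M `<=` L
    & forall x y, M x -> M y -> in_Pn 1 (form x y)].

(* Vertices are homothety classes, i.e. sets of lattices. *)
Definition hclass L : vertex := [set dilate c L | c in [set c : F | c != 0]].

Definition is_vertex v : Prop :=
  exists2 L, primitive_lattice L & v = hclass L \/ exists2 M, incident M L & v = hclass M.

Definition adjacent v w : Prop :=
  [/\ is_vertex v, is_vertex w, v <> w &
      exists L L' L'', [/\ primitive_lattice L,
        is_lattice L' /\ v = hclass L', is_lattice L'' /\ w = hclass L'',
        L' `<=` L'' \/ L'' `<=` L' &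
        [/\ dilate pi L `<=` L', L' `<=` L, dilate pi L `<=` L'' & L'' `<=` L]]].

Definition act (g : 'M[F]_4) v : vertex := [set [set g *m x | x in L] | L in v].

(* The columns u1, u2, w1, w2 of B have <u1,w2> = <u2,w1> = 1 and all their
   other pairings are zero. *)
Definition symplectic_basis (B : 'M[F]_4) : Prop := B^T *m Jmx F *m B = Jmx F.

(* O pi^a1 u1 + O pi^a2 u2 + O pi^b1 w1 + O pi^b2 w2, where a = (a1,a2,b1,b2). *)
Definition apartment_lattice (B : 'M[F]_4) (a : 'rV[int]_4) : set V :=
  span_cols (B *m diag_mx (map_mx (fun k => pi ^ k) a)).

Variable R : realType.

(* The Euclidean coordinates (a1 - b2, a2 - b1) are invariant under homothety;
   they identify the vertices of an apartment with Z^2 and its chambers with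
   the isosceles right triangles that are the images of (0,0), (1,0), (1,1)
   under the symmetries of the tiling. *)
Definition apartment_coord (a : 'rV[int]_4) : 'rV[R]_2 :=
  \row_(k < 2) nth 0 [:: (a 0 0 - a 0 3)%:~R; (a 0 1 - a 0 2)%:~R] k.

(* The path v 0, ..., v n advances along a straight line of an apartment. *)
Definition geodesic_path (n : nat) (v : nat -> vertex) : Prop :=
  (forall i, (i < n)%N -> adjacent (v i) (v i.+1)) /\
  exists (B : 'M[F]_4) (a : nat -> 'rV[int]_4) (p d : 'rV[R]_2) (t : nat -> R),
    [/\ symplectic_basis B,
        forall i, (i <= n)%N -> v i = hclass (apartment_lattice B (a i)),
        d != 0,
        forall i, (i < n)%N -> t i < t i.+1
      & forall i, (i <= n)%N -> apartment_coord (a i) = p + t i *: d].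

(* An oriented edge of X_Gamma is the Gamma-orbit of an oriented edge of X. *)
Definition edge_orbit Gamma v w : edge :=
  [set (act g v, act g w) | g in Gamma].

Definition is_edge Gamma (e : edge) : Prop :=
  exists v w, adjacent v w /\ e = edge_orbit Gamma v w.

(* The endpoints of an edge of X_Gamma, as Gamma-orbits of vertices of X. *)
Definition source (e : edge) : set vertex := fst @` e.
Definition target (e : edge) : set vertex := snd @` e.

(* A cycle v_0 -> v_1 -> ... -> v_n = v_0 is given by the list of its n edges:
   X_Gamma may have several edges between the same two vertices. *)
Definition is_cycle Gamma (c : seq edge) : Prop :=
  [/\ c <> [::], forall e, e \in c -> is_edge Gamma e
    & cycle (fun e e' => `[< target e = source e' >]) c].

Definition geodesic_cycle Gamma (c : seq edge) : Prop :=
  is_cycle Gamma c /\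
  exists2 v : nat -> vertex, geodesic_path (size c) v &
    forall i, (i < size c)%N -> nth set0 c i = edge_orbit Gamma (v i) (v i.+1).

Definition tailless Gamma (c : seq edge) : Prop :=
  forall k, geodesic_cycle Gamma (rot k c).

Definition primitive_cycle (c : seq edge) : Prop :=
  forall (c' : seq edge) (k : nat), (1 < k)%N -> c <> flatten (nseq k c').

Definition cycle_class (c : seq edge) : set (seq edge) := [set rot k c | k in setT].

Definition prime_classes Gamma : set (set (seq edge)) :=
  [set cycle_class c | c in [set c | geodesic_cycle Gamma c /\
                                     tailless Gamma c /\ primitive_cycle c]].

(* All members of a class have the same length. *)
Definition class_length (C : set (seq edge)) : nat := size (xget [::] C).

End Building.

(* A formal power series is the sequence of its coefficients. *)
Section PowerSeries.
Variable (C : comNzRingType).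

Definition fps_one : nat -> C := fun n => (n == 0)%:R.

Definition fps_mul (a b : nat -> C) : nat -> C :=
  fun n => \sum_(i < n.+1) a i * b (n - i)%N.

Definition fps_of_poly (p : {poly C}) : nat -> C := fun n => p`_n.

(* (1 - u^l)^-1 = 1 + u^l + u^(2l) + ... *)
Definition euler_factor (l : nat) : nat -> C := fun n => (l %| n)%N%:R.

(* Z is the product of the series (1 - u^(len c))^-1, c in S: the net of the
   finite partial products converges to Z coefficientwise. *)
Definition is_euler_product (T : choiceType) (S : set T) (len : T -> nat)
    (Z : nat -> C) : Prop :=
  forall n, exists2 A : {fset T}, [set` A] `<=` S &
    forall B : {fset T}, (A `<=` B)%fset -> [set` B] `<=` S ->
      (\big[fps_mul/fps_one]_(c <- B) euler_factor (len c)) n = Z n.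

End PowerSeries.

Definition is_zeta (F : fieldType) (ord : F -> int) (pi : F) (R : realType)
    (Gamma : set 'M[F]_4) (Z : nat -> R[i]) : Prop :=
  is_euler_product (prime_classes ord pi R Gamma) (@class_length F) Z.

Lemma is_euler_product_unique (C : comNzRingType) (T : choiceType) (S : set T)
    (len : T -> nat) (Z Z' : nat -> C) :
  is_euler_product S len Z -> is_euler_product S len Z' -> Z = Z'.
Proof.
move=> hZ hZ'; apply/funext => n.
have [A AS hA] := hZ n; have [A' AS' hA'] := hZ' n.
have US : [set` (A `|` A')%fset] `<=` S.
  by move=> x /=; rewrite inE => /orP[/AS|/AS'].
by rewrite -(hA _ _ US) ?fsubsetUl// hA' ?fsubsetUr.
Qed.

Section DetUnique.
Variables (F : fieldType) (R : realType) (W : set ('M[F]_4 -> R[i])).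
Implicit Types (m n : nat).

Let is_basis_inj n (b : 'I_n -> 'M[F]_4 -> R[i]) (c c' : 'I_n -> R[i]) :
  is_basis W b -> (forall g, \sum_i c i * b i g = \sum_i c' i * b i g) -> c =1 c'.
Proof.
move=> [_ free _] cc' i; apply/eqP; rewrite -subr_eq0; apply/eqP.
apply: (free (fun i => c i - c' i)) => g.
by under eq_bigr do rewrite mulrBl; rewrite sumrB cc' subrr.
Qed.

Let is_basis_mx m n (b : 'I_n -> 'M[F]_4 -> R[i]) (b' : 'I_m -> 'M[F]_4 -> R[i]) :
  is_basis W b -> is_basis W b' ->
  exists S : 'M[R[i]]_(n, m), forall j g, b' j g = \sum_i S i j * b i g.
Proof.
move=> [_ _ span] [Wb' _ _].
have [c hc] := @choice _ _ (fun j c => forall g, b' j g = \sum_i c i * b i g)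
  (fun j => span _ (Wb' j)).
by exists (\matrix_(i, j) c j i) => j g; rewrite hc; apply: eq_bigr => i _; rewrite mxE.
Qed.

Let comb_comb m n l (b : 'I_n -> 'M[F]_4 -> R[i]) (S : 'M[R[i]]_(n, m))
    (c : 'M[R[i]]_(m, l)) j g :
  \sum_k c k j * (\sum_i S i k * b i g) = \sum_i (S *m c) i j * b i g.
Proof.
under eq_bigr do rewrite mulr_sumr; rewrite exchange_big /=.
apply: eq_bigr => i _; rewrite mxE mulr_suml; apply: eq_bigr => k _.
by rewrite mulrA [c k j * _]mulrC.
Qed.

Let is_basis_mxK m n (b : 'I_n -> 'M[F]_4 -> R[i]) (b' : 'I_m -> 'M[F]_4 -> R[i])
    (S : 'M[R[i]]_(n, m)) (T : 'M[R[i]]_(m, n)) :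
  is_basis W b -> (forall j g, b' j g = \sum_i S i j * b i g) ->
  (forall i g, b i g = \sum_k T k i * b' k g) -> S *m T = 1%:M.
Proof.
move=> hb hS hT; apply/matrixP => i j; move: i.
apply: (is_basis_inj hb) => g; rewrite -comb_comb.
transitivity (b j g); first by rewrite hT; apply: eq_bigr => k _; rewrite hS.
rewrite (bigD1 j)//= big1 ?mxE ?eqxx ?mul1r ?addr0// => i /negPf ij.
by rewrite mxE ij mul0r.
Qed.

Lemma is_det_1sub_unique (L : ('M[F]_4 -> R[i]) -> 'M[F]_4 -> R[i])
    (p D D' : {poly R[i]}) :
  (forall n (c : 'I_n -> R[i]) (b : 'I_n -> 'M[F]_4 -> R[i]), (forall i, W (b i)) ->
     forall g, L (fun g => \sum_i c i * b i g) g = \sum_i c i * L (b i) g) ->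
  is_det_1sub W L p D -> is_det_1sub W L p D' -> D = D'.
Proof.
move=> linL [n [b [A [hb hA ->]]]] [m [b' [A' [hb' hA' ->]]]].
have [S hS] := is_basis_mx hb hb'; have [T hT] := is_basis_mx hb' hb.
have ST := is_basis_mxK hb hS hT; have TS := is_basis_mxK hb' hT hS.
have nm : n = m by apply/eqP; rewrite eqn_leq (mulmx1_min ST) (mulmx1_min TS).
case: m / nm b' A' hb' hA' S hS T hT ST TS => b' A' hb' hA' S hS T hT ST TS.
have AS : A *m S = S *m A'.
  apply/matrixP => i j; move: i; apply: (is_basis_inj hb) => g.
  rewrite -!comb_comb; transitivity (L (b' j) g).
    have -> : b' j = (fun g => \sum_i S i j * b i g) by apply/funext => ?.
    rewrite linL; last by case: hb.
    by apply: eq_bigr => k _; rewrite hA.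
  by rewrite hA'; apply: eq_bigr => k _; rewrite hS.
pose q (M : 'M[R[i]]_n) := map_mx polyC M.
have qST : q S *m q T = 1%:M by rewrite /q -map_mxM ST map_mx1.
rewrite -![map_mx polyC _]/(q _).
have <- : q S *m (1%:M - p *: q A') *m q T = 1%:M - p *: q A.
  have qAS : q S *m q A' = q A *m q S by rewrite /q -!map_mxM AS.
  by rewrite mulmxBr mulmx1 -scalemxAr qAS mulmxBl qST -scalemxAl -mulmxA qST mulmx1.
by rewrite !det_mulmx mulrAC -det_mulmx qST det1 mul1r.
Qed.

End DetUnique.

(* Main.v *)
(* The vertices of a straight path of the 1-skeleton are the classes of
   g diag(pi^w_i) O^4, g in GSp_4, where w_0, w_1, ... is one of two explicit
   sequences of weights: the path runs along a diagonal of the tiling, between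
   special vertices, or along an axis, alternating between special and
   non-special vertices. By a factorization of the stabilizer of an edge, a path
   is straight as soon as any two successive edges are. Hence the tailless
   geodesic cycles of X_Gamma are the closed walks of the relation "successor"
   on the finite set of edges of X_Gamma, and the Euler product over primitive
   closed walks is 1/det(1 - uT), T the transition matrix, by comparing
   logarithmic derivatives.

   Geodesics do not change type, so T is the direct sum of a matrix A on the
   diagonal edges and of a matrix with off-diagonal blocks X and Y on the edges
   along the axes, which exchanges those leaving a special vertex and those
   leaving a non-special one. Thus det(1 - uT) = det(1 - uA) det(1 - u^2 XY).
   As P_1 Z and P_2 Z are the stabilizers of a diagonal edge and of an edge along
   an axis, A and XY are the matrices of L_{P_1} and L_{P_2} in the bases of
   indicator functions of the Gamma-orbits of edges, provided that distinct
   cosets in P d P / P give distinct walks in X_Gamma. This holds because Gamma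
   acts freely on lattice classes modulo the center. Indeed an element of Gamma
   fixing a class has a power b congruent to 1 modulo a high power of P. By
   cocompactness, moving from one self-dual lattice to the next, every lattice
   is s t O^4 with t bounded and s in Gamma commuting with b up to scalars:
   the commutators that occur are fixators of nearby lattices in the discrete
   group Gamma, so they have finite order and are scalar. Hence b fixes every
   class, so it is scalar, and Gamma has no torsion. *)

Require Import Defs.
From mathcomp Require Import all_boot all_order all_algebra.
From mathcomp Require Import finmap complex.
From mathcomp Require Import boolp classical_sets functions cardinality fsbigop reals.
From mathcomp Require Import perm zify ring.
Set Implicit Arguments.
Unset Strict Implicit.
Unset Printing Implicit Defensive.
Import Order.TTheory GRing.Theory Num.Theory.
Local Open Scope classical_set_scope.
Local Open Scope ring_scope.

(** * Valuations and integral matrices *)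

(** Two obstacles shape the argument. First, [Gamma] is discrete in GSp_4(F), but an element fixing
    a lattice class may rescale the lattice, so its multiple of unit determinant is only known to
    lie in [Gamma] times the center, where discreteness does not apply directly. Scalars cancel in
    commutators, which brings these back into [Gamma]; hence the detour through elements commuting
    up to scalars. Second, edges of X_Gamma are orbits, and their kind must be read off from the
    orbit. Homotheties change the order of the determinant by multiples of 4, and so does [Gamma],
    being contained in [G0]; so this order modulo 4 is an invariant of the vertices of X_Gamma. It
    is even at special vertices and odd at the others, and its values at the two ends of an edge
    separate the three kinds of edges and exclude loops. The same hypothesis lets coset
    representatives be rescaled to unit determinant. The Euler product is compared with the
    determinant up to an arbitrary degree n, which involves only the finitely many primes of length
    at most n and divisions by integers, possible in characteristic zero. *)

Lemma invmxM (F : fieldType) n (A B : 'M[F]_n) : A \in unitmx -> B \in unitmx ->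
  invmx (A *m B) = invmx B *m invmx A.
Proof.
move=> uA uB; have uAB : A *m B \in unitmx by rewrite unitmx_mul uA.
apply: (can_inj (mulKmx uAB)); rewrite mulmxV// -mulmxA [B *m _]mulmxA mulmxV//.
by rewrite mul1mx mulmxV.
Qed.

Section Valuation.
Variables (F : fieldType) (ord : F -> int) (pi : F).
Hypotheses (hF : nonarch_local_field ord) (hpi : uniformizer ord pi).
Local Notation in_Pn := (in_Pn ord).

Lemma pi_neq0 : pi != 0. Proof. by case: hpi. Qed.
Lemma ord_pi : ord pi = 1. Proof. by case: hpi. Qed.

Lemma ordMn0 x y : x != 0 -> y != 0 -> ord (x * y) = ord x + ord y.
Proof. exact: (ordM hF). Qed.

Lemma ord_one : ord 1 = 0.
Proof.
have : ord (1 * 1) = ord 1 + ord 1 by apply: ordMn0; exact: oner_neq0.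
by rewrite mulr1; lia.
Qed.

Lemma ordV x : x != 0 -> ord x^-1 = - ord x.
Proof.
move=> x0; have := ordMn0 x0 (invr_neq0 x0).
by rewrite divff// ord_one; lia.
Qed.

Lemma ordN x : x != 0 -> ord (- x) = ord x.
Proof.
move=> x0; have n1 : (-1 : F) != 0 by rewrite oppr_eq0 oner_neq0.
have := ordMn0 n1 n1; rewrite mulrNN mulr1 ord_one => h.
by rewrite -mulN1r ordMn0//; lia.
Qed.

Lemma ordXn x n : x != 0 -> ord (x ^+ n) = ord x *+ n.
Proof.
move=> x0; elim: n => [|n IH]; first by rewrite expr0 mulr0n ord_one.
by rewrite exprS ordMn0 ?expf_neq0// IH mulrS.
Qed.

Lemma pi_exp_neq0 (n : int) : pi ^ n != 0.
Proof. by rewrite expfz_neq0// pi_neq0. Qed.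

Lemma ord_pi_exp (n : int) : ord (pi ^ n) = n.
Proof.
case: n => n; first by rewrite -exprnP ordXn ?pi_neq0// ord_pi; lia.
by rewrite NegzE -exprnN ordV ?expf_neq0 ?pi_neq0// ordXn ?pi_neq0// ord_pi; lia.
Qed.

Lemma in_Pn0 n : in_Pn n 0. Proof. by rewrite /Defs.in_Pn eqxx. Qed.

Lemma in_Pn_ord n x : x != 0 -> in_Pn n x = (n <= ord x).
Proof. by rewrite /Defs.in_Pn => /negPf ->. Qed.

Lemma in_Pn1 : in_Pn 0 1.
Proof. by rewrite in_Pn_ord ?oner_neq0// ord_one. Qed.

Lemma in_PnN n x : in_Pn n (- x) = in_Pn n x.
Proof.
have [->|x0] := eqVneq x 0; first by rewrite oppr0.
by rewrite !in_Pn_ord ?oppr_eq0// ordN.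
Qed.

Lemma in_Pn_sign (b : bool) : in_Pn 0 ((-1) ^+ b).
Proof. by case: b; rewrite ?expr1 ?expr0 ?in_PnN in_Pn1. Qed.

Lemma in_PnD n x y : in_Pn n x -> in_Pn n y -> in_Pn n (x + y).
Proof.
have [->|x0] := eqVneq x 0; first by rewrite add0r.
have [->|y0] := eqVneq y 0; first by rewrite addr0.
have [->|xy0] := eqVneq (x + y) 0; first by rewrite in_Pn0.
rewrite !in_Pn_ord// => h1 h2; apply: le_trans (ordD hF x0 y0 xy0).
by rewrite le_min h1 h2.
Qed.

Lemma in_PnB n x y : in_Pn n x -> in_Pn n y -> in_Pn n (x - y).
Proof. by move=> hx hy; apply: in_PnD => //; rewrite in_PnN. Qed.

Lemma in_PnM m n x y : in_Pn m x -> in_Pn n y -> in_Pn (m + n) (x * y).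
Proof.
have [->|x0] := eqVneq x 0; first by rewrite mul0r !in_Pn0.
have [->|y0] := eqVneq y 0; first by rewrite mulr0 !in_Pn0.
by rewrite !in_Pn_ord ?mulf_neq0// ordMn0// => h1 h2; lia.
Qed.

Lemma in_Pn_le m n x : m <= n -> in_Pn n x -> in_Pn m x.
Proof.
have [->|x0] := eqVneq x 0; first by rewrite !in_Pn0.
by rewrite !in_Pn_ord// => h1 h2; lia.
Qed.

Lemma in_PnMeq k m n x y : k <= m + n -> in_Pn m x -> in_Pn n y -> in_Pn k (x * y).
Proof. by move=> h hx hy; apply: (in_Pn_le h); apply: in_PnM. Qed.

Lemma in_Pn_pi n : in_Pn n (pi ^ n).
Proof. by rewrite in_Pn_ord ?pi_exp_neq0// ord_pi_exp. Qed.

Lemma in_Pn_piM m n x : in_Pn n (pi ^ m * x) = in_Pn (n - m) x.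
Proof.
have [->|x0] := eqVneq x 0; first by rewrite mulr0 !in_Pn0.
by rewrite !in_Pn_ord ?mulf_neq0 ?pi_exp_neq0// ordMn0 ?pi_exp_neq0// ord_pi_exp; lia.
Qed.

Lemma in_Pn_sum n (I : Type) (r : seq I) (P : pred I) (f : I -> F) :
  (forall i, P i -> in_Pn n (f i)) -> in_Pn n (\sum_(i <- r | P i) f i).
Proof.
by move=> h; elim/big_ind: _ => //; [exact: in_Pn0 | move=> x y; exact: in_PnD].
Qed.

Lemma in_Pn_prod (I : Type) (r : seq I) (P : pred I) (f : I -> F) :
  (forall i, P i -> in_Pn 0 (f i)) -> in_Pn 0 (\prod_(i <- r | P i) f i).
Proof.
move=> h; elim/big_ind: _ => //; [exact: in_Pn1 | move=> x y; exact: in_PnMeq].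
Qed.

Definition unitO (x : F) := x != 0 /\ ord x = 0.

Lemma unitO_in x : unitO x -> in_Pn 0 x.
Proof. by case=> x0 ox; rewrite in_Pn_ord// ox. Qed.

Lemma unitOM x y : unitO x -> unitO y -> unitO (x * y).
Proof. by move=> [x0 ox] [y0 oy]; split; rewrite ?mulf_neq0// ordMn0// ox oy. Qed.

Lemma unitOV x : unitO x -> unitO x^-1.
Proof. by move=> [x0 ox]; split; rewrite ?invr_eq0// ordV// ox. Qed.

Lemma unitON x : unitO x -> unitO (- x).
Proof. by move=> [x0 ox]; split; rewrite ?oppr_eq0// ordN. Qed.

Lemma unitO1 : unitO 1.
Proof. by split; [exact: oner_neq0|exact: ord_one]. Qed.

Lemma unitOP x : in_Pn 0 x -> ~~ in_Pn 1 x -> unitO x.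
Proof.
have [->|x0] := eqVneq x 0; first by rewrite !in_Pn0.
by rewrite !in_Pn_ord// => h1 h2; split => //; lia.
Qed.

Lemma unitO_notP x : unitO x -> ~~ in_Pn 1 x.
Proof. by move=> [x0 ox]; rewrite in_Pn_ord// ox. Qed.

Lemma unitO_MP x y : in_Pn 0 x -> in_Pn 0 y -> unitO (x * y) -> unitO x /\ unitO y.
Proof.
move=> hx hy u; have := unitO_notP u.
case: (boolP (in_Pn 1 x)) => [x1|x1]; first by rewrite (in_PnMeq _ x1 hy).
case: (boolP (in_Pn 1 y)) => [y1|y1]; first by rewrite (in_PnMeq _ hx y1).
by split; apply: unitOP.
Qed.

Lemma unitOD x y : unitO x -> in_Pn 1 y -> unitO (x + y).
Proof.
move=> ux hy; apply: unitOP.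
  by apply: in_PnD; [exact: unitO_in|exact: in_Pn_le hy].
apply/negP => h; have := unitO_notP ux; rewrite -[x](addrK y).
by rewrite in_PnB.
Qed.

Lemma unitO_divP n x y : unitO x -> in_Pn n y -> in_Pn n (y / x).
Proof. by move=> ux hy; rewrite (in_PnMeq _ hy (unitO_in (unitOV ux)))//; lia. Qed.

Lemma unitO_mulP n x y : unitO x -> in_Pn n (x * y) -> in_Pn n y.
Proof.
move=> ux h; have -> : y = (x * y) / x by rewrite mulrAC divff ?mul1r//; case: ux.
exact: unitO_divP.
Qed.

Lemma ord_decomp x : x != 0 -> exists2 u, unitO u & x = u * pi ^ ord x.
Proof.
move=> x0; exists (x / pi ^ ord x); last by rewrite divfK// pi_exp_neq0.
have p0 := pi_exp_neq0 (ord x); split; first by rewrite mulf_neq0 ?invr_eq0.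
by rewrite ordMn0 ?invr_eq0// ordV// ord_pi_exp subrr.
Qed.

Section Matrices.
Variables (m n : nat).
Definition mxin (k : int) (M : 'M[F]_(m, n)) := forall i j, in_Pn k (M i j).
End Matrices.

Lemma mxinM m n p k l (A : 'M_(m, n)) (B : 'M_(n, p)) :
  mxin k A -> mxin l B -> mxin (k + l) (A *m B).
Proof. by move=> hA hB i j; rewrite mxE; apply: in_Pn_sum => r _; apply: in_PnM. Qed.

Lemma mxinMeq m n p r k l (A : 'M_(m, n)) (B : 'M_(n, p)) :
  r <= k + l -> mxin k A -> mxin l B -> mxin r (A *m B).
Proof. by move=> h hA hB i j; apply: (in_Pn_le h); apply: mxinM. Qed.

Lemma mxinD m n k (A B : 'M_(m, n)) : mxin k A -> mxin k B -> mxin k (A + B).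
Proof. by move=> hA hB i j; rewrite mxE in_PnD. Qed.

Lemma mxinN m n k (A : 'M_(m, n)) : mxin k A -> mxin k (- A).
Proof. by move=> hA i j; rewrite mxE in_PnN. Qed.

Lemma mxinB m n k (A B : 'M_(m, n)) : mxin k A -> mxin k B -> mxin k (A - B).
Proof. by move=> hA hB; apply: mxinD => //; apply: mxinN. Qed.

Lemma mxinZ m n k l r c (A : 'M_(m, n)) : r <= k + l -> in_Pn k c -> mxin l A -> mxin r (c *: A).
Proof. by move=> h hc hA i j; rewrite mxE (in_PnMeq h). Qed.

Lemma mxin_le m n k l (A : 'M_(m, n)) : k <= l -> mxin l A -> mxin k A.
Proof. by move=> h hA i j; apply: (in_Pn_le h). Qed.

Lemma mxin_scalar n k c : in_Pn k c -> mxin k (c%:M : 'M_n).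
Proof. by move=> h i j; rewrite mxE; case: (i == j); rewrite ?mulr1n ?mulr0n// in_Pn0. Qed.

Lemma mxin1 n : mxin 0 (1%:M : 'M_n).
Proof. exact/mxin_scalar/in_Pn1. Qed.

Lemma mxin_det n (A : 'M_n) : mxin 0 A -> in_Pn 0 (\det A).
Proof.
move=> hA; rewrite /determinant; apply: in_Pn_sum => s _.
apply: (@in_PnMeq _ 0 0); rewrite ?addr0//; last exact: in_Pn_prod.
exact: in_Pn_sign.
Qed.

Lemma mxin_adj n (A : 'M_n) : mxin 0 A -> mxin 0 (\adj A).
Proof.
move=> hA i j; rewrite mxE /cofactor; apply: (@in_PnMeq _ 0 0); rewrite ?addr0//.
  by rewrite -signr_odd; exact: in_Pn_sign.
by apply: mxin_det => k l; rewrite !mxE.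
Qed.

Lemma GL4OP (A : 'M_4) : GL4O ord A <-> mxin 0 A /\ unitO (\det A).
Proof.
split=> [[uA hA hA']|[hA [d0 od]]].
  have hd := mxin_det hA; have hd' := mxin_det hA'.
  have d0 : \det A != 0 by rewrite -unitfE -unitmxE.
  split=> //; split=> //.
  move: hd hd'; rewrite det_inv !in_Pn_ord ?invr_eq0// ordV// => h1.
  by rewrite oppr_ge0 => h2; apply/eqP; rewrite eq_le h1 h2.
have uA : A \in unitmx by rewrite unitmxE unitfE.
split=> // i j; rewrite /invmx uA mxE.
by rewrite (@in_PnMeq _ 0 0) ?addr0 ?mxin_adj// unitO_in//; apply: unitOV.
Qed.

Lemma GL4O_unit A : GL4O ord A -> A \in unitmx. Proof. by case. Qed.

Lemma GL4OM A B : GL4O ord A -> GL4O ord B -> GL4O ord (A *m B).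
Proof.
move=> /GL4OP[hA dA] /GL4OP[hB dB]; apply/GL4OP; split; first exact: (mxinM hA hB).
by rewrite det_mulmx; apply: unitOM.
Qed.

Lemma GL4OV A : GL4O ord A -> GL4O ord (invmx A).
Proof. by case=> uA hA hA'; split; rewrite ?unitmx_inv ?invmxK. Qed.

Lemma GL4O1 : GL4O ord 1%:M.
Proof. by apply/GL4OP; rewrite det1; split; [exact: mxin1|exact: unitO1].  Qed.

Lemma GL4OZ u A : unitO u -> GL4O ord A -> GL4O ord (u *: A).
Proof.
move=> uu /GL4OP[hA dA]; apply/GL4OP; split; first exact: (mxinZ _ (unitO_in uu) hA).
rewrite detZ; apply: unitOM => //; case: uu => u0 ou.
by split; rewrite ?expf_neq0// ordXn// ou mul0rn.
Qed.

(** Laplace expansion along the first row: every term but the diagonal one contains an off-diagonal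
    entry, which lies in P, and the diagonal minor is again of the form 1 + A. *)
Lemma det_1P n (A : 'M_n) : mxin 1 A -> in_Pn 1 (\det (1%:M + A) - 1).
Proof.
elim: n A => [|n IH] A hA; first by rewrite det_mx00 subrr in_Pn0.
have h0 : mxin 0 (1%:M + A) by apply: mxinD; [exact: mxin1|exact: mxin_le hA].
rewrite (expand_det_row _ ord0) big_ord_recl /= addrAC; apply: in_PnD; last first.
  apply: in_Pn_sum => i _; apply: (@in_PnMeq _ 1 0) => //.
    by rewrite !mxE -val_eqE /= mulr0n add0r.
  have := mxin_adj h0 (lift ord0 i) ord0; by rewrite mxE.
rewrite !mxE eqxx mulr1n mulrDl mul1r addrAC; apply: in_PnD; last first.
  apply: (@in_PnMeq _ 1 0) => //; have := mxin_adj h0 ord0 ord0; by rewrite mxE.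
rewrite /cofactor addn0 expr0 mul1r.
have -> : row' ord0 (col' ord0 (1%:M + A)) = 1%:M + row' ord0 (col' ord0 A).
  by apply/matrixP => i j; rewrite !mxE.
by apply: IH => i j; rewrite !mxE.
Qed.

Lemma GL4O_1P (A : 'M_4) : mxin 1 (A - 1%:M) -> GL4O ord A.
Proof.
move=> h; have -> : A = 1%:M + (A - 1%:M) by rewrite addrC subrK.
apply/GL4OP; split; first by apply: mxinD; [exact: mxin1|exact: mxin_le h].
have := det_1P h; set D := \det _ => hD.
have -> : D = 1 + (D - 1) by ring.
by apply: unitOD => //; exact: unitO1.
Qed.

End Valuation.

(** * Similitudes and weights *)

Section Ord4.

Definition o0 : 'I_4 := @Ordinal 4 0 isT.
Definition o1 : 'I_4 := @Ordinal 4 1 isT.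
Definition o2 : 'I_4 := @Ordinal 4 2 isT.
Definition o3 : 'I_4 := @Ordinal 4 3 isT.

Lemma ord4_ind (P : 'I_4 -> Prop) : P o0 -> P o1 -> P o2 -> P o3 -> forall i, P i.
Proof.
move=> h0 h1 h2 h3 [[|[|[|[|i]]]] hi] //.
- by have -> : Ordinal hi = o0 by apply: val_inj.
- by have -> : Ordinal hi = o1 by apply: val_inj.
- by have -> : Ordinal hi = o2 by apply: val_inj.
- by have -> : Ordinal hi = o3 by apply: val_inj.
Qed.

Lemma sum4 (V : nmodType) (f : 'I_4 -> V) : \sum_i f i = f o0 + f o1 + f o2 + f o3.
Proof.
rewrite !big_ord_recl big_ord0 addr0 !addrA.
by congr (_ + _ + _ + _); congr f; apply: val_inj.
Qed.

Definition row4 (T : nmodType) (a b c d : T) : 'rV[T]_4 := \row_(i < 4) nth 0 [:: a; b; c; d] i.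

Lemma row4E (T : nmodType) (a : 'rV[T]_4) : a = row4 (a 0 o0) (a 0 o1) (a 0 o2) (a 0 o3).
Proof. by apply/matrixP => i; rewrite (ord1 i); apply: ord4_ind; rewrite mxE. Qed.

Variable F : fieldType.
Local Notation J := (Jmx F).
Implicit Types (g h s : 'M[F]_4).

(** The alternating form evaluated on column [i] of [g] and column [j] of [h]. *)
Definition pair g h (i j : 'I_4) : F :=
  g o0 i * h o3 j + g o1 i * h o2 j - g o2 i * h o1 j - g o3 i * h o0 j.

Lemma pairE g h i j : (g^T *m J *m h) i j = pair g h i j.
Proof.
rewrite mxE sum4 !mxE !sum4 !mxE /= /pair; ring.
Qed.

Definition simil (l : F) g := g^T *m J *m g = l *: J.

Lemma simil_eq l g : simil l g ->
  [/\ pair g g o0 o1 = 0, pair g g o0 o2 = 0, pair g g o0 o3 = l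
    & [/\ pair g g o1 o2 = l, pair g g o1 o3 = 0 & pair g g o2 o3 = 0]].
Proof.
by move=> h; do !split; rewrite -pairE h !mxE /= ?mulr0 ?mulr1.
Qed.

(** The form is alternating, so the six pairings above the diagonal determine the Gram matrix. *)
Lemma eq_simil l g : pair g g o0 o1 = 0 -> pair g g o0 o2 = 0 -> pair g g o0 o3 = l ->
  pair g g o1 o2 = l -> pair g g o1 o3 = 0 -> pair g g o2 o3 = 0 -> simil l g.
Proof.
have pC i j : pair g g j i = - pair g g i j by rewrite /pair; ring.
have p0 i : pair g g i i = 0 by rewrite /pair; ring.
move=> h1 h2 h3 h4 h5 h6; apply/matrixP.
apply: ord4_ind; apply: ord4_ind; rewrite pairE ?p0 !mxE /= ?mulr0 ?mulr1 ?mulrN1//;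
by rewrite pC ?h1 ?h2 ?h3 ?h4 ?h5 ?h6 ?oppr0.
Qed.

Lemma J2 : J *m J = - 1%:M.
Proof.
by apply/matrixP; apply: ord4_ind; apply: ord4_ind; rewrite mxE sum4 !mxE /=; ring.
Qed.

Lemma mulJ g i j : (J *m g) i j = if (i < 2)%N then g (rev_ord i) j else - g (rev_ord i) j.
Proof.
move: i j; apply: ord4_ind => j; rewrite mxE sum4 !mxE /= !(mul0r, mul1r, mulN1r, addr0, add0r).
- by congr (g _ _); apply: val_inj.
- by congr (g _ _); apply: val_inj.
- by congr (- g _ _); apply: val_inj.
- by congr (- g _ _); apply: val_inj.
Qed.

Lemma mul_J g i j : (g *m J) i j = if (j < 2)%N then - g i (rev_ord j) else g i (rev_ord j).
Proof.
move: j i; apply: ord4_ind => j; rewrite mxE sum4 !mxE /= !(mulr0, mulr1, mulrN1, addr0, add0r).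
- by congr (- g _ _); apply: val_inj.
- by congr (- g _ _); apply: val_inj.
- by congr (g _ _); apply: val_inj.
- by congr (g _ _); apply: val_inj.
Qed.

Lemma detJ_unit : \det J * \det J = 1.
Proof. by rewrite -det_mulmx J2 -scaleN1r detZ det1 mulr1 -signr_odd /= expr0. Qed.

Lemma detJ_neq0 : \det J != 0.
Proof.
apply/eqP => h; have := detJ_unit; rewrite h mul0r => /esym/eqP.
by rewrite oner_eq0.
Qed.

(** Taking determinants fixes [\det g] up to sign, which is enough to get its order as twice that of
    [l]. *)
Lemma simil_det l g : simil l g -> \det g ^+ 2 = l ^+ 4.
Proof.
move/(congr1 determinant); rewrite !det_mulmx det_tr detZ mulrAC -expr2.
by move/(mulIf detJ_neq0).
Qed.

Lemma GSp4P g : GSp4 g <-> exists2 l, l != 0 & simil l g.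
Proof.
split=> [[]//|[l l0 hl]]; split; last by exists l.
have : \det g ^+ 2 != 0 by rewrite (simil_det hl) expf_neq0.
by rewrite unitmxE unitfE expf_eq0.
Qed.

Lemma GSp4_unit g : GSp4 g -> g \in unitmx. Proof. by case. Qed.

Lemma similM l l' g h : simil l g -> simil l' h -> simil (l * l') (g *m h).
Proof.
rewrite /simil => hg hh.
have -> : (g *m h)^T *m J *m (g *m h) = h^T *m (g^T *m J *m g) *m h.
  by rewrite trmx_mul !mulmxA.
by rewrite hg -scalemxAr -scalemxAl hh scalerA.
Qed.

Lemma GSp4M g h : GSp4 g -> GSp4 h -> GSp4 (g *m h).
Proof.
move=> /GSp4P[l l0 hl] /GSp4P[l' l0' hl']; apply/GSp4P.
by exists (l * l'); [rewrite mulf_neq0|exact: similM].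
Qed.

Lemma similV l g : l != 0 -> simil l g -> simil l^-1 (invmx g).
Proof.
move=> l0 hl; have ug : g \in unitmx by apply: GSp4_unit; apply/GSp4P; exists l.
apply: (scalerI l0); rewrite scalerA divff// scale1r scalemxAl scalemxAr -hl.
by rewrite -!mulmxA mulmxV// mulmx1 !mulmxA -trmx_mul mulmxV// trmx1 mul1mx.
Qed.

Lemma GSp4V g : GSp4 g -> GSp4 (invmx g).
Proof.
move=> /GSp4P[l l0 hl]; apply/GSp4P; exists l^-1; first by rewrite invr_eq0.
exact: similV.
Qed.

Lemma simil1 : simil 1 1%:M.
Proof. by rewrite /simil trmx1 mul1mx mulmx1 scale1r. Qed.

Lemma GSp4_1 : GSp4 (1%:M : 'M[F]_4).
Proof. by apply/GSp4P; exists 1; [exact: oner_neq0|exact: simil1]. Qed.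

Lemma simil_scalar (a : F) : simil (a ^+ 2) a%:M.
Proof.
by rewrite /simil tr_scalar_mx mul_scalar_mx mul_mx_scalar scalerA -expr2.
Qed.

Lemma GSp4Z c g : c != 0 -> GSp4 g -> GSp4 (c *: g).
Proof.
move=> c0 hg; rewrite -mul_scalar_mx; apply: GSp4M => //.
by apply/GSp4P; exists (c ^+ 2); [rewrite expf_neq0|exact: simil_scalar].
Qed.

Lemma simil_inv l g : l != 0 -> simil l g -> invmx g = - l^-1 *: (J *m g^T *m J).
Proof.
move=> l0 hl; have ug : g \in unitmx by apply: GSp4_unit; apply/GSp4P; exists l.
apply: (can_inj (mulmxK ug)); rewrite mulVmx// -scalemxAl.
rewrite -!mulmxA [g^T *m _]mulmxA hl -scalemxAr J2 scalerA mulNr mulVf//.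
by rewrite scaleN1r opprK.
Qed.

End Ord4.

Definition wt (a : 'rV[int]_4) (i : 'I_4) : int := a 0 i.

Lemma wtD a b i : wt (a + b) i = wt a i + wt b i. Proof. exact: mxE. Qed.
Lemma wtN a i : wt (- a) i = - wt a i. Proof. exact: mxE. Qed.
Lemma wt_const k i : wt (const_mx k) i = k. Proof. exact: mxE. Qed.
Lemma wt_row4 (x y z t : int) :
  (wt (row4 x y z t) o0 = x) * (wt (row4 x y z t) o1 = y) *
  (wt (row4 x y z t) o2 = z) * (wt (row4 x y z t) o3 = t).
Proof. by rewrite /wt !mxE. Qed.

Section Weights.
Variables (F : fieldType) (ord : F -> int) (pi : F).
Hypotheses (hF : nonarch_local_field ord) (hpi : uniformizer ord pi).
Local Notation in_Pn := (in_Pn ord).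
Implicit Types (g h s : 'M[F]_4) (a b : 'rV[int]_4).

Local Notation pi0 := (pi_neq0 hpi).

Lemma ord_det l g : l != 0 -> simil l g -> ord (\det g) = ord l *+ 2.
Proof.
move=> l0 hl; have ug : \det g != 0.
  by rewrite -unitfE -unitmxE; apply: GSp4_unit; apply/GSp4P; exists l.
have := congr1 ord (simil_det hl); rewrite !(ordXn hF)//; lia.
Qed.

Definition td a : 'M[F]_4 := diag_mx (map_mx (fun k => pi ^ k) a).

Lemma tdE a i j : td a i j = pi ^ wt a i *+ (i == j).
Proof. by rewrite /wt !mxE. Qed.

Lemma mul_td a (A : 'M[F]_4) i j : (td a *m A) i j = pi ^ wt a i * A i j.
Proof. by rewrite mul_diag_mx !mxE /wt. Qed.

Lemma mul_mx_td a (A : 'M[F]_4) i j : (A *m td a) i j = A i j * pi ^ wt a j.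
Proof. by rewrite mul_mx_diag !mxE /wt. Qed.

Lemma tdD a b : td (a + b) = td a *m td b.
Proof.
apply/matrixP => i j; rewrite mul_td !tdE wtD exprzDr ?unitfE ?pi0//.
by case: eqP; rewrite ?mulr1n ?mulr0n ?mulr0.
Qed.

Lemma td0 : td 0 = 1%:M.
Proof. by apply/matrixP => i j; rewrite tdE /wt !mxE expr0z. Qed.

Lemma td_const k : td (const_mx k) = (pi ^ k)%:M.
Proof. by apply/matrixP => i j; rewrite tdE wt_const !mxE. Qed.

Lemma td_unit a : td a \in unitmx.
Proof. by case: (@mulmx1_unit _ _ (td a) (td (- a))); rewrite -?tdD ?subrr ?td0. Qed.

Lemma tdN a : td (- a) = invmx (td a).
Proof.
by apply: (can_inj (mulmxK (td_unit a))); rewrite -tdD addNr td0 mulVmx// td_unit.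
Qed.

Lemma td_simil a l : wt a o0 + wt a o3 = l -> wt a o1 + wt a o2 = l -> simil (pi ^ l) (td a).
Proof.
by move=> h1 h2; apply: eq_simil; rewrite /pair !tdE /= ?mulr1n ?mulr0n
  ?mul0r ?mulr0 ?subr0 ?addr0 ?add0r -?exprzDr ?unitfE ?pi0// ?h1 ?h2.
Qed.

(** Integrality of the conjugate of [s] by [td a], written entrywise. Together with [unitdet] it
    says that [s] stabilizes the lattice of weights [a]. *)
Definition inw a s := forall i j, in_Pn (wt a i - wt a j) (s i j).

Lemma inwE a s : inw a s <-> mxin ord 0 (invmx (td a) *m s *m td a).
Proof.
rewrite -tdN; split=> h i j.
  rewrite mul_mx_td mul_td mulrC mulrA -exprzDr ?unitfE ?pi0// (in_Pn_piM hF hpi).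
  rewrite wtN; apply: in_Pn_le (h i j). lia.
have := h i j; rewrite mul_mx_td mul_td mulrC mulrA -exprzDr ?unitfE ?pi0// (in_Pn_piM hF hpi).
by rewrite wtN; apply: in_Pn_le; lia.
Qed.

Lemma inwM a s s' : inw a s -> inw a s' -> inw a (s *m s').
Proof.
move=> hs hs' i j; rewrite mxE; apply: (in_Pn_sum hF) => k _.
by apply: (in_PnMeq hF _ (hs i k) (hs' k j)); lia.
Qed.

Definition unitdet s := unitO ord (\det s).

Lemma unitdet_unit s : unitdet s -> s \in unitmx.
Proof. by case; rewrite unitmxE unitfE. Qed.

Lemma unitdetM s s' : unitdet s -> unitdet s' -> unitdet (s *m s').
Proof. by rewrite /unitdet det_mulmx; exact: unitOM. Qed.

Lemma unitdetV s : unitdet s -> unitdet (invmx s).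
Proof. by move=> h; rewrite /unitdet det_inv; apply: unitOV. Qed.

Lemma inw_GL4O a s : inw a s -> unitdet s -> GL4O ord (invmx (td a) *m s *m td a).
Proof.
move=> /inwE h u; apply/(GL4OP hF); split=> //.
have t0 : \det (td a) != 0 by rewrite -unitfE -unitmxE td_unit.
by rewrite !det_mulmx det_inv mulrC mulrA divff// mul1r.
Qed.

Lemma inwV a s : inw a s -> unitdet s -> inw a (invmx s).
Proof.
move=> h u; apply/inwE; have [_ _] := inw_GL4O h u.
by rewrite !invmxM ?invmxK ?unitmx_mul ?unitmx_inv ?td_unit ?(unitdet_unit u)// mulmxA.
Qed.

Lemma inw1 a : inw a 1%:M.
Proof.
move=> p q; rewrite mxE; case: eqP => [->|_]; rewrite ?mulr0n ?(in_Pn0 ord)// subrr.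
exact: (in_Pn1 hF).
Qed.

Lemma inw_add_const a k s : inw a s -> inw (a + const_mx k) s.
Proof. by move=> h i j; rewrite !wtD !wt_const; apply: in_Pn_le (h i j); lia. Qed.

(** The weights of the dual lattice for the alternating form: the Gram matrix pairs the coordinates
    i and 3 - i. *)
Definition dualw a := row4 (- wt a o3) (- wt a o2) (- wt a o1) (- wt a o0).

Lemma simil_unitdet l s : l != 0 -> simil l s -> unitdet s <-> ord l = 0.
Proof.
move=> l0 hl; have ug : \det s != 0.
  by rewrite -unitfE -unitmxE; apply: GSp4_unit; apply/GSp4P; exists l.
rewrite /unitdet /unitO (ord_det l0 hl); split=> [[_]|h]; first by lia.
by split=> //; rewrite h.
Qed.

Lemma inw_dual a s : GSp4 s -> unitdet s -> inw a s -> inw (dualw a) s.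
Proof.
move=> /GSp4P[l l0 hl] us hs.
have ol : ord l = 0 by apply/(simil_unitdet l0 hl).
have ul : unitO ord l by split.
have := inwV hs us; rewrite (simil_inv l0 hl) => h.
have key i j : in_Pn (wt a i - wt a j) ((Jmx F *m s^T *m Jmx F) i j).
  apply: (unitO_mulP hF (unitON hF (unitOV hF ul))).
  by have := h i j; rewrite mxE.
have {}key i j : in_Pn (wt a (rev_ord j) - wt a (rev_ord i)) (s i j).
  have := key (rev_ord j) (rev_ord i); rewrite mul_J mulJ mxE !rev_ordK.
  by do 2![case: ifP => _]; rewrite ?in_PnN.
have wd i : wt (dualw a) i = - wt a (rev_ord i).
  by move: i; apply: ord4_ind; rewrite /dualw wt_row4; congr (- wt a _); apply: val_inj.
by move=> i j; rewrite !wd opprK addrC.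
Qed.

End Weights.

(** * The congruence subgroups P_1 and P_2 *)

Section Parahoric.
Variables (F : fieldType) (ord : F -> int) (pi : F).
Hypotheses (hF : nonarch_local_field ord) (hpi : uniformizer ord pi).
Local Notation in_Pn := (in_Pn ord).
Local Notation unitO := (unitO ord).
Local Notation inw := (inw ord).
Local Notation unitdet := (unitdet ord).
Implicit Types (g h s : 'M[F]_4) (a b : 'rV[int]_4).

(** [w1] and [w2] are the weights of the translations diag(1, 1, pi, pi) and diag(1, pi, pi, pi^2).
    [wl] and [wl'] describe neighbours of the standard lattice along an axis and are dual to each
    other up to homothety. *)
Definition w1 : 'rV[int]_4 := row4 0 0 1 1.
Definition w2 : 'rV[int]_4 := row4 0 1 1 2.
Definition wl : 'rV[int]_4 := row4 0 1 1 1.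
Definition wl' : 'rV[int]_4 := row4 0 0 0 1.

Definition GSp1 s := GSp4 s /\ unitdet s.

Lemma GSp1_1 : GSp1 1%:M.
Proof. by split; [exact: GSp4_1|rewrite /(unitdet _) det1; exact: unitO1]. Qed.

Lemma GSp1M s s' : GSp1 s -> GSp1 s' -> GSp1 (s *m s').
Proof. by move=> [h u] [h' u']; split; [exact: GSp4M|exact: (unitdetM hF)]. Qed.

Lemma GSp1V s : GSp1 s -> GSp1 (invmx s).
Proof. by move=> [h u]; split; [exact: GSp4V|exact: (unitdetV hF)]. Qed.

Lemma simil1_GSp1 u s : unitO u -> simil u s -> GSp1 s.
Proof.
by move=> [l0 ol] hl; split; [apply/GSp4P; exists u|apply/(simil_unitdet hF l0 hl)].
Qed.

Lemma GSp1P s : GSp1 s <-> exists2 l, unitO l & simil l s.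
Proof.
split=> [[/GSp4P[l l0 hl] us]|[l ul hl]]; last exact: simil1_GSp1 hl.
by exists l => //; split=> //; apply/(simil_unitdet hF l0 hl).
Qed.

Lemma KmaxP s : Kmax ord s <-> GSp1 s /\ inw 0 s.
Proof.
have h0 : inw 0 s <-> mxin ord 0 s by split=> h i j; have := h i j; rewrite /wt !mxE.
split=> [[hs /(GL4OP hF)[h u]]|[[hs u] /h0 h]]; first by split=> //; apply/h0.
by split=> //; apply/(GL4OP hF).
Qed.

(* [par a s] says that [s] stabilizes the lattices of weights [0] and [a]. *)
Definition par a s := [/\ GSp1 s, inw 0 s & inw a s].

Lemma parM a s s' : par a s -> par a s' -> par a (s *m s').
Proof.
by move=> [h1 h2 h3] [h1' h2' h3']; split; [exact: GSp1M|exact: (inwM hF)|exact: (inwM hF)].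
Qed.

Lemma parV a s : par a s -> par a (invmx s).
Proof.
move=> [h1 h2 h3]; have [_ u] := h1.
by split; [exact: GSp1V|exact: (inwV hF hpi)|exact: (inwV hF hpi)].
Qed.

(** Modulo P the matrix is block upper triangular, and the similitude relations between the two
    diagonal blocks make the product of their determinants congruent to the square of the similitude
    factor, a unit. *)
Lemma minors_unit s : GSp1 s -> inw 0 s -> inw w1 s ->
  unitO (s o0 o0 * s o1 o1 - s o1 o0 * s o0 o1).
Proof.
move=> /GSp1P[l ul hl] h0 h1.
have O i j : in_Pn 0 (s i j) by have := h0 i j; rewrite /wt !mxE.
have [p20 p21 p30 p31] : [/\ in_Pn 1 (s o2 o0), in_Pn 1 (s o2 o1), in_Pn 1 (s o3 o0)
    & in_Pn 1 (s o3 o1)].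
  by split; [have := h1 o2 o0|have := h1 o2 o1|have := h1 o3 o0|have := h1 o3 o1];
    rewrite !wt_row4.
have [_ e02 e03 [e12 e13 _]] := simil_eq hl; move: e02 e03 e12 e13; rewrite /pair => e02 e03 e12 e13.
set D := (X in unitO X).
pose D' := s o3 o3 * s o2 o2 - s o2 o3 * s o3 o2.
have OD : in_Pn 0 D by apply: (in_PnB hF); apply: (in_PnMeq hF _ (O _ _) (O _ _)).
have OD' : in_Pn 0 D' by apply: (in_PnB hF); apply: (in_PnMeq hF _ (O _ _) (O _ _)).
have Pl i j k m : in_Pn 1 (s i j) -> in_Pn 1 (s i j * s k m).
  by move=> h; apply: (in_PnMeq hF _ h (O _ _)).
pose e1 := s o2 o0 * s o1 o3 + s o3 o0 * s o0 o3.
pose e2 := s o2 o1 * s o1 o2 + s o3 o1 * s o0 o2.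
pose e3 := s o2 o0 * s o1 o2 + s o3 o0 * s o0 o2.
pose e4 := s o2 o1 * s o1 o3 + s o3 o1 * s o0 o3.
have E1 : in_Pn 1 e1 by apply: (in_PnD hF); apply: Pl.
have E2 : in_Pn 1 e2 by apply: (in_PnD hF); apply: Pl.
have E3 : in_Pn 1 e3 by apply: (in_PnD hF); apply: Pl.
have E4 : in_Pn 1 e4 by apply: (in_PnD hF); apply: Pl.
have key : D * D' = l * l + (l * e2 + e1 * (l + e2) - e3 * e4).
  have -> : l * l + (l * e2 + e1 * (l + e2) - e3 * e4) = (l + e1) * (l + e2) - e3 * e4 by ring.
  rewrite -{1}e03 -e12.
  rewrite (_ : e3 = s o0 o0 * s o3 o2 + s o1 o0 * s o2 o2); last first.
    by apply/eqP; rewrite eq_sym -subr_eq0 -[X in _ == X]e02 /e3; apply/eqP; ring.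
  rewrite (_ : e4 = s o0 o1 * s o3 o3 + s o1 o1 * s o2 o3); last first.
    by apply/eqP; rewrite eq_sym -subr_eq0 -[X in _ == X]e13 /e4; apply/eqP; ring.
  by rewrite /D /D' /e1 /e2; ring.
have Ol := unitO_in ul.
suff /(unitO_MP hF OD OD')[] : unitO (D * D') by [].
rewrite key; apply: (unitOD hF); first exact: unitOM.
apply: (in_PnB hF); last by apply: (in_PnMeq hF _ E3 E4).
apply: (in_PnD hF); first by apply: (in_PnMeq hF _ Ol E2).
by apply: (in_PnMeq hF _ E1 (in_PnD hF Ol (in_Pn_le _ E2))).
Qed.

Lemma mulmx4 g h i j : (g *m h) i j =
  g i o0 * h o0 j + g i o1 * h o1 j + g i o2 * h o2 j + g i o3 * h o3 j.
Proof. by rewrite mxE sum4. Qed.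

Lemma s1_simil : simil 1 (s1 F).
Proof. by apply: eq_simil; rewrite /pair !mxE /=; ring. Qed.

Lemma s2_simil : simil 1 (s2 F).
Proof. by apply: eq_simil; rewrite /pair !mxE /=; ring. Qed.

Ltac four i := move: i; apply: ord4_ind.
Ltac four2 i j := move: i j; apply: ord4_ind; apply: ord4_ind.

Lemma s1_par : par w1 (s1 F).
Proof.
split; first exact: simil1_GSp1 (unitO1 hF) s1_simil.
  by move=> i j; four2 i j; rewrite /wt !mxE /= ?(in_Pn0 ord) ?(in_Pn1 hF).
by move=> i j; four2 i j; rewrite !wt_row4 !mxE /= ?(in_Pn0 ord) ?(in_Pn1 hF).
Qed.

Lemma s2_par : par wl (s2 F).
Proof.
split; first exact: simil1_GSp1 (unitO1 hF) s2_simil.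
  by move=> i j; four2 i j; rewrite /wt !mxE /= ?(in_PnN hF) ?(in_Pn0 ord) ?(in_Pn1 hF).
by move=> i j; four2 i j; rewrite !wt_row4 !mxE /= ?(in_PnN hF) ?(in_Pn0 ord) ?(in_Pn1 hF)//.
Qed.

Lemma Iwahori_par1 s : Iwahori ord s -> par w1 s.
Proof.
move=> [/KmaxP[h h0] hl]; split=> // i j.
by four2 i j; rewrite !wt_row4; try (by apply: hl); apply: in_Pn_le (h0 _ _); rewrite /wt !mxE.
Qed.

Lemma Iwahori_par2 s : Iwahori ord s -> par wl s.
Proof.
move=> [/KmaxP[h h0] hl]; split=> // i j.
by four2 i j; rewrite !wt_row4; try (by apply: hl); apply: in_Pn_le (h0 _ _); rewrite /wt !mxE.
Qed.

Lemma inw0E s i j : inw 0 s -> in_Pn 0 (s i j).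
Proof. by move=> h; have := h i j; rewrite /wt !mxE. Qed.

Lemma par_inwl' s : par wl s -> inw wl' s.
Proof.
move=> [[h u] _ hl]; have := inw_add_const 1 (inw_dual hF hpi h u hl).
by move=> H i j; have := H i j; apply: in_Pn_le; rewrite !wtD !wt_const /dualw;
  four2 i j; rewrite !wt_row4.
Qed.

(** Stabilizing both lattices takes care of all entries below the diagonal except (1,0) and (3,2).
    Orthogonality of columns 0 and 2 carries the condition from the former to the latter, since the
    entry (0,0) is a unit. *)
Lemma par1_Iwahori s : par w1 s -> in_Pn 1 (s o1 o0) -> Iwahori ord s.
Proof.
move=> [h h0 h1] p10; split; first exact/KmaxP.
have O i j := @inw0E s i j h0.
have ua : unitO (s o0 o0).
  have : unitO (s o0 o0 * s o1 o1).
    rewrite -[X in unitO X](subrK (s o1 o0 * s o0 o1)); apply: (unitOD hF).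
      exact: minors_unit.
    exact: (in_PnMeq hF _ p10 (O _ _)).
  by case/(unitO_MP hF (O _ _) (O _ _)).
have p30 : in_Pn 1 (s o3 o0) by have := h1 o3 o0; rewrite !wt_row4.
have p20 : in_Pn 1 (s o2 o0) by have := h1 o2 o0; rewrite !wt_row4.
have p32 : in_Pn 1 (s o3 o2).
  apply: (unitO_mulP hF ua); case/GSp1P: h => l _ /simil_eq[_ e02 _ _].
  have -> : s o0 o0 * s o3 o2 = - (s o1 o0 * s o2 o2) + s o2 o0 * s o1 o2 + s o3 o0 * s o0 o2.
    by move: e02; rewrite /pair => e02; apply/eqP; rewrite -subr_eq0 -[X in _ == X]e02; apply/eqP; ring.
  by apply: (in_PnD hF); first (apply: (in_PnD hF); first rewrite (in_PnN hF));
    apply: (in_PnMeq hF _ _ (O _ _)); try eassumption.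
move=> i j; four2 i j => //= _; have := h1; [move/(_ o2 o1)|move/(_ o3 o1)];
by rewrite !wt_row4.
Qed.

Lemma par2_Iwahori s : par wl s -> in_Pn 1 (s o2 o1) -> Iwahori ord s.
Proof.
move=> hs p21; have hl' := par_inwl' hs; case: hs => h h0 hl.
split; first exact/KmaxP.
move=> i j; four2 i j => //= _.
- by have := hl o1 o0; rewrite !wt_row4.
- by have := hl o2 o0; rewrite !wt_row4.
- by have := hl o3 o0; rewrite !wt_row4.
- by have := hl' o3 o1; rewrite !wt_row4.
- by have := hl' o3 o2; rewrite !wt_row4.
Qed.

(** Unipotent elements for the two simple roots, whose reflections are [s1] and [s2]. *)
Definition x12 (t : F) := mx4 [:: [:: 1; t; 0; 0]; [:: 0; 1; 0; 0]; [:: 0; 0; 1; - t]; [:: 0; 0; 0; 1]].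
Definition x23 (t : F) := mx4 [:: [:: 1; 0; 0; 0]; [:: 0; 1; t; 0]; [:: 0; 0; 1; 0]; [:: 0; 0; 0; 1]].

Lemma x12_simil t : simil 1 (x12 t).
Proof. by apply: eq_simil; rewrite /pair !mxE /=; ring. Qed.

Lemma x23_simil t : simil 1 (x23 t).
Proof. by apply: eq_simil; rewrite /pair !mxE /=; ring. Qed.

Lemma x12_Iwahori t : in_Pn 0 t -> Iwahori ord (x12 t).
Proof.
move=> ht; split.
  apply/KmaxP; split; first exact: simil1_GSp1 (unitO1 hF) (x12_simil t).
  by move=> i j; four2 i j; rewrite /wt !mxE /= ?(in_PnN hF) ?(in_Pn0 ord) ?(in_Pn1 hF).
by move=> i j; four2 i j => //= _; rewrite !mxE /= ?(in_Pn0 ord).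
Qed.

Lemma x23_Iwahori t : in_Pn 0 t -> Iwahori ord (x23 t).
Proof.
move=> ht; split.
  apply/KmaxP; split; first exact: simil1_GSp1 (unitO1 hF) (x23_simil t).
  by move=> i j; four2 i j; rewrite /wt !mxE /= ?(in_PnN hF) ?(in_Pn0 ord) ?(in_Pn1 hF).
by move=> i j; four2 i j => //= _; rewrite !mxE /= ?(in_Pn0 ord).
Qed.

(** This is the Bruhat decomposition of GL_2 of the residue field, applied to the upper left block:
    either its entry (1,0) vanishes modulo P, or it lies in the big cell. *)
Lemma P1E s : P1 ord s <-> par w1 s.
Proof.
split=> [[/Iwahori_par1//|[a [b [/Iwahori_par1 ha /Iwahori_par1 hb ->]]]]|hs].
  by do 2!apply: parM => //; exact: s1_par.
have [p10|p10] := boolP (in_Pn 1 (s o1 o0)); first by left; apply: par1_Iwahori.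
right; have [h h0 h1] := hs.
have u10 : unitO (s o1 o0) by apply: unitOP => //; exact: inw0E.
(* Multiplying on the left by the inverse of [x12 t] kills the entry (0,0), which [s1] then moves to
   position (1,0). *)
pose t := s o0 o0 / s o1 o0.
have ht : in_Pn 0 t by apply: (unitO_divP hF) => //; exact: inw0E.
have hx := x12_Iwahori ht; have hx' := Iwahori_par1 hx.
have ux : x12 t \in unitmx by case: hx' => [[/GSp4_unit]].
have us1 : s1 F \in unitmx by case: s1_par => [[/GSp4_unit]].
exists (x12 t), (invmx (s1 F) *m (invmx (x12 t) *m s)); split=> //; last first.
  by rewrite -mulmxA mulKVmx// mulKVmx.
apply: par1_Iwahori.
  apply: parM; first by apply: parV; exact: s1_par.
  by apply: parM => //; exact: parV.
have -> : invmx (s1 F) = s1 F.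
  rewrite (simil_inv (oner_neq0 _) s1_simil); apply/matrixP => i j.
  by rewrite mxE mul_J mulJ; four2 i j; rewrite !mxE /= ?invr1; ring.
have -> : invmx (x12 t) = x12 (- t).
  rewrite (simil_inv (oner_neq0 _) (x12_simil t)); apply/matrixP => i j.
  by rewrite mxE mul_J mulJ; four2 i j; rewrite !mxE /= ?invr1; ring.
rewrite !mulmx4 !mxE /= !(mul0r, mul1r, add0r, addr0).
rewrite mulNr divfK ?subrr ?(in_Pn0 ord)//; by case: u10.
Qed.

Lemma P2E s : P2 ord s <-> par wl s.
Proof.
split=> [[/Iwahori_par2//|[a [b [/Iwahori_par2 ha /Iwahori_par2 hb ->]]]]|hs].
  by do 2!apply: parM => //; exact: s2_par.
have [p10|p10] := boolP (in_Pn 1 (s o2 o1)); first by left; apply: par2_Iwahori.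
right; have [h h0 h1] := hs.
have u10 : unitO (s o2 o1) by apply: unitOP => //; exact: inw0E.
pose t := s o1 o1 / s o2 o1.
have ht : in_Pn 0 t by apply: (unitO_divP hF) => //; exact: inw0E.
have hx := x23_Iwahori ht; have hx' := Iwahori_par2 hx.
have ux : x23 t \in unitmx by case: hx' => [[/GSp4_unit]].
have us1 : s2 F \in unitmx by case: s2_par => [[/GSp4_unit]].
exists (x23 t), (invmx (s2 F) *m (invmx (x23 t) *m s)); split=> //; last first.
  by rewrite -mulmxA mulKVmx// mulKVmx.
apply: par2_Iwahori.
  apply: parM; first by apply: parV; exact: s2_par.
  by apply: parM => //; exact: parV.
have -> : invmx (s2 F) = (s2 F)^T.
  rewrite (simil_inv (oner_neq0 _) s2_simil); apply/matrixP => i j.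
  by rewrite mxE mul_J mulJ; four2 i j; rewrite !mxE /= ?invr1; ring.
have -> : invmx (x23 t) = x23 (- t).
  rewrite (simil_inv (oner_neq0 _) (x23_simil t)); apply/matrixP => i j.
  by rewrite mxE mul_J mulJ; four2 i j; rewrite !mxE /= ?invr1; ring.
rewrite !mulmx4 !mxE /= !(mul0r, mul1r, add0r, addr0).
rewrite mulNr divfK ?subrr ?(in_Pn0 ord)//; by case: u10.
Qed.

End Parahoric.

(** * Vertices and edges of the building *)

Section Vertices.
Variables (F : fieldType) (ord : F -> int) (pi : F).
Hypotheses (hF : nonarch_local_field ord) (hpi : uniformizer ord pi).
Local Notation in_Pn := (in_Pn ord).
Local Notation unitO := (unitO ord).
Local Notation inw := (inw ord).
Local Notation unitdet := (unitdet ord).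
Local Notation GSp1 := (GSp1 ord).
Local Notation td := (td pi).
Local Notation GL4O := (GL4O ord).
Implicit Types (g h s : 'M[F]_4) (a b : 'rV[int]_4).

Definition vtx g := hclass (span_cols ord g).

Lemma span_subP g h : g \in unitmx ->
  span_cols ord h `<=` span_cols ord g <-> mxin ord 0 (invmx g *m h).
Proof.
move=> ug; split=> [sub i j|sub _ [x hx <-]].
  have [|y hy e] := sub (h *m (col j 1%:M)).
    by exists (col j 1%:M) => // k; have := mxin1 hF (n := 4) k j; rewrite !mxE.
  have -> : (invmx g *m h) i j = (invmx g *m (h *m col j 1%:M)) i 0.
    by rewrite mulmxA colE mul1mx -colE [RHS]mxE.
  by rewrite -e mulKmx.
exists (invmx g *m (h *m x)); last by rewrite mulKVmx.
by move=> i; rewrite mulmxA; apply: (mxinM hF sub (l := 0)) => k l; rewrite (ord1 l).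
Qed.

Lemma dilate_span c g : dilate c (span_cols ord g) = span_cols ord (c *: g).
Proof.
apply/seteqP; split=> [_ [_ [x hx <-] <-]|_ [x hx <-]].
  by exists x => //; rewrite scalemxAl.
by exists (g *m x); [exists x|rewrite scalemxAl].
Qed.

Lemma span_eqP g h : g \in unitmx -> h \in unitmx ->
  span_cols ord g = span_cols ord h <-> GL4O (invmx g *m h).
Proof.
move=> ug uh; split=> [e|[_ h1 h2]].
  split; first by rewrite unitmx_mul unitmx_inv ug.
    by apply/span_subP => //; rewrite e.
  suff : mxin ord 0 (invmx (invmx g *m h)) by [].
  rewrite invmxM ?unitmx_inv// invmxK.
  by apply/span_subP => //; rewrite e.
have {}h2 : mxin ord 0 (invmx (invmx g *m h)) by [].
apply/seteqP; split; apply/span_subP => //.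
by move: h2; rewrite invmxM ?unitmx_inv// invmxK.
Qed.

Lemma vtx_in g : vtx g (span_cols ord g).
Proof.
by exists 1; rewrite /= ?oner_eq0// dilate_span scale1r.
Qed.

Lemma vtxZ c g : c != 0 -> vtx (c *: g) = vtx g.
Proof.
move=> c0; apply/seteqP; split=> _ [e /= e0 <-].
  by exists (e * c); rewrite /= ?mulf_neq0// !dilate_span scalerA.
by exists (e / c); rewrite /= ?mulf_neq0 ?invr_eq0// !dilate_span scalerA divfK.
Qed.

Lemma vtxP g h : g \in unitmx -> h \in unitmx ->
  vtx g = vtx h <-> exists2 c, c != 0 & GL4O (c *: (invmx g *m h)).
Proof.
move=> ug uh; split=> [e|[c c0 hc]].
  have := vtx_in h; rewrite -e => -[c /= c0]; rewrite dilate_span => /span_eqP hc.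
  exists c^-1; first by rewrite invr_eq0.
  have ucg : c *: g \in unitmx by rewrite unitmxZ ?unitfE.
  by have := hc ucg uh; rewrite invmxZ// -scalemxAl.
rewrite -[RHS](vtxZ _ c0) /vtx; congr hclass; apply/span_eqP => //.
  by rewrite unitmxZ ?unitfE.
by rewrite -scalemxAr.
Qed.

Lemma vtx_act g h : act g (vtx h) = vtx (g *m h).
Proof.
have im c : [set g *m x | x in dilate c (span_cols ord h)] = dilate c (span_cols ord (g *m h)).
  rewrite !dilate_span scalemxAr; apply/seteqP; split=> [_ [_ [x hx <-] <-]|_ [x hx <-]].
    by exists x => //; rewrite mulmxA.
  by exists (c *: h *m x); [exists x|rewrite mulmxA].
apply/seteqP; split=> [_ [_ [c c0 <-] <-]|_ [c c0 <-]]; first by exists c; rewrite ?im.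
by exists (dilate c (span_cols ord h)); [exists c|rewrite im].
Qed.

Lemma vtx_mulr g h : h \in unitmx -> GL4O h -> vtx (g *m h) = vtx g.
Proof.
move=> uh [_ h1 h2]; rewrite /vtx; congr hclass; apply/seteqP; split=> _ [x hx <-].
  exists (h *m x); last by rewrite mulmxA.
  by move=> i; apply: (mxinM hF h1 (l := 0)) => k l; rewrite (ord1 l).
exists (invmx h *m x); last by rewrite -mulmxA mulKVmx.
by move=> i; apply: (mxinM hF h2 (l := 0)) => k l; rewrite (ord1 l).
Qed.

Lemma vtx_stab g a s : g \in unitmx -> unitdet s -> inw a s -> vtx (g *m s *m td a) = vtx (g *m td a).
Proof.
move=> ug us hs; have h := inw_GL4O hF hpi hs us.
rewrite -(vtx_mulr (g *m td a) (GL4O_unit h) h); congr vtx.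
by rewrite -!mulmxA mulKVmx ?(td_unit hpi).
Qed.

Lemma vtx_eq_inw g h a : GSp4 g -> GSp4 h -> vtx (g *m td a) = vtx (h *m td a) ->
  exists c s, [/\ c != 0, GSp1 s, inw a s & h = c *: (g *m s)].
Proof.
move=> hg hh /vtxP[]; rewrite ?unitmx_mul ?(td_unit hpi) ?GSp4_unit// => c c0.
rewrite invmxM ?(td_unit hpi) ?GSp4_unit// -!mulmxA [invmx g *m _]mulmxA mulmxA.
rewrite scalemxAl scalemxAr => /(GL4OP hF)[h1 h2].
exists c^-1, (c *: (invmx g *m h)); split; rewrite ?invr_eq0//.
- split; first by apply: GSp4Z => //; apply: GSp4M => //; exact: GSp4V.
  move: h2; rewrite /(unitdet _) !det_mulmx mulrAC det_inv mulVf ?mul1r//.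
  by rewrite -unitfE -unitmxE (td_unit hpi).
- exact/(inwE hF hpi).
- by rewrite -scalemxAr mulKVmx ?GSp4_unit// scalerA mulVf// scale1r.
Qed.

Lemma ord_detZ c s : c != 0 -> s \in unitmx -> ord (\det (c *: s)) = ord c *+ 4 + ord (\det s).
Proof.
move=> c0; rewrite unitmxE unitfE => s0.
by rewrite detZ (ordMn0 hF) ?expf_neq0// (ordXn hF).
Qed.

(** Each equality of vertices gives its own scalar and its own stabilizing element. The two elements
    are proportional with unit determinants, so their ratio is a unit of O and one of them serves
    for both vertices. *)
Lemma edge_eq_inw g h a b : GSp4 g -> GSp4 h ->
  vtx (g *m td a) = vtx (h *m td a) -> vtx (g *m td b) = vtx (h *m td b) ->
  exists c s, [/\ c != 0, GSp1 s, inw a s, inw b s & h = c *: (g *m s)].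
Proof.
move=> hg hh /(vtx_eq_inw hg hh)[c [s [c0 hs has e]]] /(vtx_eq_inw hg hh)[c' [s' [c0' hs' hbs e']]].
exists c, s; split=> //.
have us : s \in unitmx by apply: GSp4_unit; case: hs.
have us' : s' \in unitmx by apply: GSp4_unit; case: hs'.
have ee : s' = (c / c') *: s.
  apply: (scalerI c0'); rewrite scalerA mulrCA divff// mulr1.
  have ug := GSp4_unit hg.
  apply: (can_inj (mulKmx ug)); rewrite -!scalemxAr.
  by rewrite -e -e'.
have oc : ord (c / c') = 0.
  case: hs => _ [_ os]; case: hs' => _ [_ os']; have := os'.
  rewrite ee ord_detZ ?mulf_neq0 ?invr_eq0// os; lia.
have uc : unitO (c / c') by split; rewrite ?mulf_neq0 ?invr_eq0.
move=> i j; apply: (unitO_mulP hF uc); have := hbs i j.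
by rewrite ee mxE.
Qed.

(** The parity of the order of the similitude factor. For [g] in GSp_4 it tells the two kinds of
    special vertices apart: the class of [g O^4] contains a self-dual lattice exactly when the order
    is even. *)
Definition even_simil g := (4 %| ord (\det g))%Z.

Lemma evnE l g : l != 0 -> simil l g -> even_simil g = (2 %| ord l)%Z.
Proof.
move=> l0 hl; rewrite /even_simil (ord_det hF l0 hl).
by rewrite (_ : 4 = 2 * 2)// mulr2n (_ : ord l + ord l = 2 * ord l) ?dvdz_mul2l//; lia.
Qed.

Lemma evnM g h : GSp4 g -> GSp4 h -> even_simil (g *m h) = (even_simil g == even_simil h).
Proof.
move=> /GSp4P[l l0 hl] /GSp4P[l' l0' hl'].
rewrite (evnE (mulf_neq0 l0 l0') (similM hl hl')) (evnE l0 hl) (evnE l0' hl') (ordMn0 hF)//.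
move: (ord l) (ord l') => x y; apply/idP/eqP; lia.
Qed.

Lemma evn_GSp1 s : GSp1 s -> even_simil s.
Proof. by move=> [_ [_ h]]; rewrite /even_simil h dvdz0. Qed.

Lemma evnZ c g : c != 0 -> GSp4 g -> even_simil (c *: g) = even_simil g.
Proof.
move=> c0 hg; rewrite -mul_scalar_mx evnM//; last first.
  by apply/GSp4P; exists (c ^+ 2); [rewrite expf_neq0|exact: simil_scalar].
rewrite (@evnE (c ^+ 2)) ?expf_neq0//; last exact: simil_scalar.
rewrite (ordXn hF)//; case: (even_simil g); apply/eqP => //; lia.
Qed.

(* The weights of the successive vertices [vtx (g *m td (line_wt k i))] of a
   straight path: along a diagonal of the tiling for [k = None], along an axis
   for [k = Some b]. In the latter case the vertices are alternately special
   and non-special, and the first step has weight (0, 1, 1, 1) or (0, 0, 0, 1)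
   according to the parity [b] of the similitude factor of [g], since only one
   of the two is then a vertex of the building. *)
Definition line_wt (k : option bool) (i : nat) : 'rV[int]_4 :=
  if k is Some b then
    let a := (i./2 + (odd i && b))%N in row4 0 a%:Z a%:Z i%:Z
  else row4 0 0 i%:Z i%:Z.

Lemma wt_hyp n : (wt (line_wt None n) o0 = 0) * (wt (line_wt None n) o1 = 0) *
  (wt (line_wt None n) o2 = n%:Z) * (wt (line_wt None n) o3 = n%:Z).
Proof. by rewrite !wt_row4. Qed.

Lemma wt_ax (b : bool) n : (wt (line_wt (Some b) n) o0 = 0) *
  (wt (line_wt (Some b) n) o1 = (n./2 + (odd n && b))%N%:Z) *
  (wt (line_wt (Some b) n) o2 = (n./2 + (odd n && b))%N%:Z) * (wt (line_wt (Some b) n) o3 = n%:Z).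
Proof. by rewrite !wt_row4. Qed.

(** The opposite unipotent radicals of the Klingen parabolic subgroup ([lowu], a Heisenberg group)
    and of the Siegel one ([lowh], abelian). *)
Definition lowu (x y z : F) := mx4 [:: [:: 1; 0; 0; 0]; [:: x; 1; 0; 0]; [:: y; 0; 1; 0]; [:: z; y; - x; 1]].
Definition lowh (x y z : F) := mx4 [:: [:: 1; 0; 0; 0]; [:: 0; 1; 0; 0]; [:: x; y; 1; 0]; [:: z; x; 0; 1]].

Lemma lowu_simil x y z : simil 1 (lowu x y z).
Proof. by apply: eq_simil; rewrite /pair !mxE /=; ring. Qed.

Lemma lowh_simil x y z : simil 1 (lowh x y z).
Proof. by apply: eq_simil; rewrite /pair !mxE /=; ring. Qed.

Ltac four2 i j := move: i j; apply: ord4_ind; apply: ord4_ind.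

Lemma lowuV x y z : invmx (lowu x y z) = lowu (- x) (- y) (- z).
Proof.
rewrite (simil_inv (oner_neq0 _) (lowu_simil x y z)); apply/matrixP => i j.
by rewrite mxE mul_J mulJ; four2 i j; rewrite !mxE /= ?invr1; ring.
Qed.

Lemma lowhV x y z : invmx (lowh x y z) = lowh (- x) (- y) (- z).
Proof.
rewrite (simil_inv (oner_neq0 _) (lowh_simil x y z)); apply/matrixP => i j.
by rewrite mxE mul_J mulJ; four2 i j; rewrite !mxE /= ?invr1; ring.
Qed.

Lemma inw_le a s i j k : inw a s -> k <= wt a i - wt a j -> in_Pn k (s i j).
Proof. by move=> h hk; apply: in_Pn_le hk (h i j). Qed.

(** In the coordinates of the edge the upper left block of [s] is invertible, so [s] is [u] times a
    block upper triangular matrix. The entries of [u] off the diagonal lie in P^(n+1), so [u] fixes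
    the path so far; the other factor fixes the next vertex, because only the vanishing block would
    have to meet a stronger bound there. *)
Lemma factor_hyp n s : GSp1 s -> inw (line_wt None n) s -> inw (line_wt None n.+1) s ->
  exists u, [/\ GSp1 u, forall i, (i <= n.+1)%N -> inw (line_wt None i) u &
    inw (line_wt None n.+2) (invmx u *m s)].
Proof.
move=> hs hA hB.
pose A := line_wt None n; pose s' := invmx (td A) *m s *m td A.
have gA : GSp4 (td A).
  apply/GSp4P; exists (pi ^ n%:Z); first exact: pi_exp_neq0 hpi _.
  by apply: (td_simil hpi); rewrite /A !wt_hyp ?add0r.
have e' i j : s' i j = pi ^ (wt A j - wt A i) * s i j.
  rewrite /s' -(tdN hpi) mul_mx_td mul_td wtN mulrC mulrA -exprzDr ?unitfE ?(pi_neq0 hpi)//.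
have hs' : GSp1 s'.
  case: hs => h u; split; first by apply: GSp4M => //; apply: GSp4M => //; exact: GSp4V.
  rewrite /(unitdet _) !det_mulmx mulrAC det_inv mulVf ?mul1r//.
  by rewrite -unitfE -unitmxE (td_unit hpi).
have h0' : inw 0 s'.
  by move=> i j; rewrite e' (in_Pn_piM hF hpi); apply: inw_le hA _; rewrite /wt !mxE; lia.
have h1' : inw w1 s'.
  move=> i j; rewrite e' (in_Pn_piM hF hpi); apply: inw_le hB _.
  by four2 i j; rewrite ?(wt_hyp, wt_ax, wt_row4); lia.
have := minors_unit hF hs' h0' h1'; rewrite !e' !wt_hyp /= !subrr !expr0z !mul1r.
set D := (X in unitO X) => uD.
have pl (i j : 'I_4) : (2 <= i)%N -> (j < 2)%N -> in_Pn n.+1%:Z (s i j).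
  by move=> h1 h2; apply: inw_le hB _; move: h1 h2; four2 i j => //; rewrite ?(wt_hyp, wt_ax, wt_row4); lia.
have pd (i j : 'I_4) : (i < 2)%N -> (j < 2)%N -> in_Pn 0 (s i j).
  by move=> h1 h2; apply: inw_le hB _; move: h1 h2; four2 i j => //; rewrite ?(wt_hyp, wt_ax, wt_row4); lia.
(* The lower left block of [s] times the inverse of the upper left one, by Cramer's rule. The entry
   [x] occurs twice in this product, and [ex] is this coincidence, due to the isotropy of the first
   two columns. *)
pose x := (s o2 o0 * s o1 o1 - s o2 o1 * s o1 o0) / D.
pose y := (s o2 o1 * s o0 o0 - s o2 o0 * s o0 o1) / D.
pose z := (s o3 o0 * s o1 o1 - s o3 o1 * s o1 o0) / D.
have p (i j k l i' j' k' l' : 'I_4) : (2 <= i)%N -> (j < 2)%N -> (k < 2)%N -> (l < 2)%N ->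
   (2 <= i')%N -> (j' < 2)%N -> (k' < 2)%N -> (l' < 2)%N ->
   in_Pn n.+1%:Z ((s i j * s k l - s i' j' * s k' l') / D).
  move=> *; apply: (unitO_divP hF) => //.
  by apply: (in_PnB hF); apply: (in_PnMeq hF (m := n.+1%:Z) (n := 0)); rewrite ?addr0//; auto.
have px : in_Pn n.+1%:Z x by apply: p.
have py : in_Pn n.+1%:Z y by apply: p.
have pz : in_Pn n.+1%:Z z by apply: p.
have D0 : D != 0 by case: uD.
have ex : x = (s o3 o1 * s o0 o0 - s o3 o0 * s o0 o1) / D.
  case/GSp1P: (hs) => // l _ /simil_eq[e01 _ _ _]; rewrite /x; congr (_ / _).
  apply/eqP; rewrite eq_sym -subr_eq0 -[X in _ == X]e01 /pair; apply/eqP; ring.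
have inwu i : (i <= n.+1)%N -> inw (line_wt None i) (lowh x y z).
  move=> hi j k; four2 j k; rewrite ?(wt_hyp, wt_ax, wt_row4) !mxE /= ?(in_Pn0 ord) ?subrr ?(in_Pn1 hF)//;
  by apply: (in_Pn_le _ px) || apply: (in_Pn_le _ py) || apply: (in_Pn_le _ pz); lia.
have hu : GSp1 (lowh x y z) := simil1_GSp1 hF (unitO1 hF) (lowh_simil x y z).
exists (lowh x y z); split=> //.
have hm : inw (line_wt None n.+1) (invmx (lowh x y z) *m s).
  by apply: (inwM hF) => //; apply: (inwV hF hpi); [exact: inwu|case: hu].
have zero (i j : 'I_4) : (2 <= i)%N -> (j < 2)%N -> (invmx (lowh x y z) *m s) i j = 0.
  rewrite lowhV mulmx4 => hi hj; move: hi hj; four2 i j => // _ _; rewrite !mxE /=;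
  rewrite !(mul0r, mul1r, addr0, add0r).
  - by rewrite /x /y; move: D0; rewrite /D => D0; field.
  - by rewrite /x /y; move: D0; rewrite /D => D0; field.
  - by rewrite ex /z; move: D0; rewrite /D => D0; field.
  - by rewrite ex /z; move: D0; rewrite /D => D0; field.
move=> i j; have [/andP[hi hj]|hij] := boolP ((2 <= i)%N && (j < 2)%N).
  by rewrite zero// (in_Pn0 ord).
by apply: inw_le hm _; move: hij; four2 i j => //= _; rewrite ?(wt_hyp, wt_ax, wt_row4); lia.
Qed.

(** Duality exchanges the two axis sequences up to homothety, so a stabilizer of a vertex of one
    stabilizes the vertex of the same index in the other. *)
Lemma ax_dual (b : bool) i s : GSp1 s -> inw (line_wt (Some b) i) s -> inw (line_wt (Some (~~ b)) i) s.
Proof.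
move=> [hs us] h; have := inw_add_const i%:Z (inw_dual hF hpi hs us h).
move=> H j k; apply: inw_le H _; rewrite !wtD !wt_const.
have e := odd_double_half i; four2 j k; rewrite ?(wt_hyp, wt_ax, wt_row4); case: b h; case: (odd i) e => e _ /=; lia.
Qed.

Lemma half_bound (b : bool) i n : (i <= n.+1)%N ->
  (i./2 + (odd i && b) <= n./2.+1)%N /\ (i <= n./2.+1 + (i./2 + (odd i && b)))%N.
Proof.
move=> hi; have := odd_double_half i; have := odd_double_half n.
by rewrite -!muln2; case: b; case: (odd i); case: (odd n) => /= h1 h2; split; lia.
Qed.

(** The first column of [s], divided by its unit entry (0,0), defines [u]. Then u^(-1) s fixes the
    line of the first basis vector and, being a similitude, also has a last row that vanishes off
    the diagonal; these zeros are where the next vertex asks for more than the previous ones. *)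
Lemma factor_ax (b : bool) n s : GSp1 s -> inw (line_wt (Some b) n) s -> inw (line_wt (Some b) n.+1) s ->
  exists u, [/\ GSp1 u, forall i, (i <= n.+1)%N -> inw (line_wt (Some b) i) u &
    inw (line_wt (Some b) n.+2) (invmx u *m s)].
Proof.
move=> hs hA hB; have hA' := ax_dual hs hA; have hB' := ax_dual hs hB.
have std_edge := odd_double_half n; have eo1 : n.+1./2 = (odd n + n./2)%N by rewrite -uphalfE uphalf_half.
pose j := n./2%:Z.
(* Each entry obeys the best of four bounds, given by the two vertices of the edge and their
   duals. *)
have H k p q : (k <= wt (line_wt (Some b) n) p - wt (line_wt (Some b) n) q)
    || (k <= wt (line_wt (Some (~~ b)) n) p - wt (line_wt (Some (~~ b)) n) q)
    || (k <= wt (line_wt (Some b) n.+1) p - wt (line_wt (Some b) n.+1) q)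
    || (k <= wt (line_wt (Some (~~ b)) n.+1) p - wt (line_wt (Some (~~ b)) n.+1) q) -> in_Pn k (s p q).
  by case/orP => [/orP[/orP[]|]|]; [exact: inw_le hA|exact: inw_le hA'|exact: inw_le hB|exact: inw_le hB'].
have p10 : in_Pn (j + 1) (s o1 o0).
  by apply: H; rewrite ?(wt_hyp, wt_ax, wt_row4) eo1 /=; case: b {hA hB hA' hB'}; case: (odd n) std_edge => std_edge /=; lia.
have p20 : in_Pn (j + 1) (s o2 o0).
  by apply: H; rewrite ?(wt_hyp, wt_ax, wt_row4) eo1 /=; case: b {hA hB hA' hB'}; case: (odd n) std_edge => std_edge /=; lia.
have p30 : in_Pn n.+1%:Z (s o3 o0) by apply: H; rewrite ?(wt_hyp, wt_ax, wt_row4); lia.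
have p23 : in_Pn (- j) (s o2 o3).
  by apply: H; rewrite ?(wt_hyp, wt_ax, wt_row4) eo1 /=; case: b {hA hB hA' hB'}; case: (odd n) std_edge => std_edge /=; lia.
have p13 : in_Pn (- j) (s o1 o3).
  by apply: H; rewrite ?(wt_hyp, wt_ax, wt_row4) eo1 /=; case: b {hA hB hA' hB'}; case: (odd n) std_edge => std_edge /=; lia.
have p03 : in_Pn (- n%:Z) (s o0 o3) by apply: H; rewrite ?(wt_hyp, wt_ax, wt_row4); lia.
have p00 : in_Pn 0 (s o0 o0) by apply: H; rewrite ?(wt_hyp, wt_ax, wt_row4); lia.
have p33 : in_Pn 0 (s o3 o3) by apply: H; rewrite ?(wt_hyp, wt_ax, wt_row4); lia.
have [l ul hl] : exists2 l, unitO l & simil l s by apply/(GSp1P hF).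
have [_ _ e03 _] := simil_eq hl.
(* The pairing of columns 0 and 3 is the unit [l], and all its terms except s_00 s_33 lie in P. *)
have u00 : unitO (s o0 o0).
  suff : unitO (s o0 o0 * s o3 o3) by case/(unitO_MP hF p00 p33).
  have -> : s o0 o0 * s o3 o3 = l + (s o2 o0 * s o1 o3 + s o3 o0 * s o0 o3 - s o1 o0 * s o2 o3).
    by rewrite -e03 /pair; ring.
  apply: (unitOD hF) => //; apply: (in_PnB hF); first apply: (in_PnD hF).
  - by apply: (in_PnMeq hF _ p20 p13); clear; lia.
  - by apply: (in_PnMeq hF _ p30 p03); clear; lia.
  - by apply: (in_PnMeq hF _ p10 p23); clear; lia.
have n00 : s o0 o0 != 0 by case: u00.
pose x := s o1 o0 / s o0 o0; pose y := s o2 o0 / s o0 o0; pose z := s o3 o0 / s o0 o0.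
have px : in_Pn (j + 1) x by apply: (unitO_divP hF).
have py : in_Pn (j + 1) y by apply: (unitO_divP hF).
have pz : in_Pn n.+1%:Z z by apply: (unitO_divP hF).
have inwu i : (i <= n.+1)%N -> inw (line_wt (Some b) i) (lowu x y z).
  move=> hi; have [ha hb] := half_bound b hi.
  move=> k m; four2 k m; rewrite !wt_ax !mxE /= ?(in_Pn0 ord) ?subrr ?(in_PnN hF) ?(in_Pn1 hF)//;
  (apply: (in_Pn_le _ px) || apply: (in_Pn_le _ py) || apply: (in_Pn_le _ pz));
  by move: hi ha hb; rewrite /j; move: (i./2 + _)%N n./2 => a' c'; clear; lia.
have hu : GSp1 (lowu x y z) := simil1_GSp1 hF (unitO1 hF) (lowu_simil x y z).
exists (lowu x y z); split=> //.
set m := invmx _ *m s.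
have hm : inw (line_wt (Some b) n.+1) m.
  by apply: (inwM hF) => //; apply: (inwV hF hpi); [exact: inwu|case: hu].
have z1 (i : 'I_4) : (0 < i)%N -> m i o0 = 0.
  rewrite /m lowuV mulmx4; move: i; apply: ord4_ind => // _; rewrite !mxE /=; rewrite /x /y /z; by field.
have mn0 : m o0 o0 != 0.
  by rewrite /m lowuV mulmx4 !mxE /= !mul0r !addr0 mul1r.
have [l' _ /simil_eq[e01 e02 _ _]] : exists2 l, unitO l & simil l m.
  by apply/(GSp1P hF); apply: (GSp1M hF) => //; exact: (GSp1V hF).
(* Column 0 of [m] is a nonzero multiple of the first basis vector, so its orthogonality to columns
   1 and 2 kills their last entries. *)
have z31 : m o3 o1 = 0.
  by move: e01; rewrite /pair (z1 o1)// (z1 o2)// (z1 o3)// !mul0r !subr0 addr0 => /eqP; rewrite mulf_eq0 (negPf mn0) => /eqP.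
have z32 : m o3 o2 = 0.
  by move: e02; rewrite /pair (z1 o1)// (z1 o2)// (z1 o3)// !mul0r !subr0 addr0 => /eqP; rewrite mulf_eq0 (negPf mn0) => /eqP.
move=> i k; four2 i k; rewrite ?(z1 o1)// ?(z1 o2)// ?(z1 o3)// ?z31 ?z32 ?(in_Pn0 ord)//; apply: inw_le hm _; rewrite !wt_ax ?eo1 /=;
  case: b {hA hB hA' hB' H inwu}; case: (odd n) std_edge => std_edge /=; clear -std_edge; lia.
Qed.

(* Why locally straight paths are straight: [u] fixes the path so far and moves
   its next vertex to any prescribed continuation. *)
Lemma factor k n s : GSp1 s -> inw (line_wt k n) s -> inw (line_wt k n.+1) s ->
  exists u, [/\ GSp1 u, forall i, (i <= n.+1)%N -> inw (line_wt k i) u &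
    inw (line_wt k n.+2) (invmx u *m s)].
Proof. by case: k => [b|]; [exact: factor_ax|exact: factor_hyp]. Qed.

End Vertices.

(** * Apartments *)

Section Apartments.
Variables (F : fieldType) (ord : F -> int) (pi : F).
Hypotheses (hF : nonarch_local_field ord) (hpi : uniformizer ord pi).
Local Notation in_Pn := (in_Pn ord).
Local Notation td := (td pi).
Local Notation vtx := (vtx ord).
Local Notation span := (span_cols ord).
Local Notation prim := (primitive_lattice ord pi).
Local Notation form := Defs.form.
Implicit Types (g h s B : 'M[F]_4) (a b l : 'rV[int]_4).

Lemma mxin_bound m n (A : 'M[F]_(m, n)) : exists k : nat, mxin ord (- k%:Z) A.
Proof.
pose k := \max_(ij : 'I_m * 'I_n) `|ord (A ij.1 ij.2)|%N.
exists k => i j; have [->|A0] := eqVneq (A i j) 0; first exact: in_Pn0.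
have : (`|ord (A i j)| <= k)%N by rewrite /k (bigD1 (i, j))//= leq_maxl.
by rewrite in_Pn_ord//; move: (ord (A i j)) => x h; clear -h; lia.
Qed.

Lemma sformE (x y : 'cV[F]_4) :
  form x y = x o0 0 * y o3 0 + x o1 0 * y o2 0 - x o2 0 * y o1 0 - x o3 0 * y o0 0.
Proof. by rewrite /form mxE sum4 !mxE !sum4 !mxE /=; ring. Qed.

Lemma form_simil (c : F) g x y : simil c g -> form (g *m x) (g *m y) = c * form x y.
Proof.
move=> hl; rewrite /form trmx_mul.
have -> : x^T *m g^T *m Jmx F *m (g *m y) = x^T *m (g^T *m Jmx F *m g) *m y by rewrite !mulmxA.
by rewrite hl -scalemxAr -scalemxAl mxE.
Qed.

Lemma form_td a x y : form (td a *m x) (td a *m y) =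
  pi ^ (wt a o0 + wt a o3) * (x o0 0 * y o3 0 - x o3 0 * y o0 0) +
  pi ^ (wt a o1 + wt a o2) * (x o1 0 * y o2 0 - x o2 0 * y o1 0).
Proof.
have e i (z : 'cV[F]_4) : (td a *m z) i 0 = pi ^ wt a i * z i 0.
  by rewrite mul_diag_mx !mxE.
rewrite sformE !e !exprzDr ?unitfE ?(pi_neq0 hpi)//.
by move: (pi ^ _) (pi ^ _) (pi ^ _) (pi ^ _) => p q r t; ring.
Qed.

Lemma sformZl c (x y : 'cV[F]_4) : form (c *: x) y = c * form x y.
Proof. by rewrite !sformE !mxE; ring. Qed.

Lemma sformZr c (x y : 'cV[F]_4) : form x (c *: y) = c * form x y.
Proof. by rewrite !sformE !mxE; ring. Qed.

Lemma vtx_lattice g L : g \in unitmx -> vtx g L -> exists k, L = span (pi ^ k *: g).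
Proof.
move=> ug [c /= c0 <-]; have [u [u0 ou] eu] := ord_decomp hF hpi c0.
have uk : pi ^ ord c *: g \in unitmx by rewrite unitmxZ ?unitfE ?(pi_exp_neq0 hpi).
exists (ord c); rewrite dilate_span; apply/(span_eqP hF) => //.
  by rewrite unitmxZ ?unitfE.
rewrite {1}eu -scalerA; move: (_ *: g) uk => h uh.
rewrite invmxZ ?unitmxZ ?unitfE// -scalemxAl mulVmx//.
by apply: (GL4OZ hF); [apply: (unitOV hF); split|exact: GL4O1].
Qed.

Lemma scale_td k B a : pi ^ k *: (B *m td a) = B *m td (a + const_mx k).
Proof. by rewrite (tdD hpi) td_const mul_mx_scalar -scalemxAr. Qed.

Lemma vtx_td_lattice B a L : B \in unitmx -> vtx (B *m td a) L ->
  exists k, L = span (B *m td (a + const_mx k)).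
Proof.
move=> uB /vtx_lattice[|k ->]; first by rewrite unitmx_mul uB (td_unit hpi).
by exists k; rewrite scale_td.
Qed.

Lemma span_td_sub B a b : B \in unitmx ->
  span (B *m td a) `<=` span (B *m td b) <-> forall i, wt b i <= wt a i.
Proof.
move=> uB; have ub : B *m td b \in unitmx by rewrite unitmx_mul uB (td_unit hpi).
have -> : (span (B *m td a) `<=` span (B *m td b)) =
    mxin ord 0 (td (a - b)).
  rewrite (propext (span_subP hF _ ub)) invmxM ?(td_unit hpi)//.
  by rewrite -mulmxA [invmx B *m _]mulmxA mulVmx// mul1mx -(tdN hpi) -(tdD hpi) addrC.
split=> [h i|h i j]; first have := h i i; rewrite tdE.
  rewrite eqxx mulr1n in_Pn_ord ?(pi_exp_neq0 hpi)// (ord_pi_exp hF hpi) wtD wtN.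
  by rewrite subr_ge0.
case: eqP => _; rewrite ?mulr0n ?(in_Pn0 ord)// mulr1n.
by apply: in_Pn_le (in_Pn_pi hF hpi _); rewrite wtD wtN subr_ge0.
Qed.

Lemma dilate_td B a : dilate pi (span (B *m td a)) = span (B *m td (a + const_mx 1)).
Proof. by rewrite dilate_span -scale_td expr1z. Qed.

Lemma symplectic_simil B : symplectic_basis B <-> simil 1 B.
Proof. by rewrite /symplectic_basis /simil scale1r. Qed.

Lemma symplectic_unit B : symplectic_basis B -> B \in unitmx.
Proof. by move/symplectic_simil => h; apply: GSp4_unit; apply/GSp4P; exists 1; rewrite ?oner_neq0. Qed.

Definition prw a := wt a o0 + wt a o3 = 0 /\ wt a o1 + wt a o2 = 0.

(** Up to a homothety by pi^c, each of the two hyperbolic planes carries a pair of weights of sum 1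
    or 2. Equal sums give the special vertices, different sums the non-special ones. *)
Definition vw a := exists c : int,
  (2 * c + 1 <= wt a o0 + wt a o3 <= 2 * c + 2) && (2 * c + 1 <= wt a o1 + wt a o2 <= 2 * c + 2).

Definition ev (i : 'I_4) : 'cV[F]_4 := col i 1%:M.

Lemma evE i j : ev i j 0 = if j == i then 1 else 0.
Proof. by rewrite !mxE; case: eqP. Qed.

Lemma ev_int i j : in_Pn 0 (ev i j 0).
Proof. by rewrite evE; case: eqP; rewrite ?(in_Pn0 ord) ?(in_Pn1 hF). Qed.

Lemma span_ev g i : span g (g *m ev i).
Proof. by exists (ev i) => // j; exact: ev_int. Qed.

Lemma span_ev_td B a i k : B \in unitmx -> span (B *m td a) (pi ^ k *: (B *m td a *m ev i)) -> 0 <= k.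
Proof.
move=> uB [x hx]; rewrite -!mulmxA !scalemxAr => /(can_inj (mulKmx uB)) /(can_inj (mulKmx (td_unit hpi a))) e.
by have := hx i; rewrite e mxE evE eqxx mulr1 in_Pn_ord ?(pi_exp_neq0 hpi)// (ord_pi_exp hF hpi).
Qed.

Lemma form_ev B a i y : symplectic_basis B ->
  form (B *m td a *m ev i) (B *m td a *m y) = form (td a *m ev i) (td a *m y).
Proof. by move=> /symplectic_simil hB; rewrite -!mulmxA (form_simil _ _ hB) mul1r. Qed.

Lemma form_int_wt B a n : symplectic_basis B ->
  (forall x y, span (B *m td a) x -> span (B *m td a) y -> in_Pn n (form x y)) ->
  n <= wt a o0 + wt a o3 /\ n <= wt a o1 + wt a o2.
Proof.
move=> hB h; split.
  have := h _ _ (span_ev _ o0) (span_ev _ o3); rewrite form_ev// form_td !evE /=.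
  rewrite !(mulr0, mul0r, mulr1, subr0, addr0) in_Pn_ord ?(pi_exp_neq0 hpi)//.
  by rewrite (ord_pi_exp hF hpi).
have := h _ _ (span_ev _ o1) (span_ev _ o2); rewrite form_ev// form_td !evE /=.
rewrite !(mulr0, mul0r, mulr1, subr0, add0r) in_Pn_ord ?(pi_exp_neq0 hpi)//.
by rewrite (ord_pi_exp hF hpi).
Qed.

Lemma wt_form_int B a n : symplectic_basis B -> n <= wt a o0 + wt a o3 -> n <= wt a o1 + wt a o2 ->
  forall x y, span (B *m td a) x -> span (B *m td a) y -> in_Pn n (form x y).
Proof.
move=> /symplectic_simil hB h1 h2 _ _ [x hx <-] [y hy <-].
rewrite -!mulmxA (form_simil _ _ hB) mul1r form_td.
have p i j : in_Pn 0 (x i 0 * y j 0) by apply: (in_PnMeq hF _ (hx _) (hy _)).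
apply: (in_PnD hF); apply: (in_PnMeq hF (n := 0) _ (in_Pn_pi hF hpi _)); rewrite ?addr0//;
  exact: (in_PnB hF).
Qed.

(** Descent on a power of [pi] that carries [x] into [L]: as long as the exponent is positive, the
    multiple of [x] pairs into P with [L], and nondegeneracy modulo [pi] allows division by [pi]
    inside [L]. *)
Lemma prim_dual L : prim L -> forall x, (forall y, L y -> in_Pn 0 (form x y)) -> L x.
Proof.
move=> [[g ug ->] hint hnd] x hx.
have [k hk] := mxin_bound (invmx g *m x).
have h : span g (pi ^ k%:Z *: x).
  exists (pi ^ k%:Z *: (invmx g *m x)); last by rewrite -scalemxAr mulKVmx.
  by move=> i; rewrite mxE (in_Pn_piM hF hpi) sub0r.
elim: k h {hk} => [|k IH h]; first by rewrite expr0z scale1r.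
apply: IH; have [|_ [z hz <-]] := hnd _ h.
  move=> y hy; rewrite sformZl (in_Pn_piM hF hpi).
  by apply: in_Pn_le (hx _ hy); lia.
rewrite -!exprnP exprS -scalerA.
by move/(scalerI (pi_neq0 hpi)) => <-; exists z.
Qed.

Lemma prim_td B a : symplectic_basis B -> prim (span (B *m td a)) <-> prw a.
Proof.
move=> hB; have uB := symplectic_unit hB; split=> [hp|[h0 h1]].
  have [_ hint hnd] := hp; have [h1 h2] := form_int_wt hB hint.
  (* A basis vector pairing into P with the whole lattice would be divisible by [pi] in it; this
     excludes a positive sum of dual weights. *)
  have key i : (forall y : 'cV_4, (forall j, in_Pn 0 (y j 0)) -> in_Pn 1 (form (td a *m ev i) (td a *m y))) -> False.
    move=> h; have [|z hz e] := hnd _ (span_ev (B *m td a) i).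
      by move=> _ [y hy <-]; rewrite form_ev//; exact: h.
    have : span (B *m td a) (pi ^ (-1) *: (B *m td a *m ev i)).
      by rewrite -e scalerA exprN1 mulVf ?scale1r// (pi_neq0 hpi).
    by move/(span_ev_td uB).
  split; apply/eqP; rewrite eq_le ?h1 ?h2 andbT leNgt; apply/negP => hlt.
    apply: (key o0) => y hy; rewrite form_td !evE /= !(mul0r, mul1r, subr0, addr0, mulr0).
    by refine (in_PnMeq hF _ (in_Pn_pi hF hpi _) (hy _)); lia.
  apply: (key o1) => y hy; rewrite form_td !evE /= !(mul0r, mul1r, subr0, add0r, oppr0, mulr0).
  by refine (in_PnMeq hF _ (in_Pn_pi hF hpi _) (hy _)); lia.
split; first by exists (B *m td a); rewrite ?unitmx_mul ?uB ?(td_unit hpi).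
  by apply: wt_form_int; rewrite // ?h0 ?h1.
move=> _ [x hx <-] h; exists (B *m td a *m (pi^-1 *: x)); last first.
  by rewrite -scalemxAr scalerA divff ?scale1r// (pi_neq0 hpi).
exists (pi^-1 *: x) => // i; rewrite mxE -exprN1 (in_Pn_piM hF hpi) sub0r opprK.
have key j : in_Pn 1 (form (td a *m x) (td a *m ev j)).
  have := h _ (span_ev (B *m td a) j); rewrite -!mulmxA.
  by rewrite (form_simil _ _ (proj1 (symplectic_simil B) hB)) mul1r.
move: (key o0) (key o1) (key o2) (key o3); rewrite !form_td !evE h0 h1 /= expr0z.
rewrite !(mul0r, mul1r, mulr0, mulr1, subr0, sub0r, oppr0, add0r, addr0, in_PnN hF).
by move=> *; move: i; apply: ord4_ind.
Qed.

Lemma vw_add_const a k : vw (a + const_mx k) <-> vw a.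
Proof.
by split=> -[c h]; [exists (c - k)|exists (c + k)]; move: h; rewrite !wtD !wt_const; lia.
Qed.

Lemma hclass_self (L : set 'cV[F]_4) : hclass L L.
Proof.
exists 1; rewrite /= ?oner_neq0//; apply/seteqP; split=> [_ [x hx <-]|x hx].
  by rewrite scale1r.
by exists x => //; rewrite scale1r.
Qed.

Lemma is_vertex_vw B a : symplectic_basis B -> is_vertex ord pi (vtx (B *m td a)) -> vw a.
Proof.
move=> hB; have uB := symplectic_unit hB.
move=> [L hL [e|[M [hM1 hM2 hM3 hM4] e]]].
  have := hclass_self L; rewrite -e => /(vtx_td_lattice uB)[k eL].
  move: hL; rewrite eL => /(prim_td _ hB)[h1 h2].
  by apply/(vw_add_const a k); exists (-1); rewrite h1 h2.
have := hclass_self M; rewrite -e => /(vtx_td_lattice uB)[k eM]; apply/(vw_add_const a k).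
move: eM hM2 hM3 hM4 => ->; move: (a + _) => {e}a hM2 hM3 hM4.
have [h1 h2] := form_int_wt hB hM4.
(* Call e the basis vector of [M]. Since pi L lies in [M], pairings of e with [M] in P^3 give
   pairings with [L] in P^2, so pi^(-2) e lies in the self-dual [L] and pi^(-1) e in [M], which is
   absurd. So each sum of dual weights is at most 2. *)
have key i : (forall y : 'cV_4, (forall j, in_Pn 0 (y j 0)) -> in_Pn 3 (form (td a *m ev i) (td a *m y))) -> False.
  move=> h; have : L (pi ^ (-2) *: (B *m td a *m ev i)).
    apply: (prim_dual hL) => y hy; rewrite sformZl (in_Pn_piM hF hpi).
    have [z hz ez] := hM2 (pi *: y) (ex_intro2 _ _ y hy erefl).
    have := h _ hz; rewrite -(form_ev _ _ _ hB) ez sformZr -[pi in pi * _]expr1z (in_Pn_piM hF hpi).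
    by apply: in_Pn_le.
  move=> hy; have := hM2 _ (ex_intro2 _ _ _ hy erefl).
  rewrite scalerA -[pi in pi * _]expr1z -exprzDr ?unitfE ?(pi_neq0 hpi)//.
  by move/(span_ev_td uB).
have le1 : wt a o0 + wt a o3 <= 2.
  rewrite leNgt; apply/negP => hlt; apply: (key o0) => y hy.
  rewrite form_td !evE /= !(mul0r, mul1r, subr0, addr0, mulr0).
  by refine (in_PnMeq hF _ (in_Pn_pi hF hpi _) (hy _)); lia.
have le2 : wt a o1 + wt a o2 <= 2.
  rewrite leNgt; apply/negP => hlt; apply: (key o1) => y hy.
  rewrite form_td !evE /= !(mul0r, mul1r, subr0, add0r, oppr0, mulr0).
  by refine (in_PnMeq hF _ (in_Pn_pi hF hpi _) (hy _)); lia.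
by exists 0; rewrite h1 h2 le1 le2.
Qed.

Lemma vtx_td_const B a k : vtx (B *m td (a + const_mx k)) = vtx (B *m td a).
Proof. by rewrite -scale_td vtxZ// (pi_exp_neq0 hpi). Qed.

Lemma vw_is_vertex B a : symplectic_basis B -> vw a -> is_vertex ord pi (vtx (B *m td a)).
Proof.
move=> hB [c hc]; have uB := symplectic_unit hB.
rewrite -(vtx_td_const B a (- c)); set a' := a + _.
have {hc} : (1 <= wt a' o0 + wt a' o3 <= 2) && (1 <= wt a' o1 + wt a' o2 <= 2).
  by rewrite /a' !wtD !wt_const; lia.
move: a' => {}a /andP[/andP[h1 h2] /andP[h3 h4]].
(* The self-dual lattice containing the given one: in each plane a pair of sum 1 has its second
   weight lowered by one, a pair of sum 2 both weights. *)
pose f (x y : int) := if x + y == 1 then x else x - 1.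
pose x := f (wt a o0) (wt a o3); pose y := f (wt a o1) (wt a o2).
pose l := row4 x y (- y) (- x).
exists (span (B *m td l)).
  by apply/prim_td => //; rewrite /prw !wt_row4 !addrN.
right; exists (span (B *m td a)) => //; split.
- by exists (B *m td a); rewrite ?unitmx_mul ?uB ?(td_unit hpi).
- rewrite dilate_td; apply/span_td_sub => //; apply: ord4_ind; rewrite wtD wt_const wt_row4 /x /y /f;
  case: eqP => ?; lia.
- apply/span_td_sub => //; apply: ord4_ind; rewrite wt_row4 /x /y /f; case: eqP => ?; lia.
- exact: wt_form_int.
Qed.

Lemma adjacent_step B a b : symplectic_basis B ->
  adjacent ord pi (vtx (B *m td a)) (vtx (B *m td b)) ->
  [/\ vw a, vw b & exists k, forall i, (0 <= wt b i - wt a i - k <= 1)].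
Proof.
move=> hB; have uB := symplectic_unit hB.
move=> [/(is_vertex_vw hB) va /(is_vertex_vw hB) vb _ [L [L' [L'' [hL [_ e'] [_ e''] hs [h1 h2 h3 h4]]]]]].
split=> //.
have mono (M N : set 'cV[F]_4) : M `<=` N -> dilate pi M `<=` dilate pi N.
  by move=> h _ [x hx <-]; exists x => //; exact: h.
have := hclass_self L'; rewrite -e' => /(vtx_td_lattice uB)[k' E'].
have := hclass_self L''; rewrite -e'' => /(vtx_td_lattice uB)[k'' E''].
case: hs => hs.
  have : dilate pi L'' `<=` L' by apply: subset_trans h1; apply: mono.
  move: hs; rewrite E' E'' dilate_td => /(span_td_sub _ _ uB) h5 /(span_td_sub _ _ uB) h6.
  exists (k' - k'' - 1) => i; have := h5 i; have := h6 i; rewrite !wtD !wt_const.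
  by move: (wt a i) (wt b i) => x y; clear; lia.
have : dilate pi L' `<=` L'' by apply: subset_trans h3; apply: mono.
move: hs; rewrite E' E'' dilate_td => /(span_td_sub _ _ uB) h5 /(span_td_sub _ _ uB) h6.
exists (k' - k'') => i; have := h5 i; have := h6 i; rewrite !wtD !wt_const.
by move: (wt a i) (wt b i) => x y; clear; lia.
Qed.

Lemma adjacent_td B a b l (ca cb : int) : symplectic_basis B -> vw a -> vw b -> prw l ->
  (forall i, wt l i <= wt a i + ca <= wt l i + 1) -> (forall i, wt l i <= wt b i + cb <= wt l i + 1) ->
  (forall i, wt a i + ca <= wt b i + cb) \/ (forall i, wt b i + cb <= wt a i + ca) ->
  (exists i j, wt a i - wt a j != wt b i - wt b j) ->
  adjacent ord pi (vtx (B *m td a)) (vtx (B *m td b)).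
Proof.
move=> hB va vb hl ha hb hab [i [j hij]]; have uB := symplectic_unit hB.
have lat c : is_lattice ord (span (B *m td c)).
  by exists (B *m td c); rewrite ?unitmx_mul ?uB ?(td_unit hpi).
split; [exact: vw_is_vertex|exact: vw_is_vertex| |].
  move=> e; have : vtx (B *m td a) (span (B *m td b)) by rewrite e; exact: vtx_in.
  move/(vtx_td_lattice uB) => [k /seteqP[/(span_td_sub _ _ uB) h1 /(span_td_sub _ _ uB) h2]].
  move/negP: hij; apply; apply/eqP.
  move: (h1 i) (h1 j) (h2 i) (h2 j); rewrite !wtD !wt_const.
  by move: (wt a i) (wt b i) (wt a j) (wt b j) => x y z t; clear; lia.
exists (span (B *m td l)), (span (B *m td (a + const_mx ca))), (span (B *m td (b + const_mx cb))).
split.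
- exact/prim_td.
- by split=> //; rewrite -(vtx_td_const B a ca).
- by split=> //; rewrite -(vtx_td_const B b cb).
- case: hab => hab; [right|left]; apply/span_td_sub => // m; rewrite !wtD !wt_const; exact: hab.
- by split; rewrite ?dilate_td; apply/span_td_sub => // m; rewrite !wtD !wt_const;
   [case/andP: (ha m)|case/andP: (ha m)|case/andP: (hb m)|case/andP: (hb m)].
Qed.

End Apartments.

(** * Geodesics *)

Section Geodesics.
Variables (F : fieldType) (ord : F -> int) (pi : F) (R : realType).
Hypotheses (hF : nonarch_local_field ord) (hpi : uniformizer ord pi).
Local Notation inw := (inw ord).
Local Notation GSp1 := (GSp1 ord).
Local Notation td := (td pi).
Local Notation GL4O := (GL4O ord).
Local Notation vtx := (vtx ord).
Local Notation even_simil := (even_simil ord).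
Implicit Types (g h s B : 'M[F]_4) (a b l : 'rV[int]_4).

Definition valid (k : option bool) g := if k is Some b then b = even_simil g else true.

Lemma diag_comm (d1 d2 : 'rV[F]_4) : diag_mx d1 *m diag_mx d2 = diag_mx d2 *m diag_mx d1.
Proof.
apply/matrixP => i j; rewrite mul_diag_mx mul_mx_diag !mxE.
by case: eqP => [->|]; rewrite ?mulr1n ?mulr0n ?mulr0 ?mul0r// mulrC.
Qed.

Lemma inw0_GL4O s : GSp1 s -> inw 0 s -> GL4O s.
Proof. by move=> h1 h2; case: (proj2 (KmaxP hF s) (conj h1 h2)). Qed.

(** The similitude factor is pushed into a diagonal matrix: its power of [pi] becomes the shift of
    weights (0, 0, m, m), and its unit part is absorbed by the lattice. *)
Lemma GSp4_decomp g : GSp4 g -> exists B m, [/\ symplectic_basis B,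
  forall a, vtx (g *m td a) = vtx (B *m td (a + row4 0 0 m m)) & even_simil g = (2 %| m)%Z].
Proof.
move=> hg; have [l l0 hl] := proj1 (GSp4P g) hg.
pose D (x : F) := diag_mx (row4 1 1 x x).
have simD x : simil x (D x).
  by apply: eq_simil; rewrite /pair !mxE /=; ring.
have [u uu el] := ord_decomp hF hpi l0.
have [u0 _] := uu.
have DM x y : D x *m D y = D (x * y).
  apply/matrixP => i j; rewrite mul_diag_mx !mxE; case: eqP => [->|_]; rewrite ?mulr1n ?mulr0n ?mulr0//.
  by move: j; apply: ord4_ind; rewrite /= ?mulr1.
have tdm : td (row4 0 0 (ord l) (ord l)) = D (pi ^ ord l).
  by apply/matrixP; apply: ord4_ind; apply: ord4_ind; rewrite tdE !wt_row4 !mxE.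
exists (g *m D l^-1), (ord l); split; last exact: (evnE hF l0 hl).
- by apply/symplectic_simil; rewrite -(divff l0); apply: similM.
- move=> a; have GU : GL4O (D u).
    apply: inw0_GL4O; first exact: (simil1_GSp1 hF uu (simD u)).
    move=> i j; rewrite /wt !mxE subrr; case: eqP => _; rewrite ?(in_Pn0 ord)// mulr1n.
    by move: i; apply: ord4_ind; rewrite /= ?(in_Pn1 hF) ?(unitO_in uu).
  have -> : g *m td a = g *m D l^-1 *m td (a + row4 0 0 (ord l) (ord l)) *m D u.
    rewrite (tdD hpi) tdm -!mulmxA DM [pi ^ _ * u]mulrC -el diag_comm [D l^-1 *m _]mulmxA DM mulVf//.
    by rewrite /D (_ : diag_mx (row4 1 1 1 1) = 1%:M) ?mul1mx//; apply/matrixP;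
      apply: ord4_ind; apply: ord4_ind; rewrite !mxE.
  by rewrite (vtx_mulr hF) //; case: GU.
Qed.

Lemma line_wt_even (b : bool) j : line_wt (Some b) j.*2 = row4 0 j%:Z j%:Z (2 * j%:Z).
Proof.
apply/matrixP => i; rewrite (ord1 i); apply: ord4_ind; rewrite !mxE //= ?odd_double ?doubleK ?addn0//.
by rewrite -mul2n PoszM.
Qed.

Lemma line_wt_odd (b : bool) j : line_wt (Some b) j.*2.+1 = row4 0 (j%:Z + b%:Z) (j%:Z + b%:Z) (2 * j%:Z + 1).
Proof.
apply/matrixP => i; rewrite (ord1 i); apply: ord4_ind; rewrite !mxE //= ?odd_double ?uphalf_double//=.
by rewrite -mul2n -addn1 PoszD PoszM.
Qed.

Lemma evenodd (i : nat) : exists j, i = j.*2 \/ i = j.*2.+1.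
Proof.
by exists i./2; rewrite -{1 3}(odd_double_half i); case: odd; [right|left].
Qed.

Lemma evenoddz (i : int) : exists j, i = 2 * j \/ i = 2 * j + 1.
Proof. by exists (i %/ 2)%Z; lia. Qed.

Ltac four i := move: i; apply: ord4_ind.
Ltac wtlia := rewrite ?(wtD, wt_row4); clear; lia.

Lemma std_vw k g i m : valid k g -> even_simil g = (2 %| m)%Z -> vw (line_wt k i + row4 0 0 m m).
Proof.
case: k => [b|_ _].
  move=> hb he; rewrite (hb : b = even_simil g) he; have [j [->|->]] := evenodd i; have [c [->|->]] := evenoddz m.
  - by rewrite line_wt_even; exists (j%:Z + c - 1); rewrite !wtD !wt_row4; clear; lia.
  - by rewrite line_wt_even; exists (j%:Z + c); rewrite !wtD !wt_row4; clear; lia.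
  - rewrite line_wt_odd (_ : (2 %| 2 * c)%Z = true); last by rewrite dvdz_mulr.
    by exists (j%:Z + c); rewrite !wtD !wt_row4; clear; lia.
  - rewrite line_wt_odd (_ : (2 %| 2 * c + 1)%Z = false); last by apply/negP; lia.
    by exists (j%:Z + c); rewrite !wtD !wt_row4; clear; lia.
have [c [e|e]] := evenoddz (i%:Z + m).
  by exists (c - 1); rewrite !wtD !wt_hyp !wt_row4; clear -e; lia.
by exists c; rewrite !wtD !wt_hyp !wt_row4; clear -e; lia.
Qed.

Lemma std_adjacent k g i : GSp4 g -> valid k g ->
  adjacent ord pi (vtx (g *m td (line_wt k i))) (vtx (g *m td (line_wt k i.+1))).
Proof.
move=> hg hv; have [B [m [hB hvt em]]] := GSp4_decomp hg; rewrite !hvt.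
have va := std_vw i hv em; have vb := std_vw i.+1 hv em.
case: k hv va vb => [b|] hv va vb; last first.
  have [c [e|e]] := evenoddz (i%:Z + m).
    (* In every case the explicit weights are those of a self-dual lattice L, and the two integers
       are the homotheties that place the two vertices between L and pi L. *)
    apply: (@adjacent_td _ _ _ hF hpi B _ _ (row4 (- c) (- c) c c) (- c) (- c)) => //.
    - by rewrite /prw !wt_row4; clear; lia.
    - by apply: ord4_ind; rewrite !wtD !wt_hyp !wt_row4; clear -e; lia.
    - by apply: ord4_ind; rewrite !wtD !wt_hyp !wt_row4; clear -e; lia.
    - by left; apply: ord4_ind; rewrite !wtD !wt_hyp !wt_row4; clear -e; lia.
    - by exists o0, o2; rewrite !wtD !wt_hyp !wt_row4; clear -e; lia.
  apply: (@adjacent_td _ _ _ hF hpi B _ _ (row4 (- c - 1) (- c - 1) (c + 1) (c + 1)) (- c) (- c - 1)) => //.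
  - by rewrite /prw !wt_row4; clear; lia.
  - by apply: ord4_ind; rewrite !wtD !wt_hyp !wt_row4; clear -e; lia.
  - by apply: ord4_ind; rewrite !wtD !wt_hyp !wt_row4; clear -e; lia.
  - by right; apply: ord4_ind; rewrite !wtD !wt_hyp !wt_row4; clear -e; lia.
  - by exists o0, o2; rewrite !wtD !wt_hyp !wt_row4; clear -e; lia.
move: hv va vb; rewrite /valid em => ->.
have [c [->|->]] := evenoddz m; [rewrite (_ : (2 %| 2 * c)%Z = true); last by rewrite dvdz_mulr|
  rewrite (_ : (2 %| 2 * c + 1)%Z = false); last by apply/negP; lia].
  have [j [->|->]] := evenodd i.
    rewrite line_wt_odd line_wt_even => va vb.
    apply: (@adjacent_td _ _ _ hF hpi B _ _ (row4 (- j%:Z - c) (- c) c (j%:Z + c)) (- j%:Z - c) (- j%:Z - c)) => //.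
    - by rewrite /prw !wt_row4; clear; lia.
    - by apply: ord4_ind; rewrite !wtD !wt_row4; clear; lia.
    - by apply: ord4_ind; rewrite !wtD !wt_row4; clear; lia.
    - by left; apply: ord4_ind; rewrite !wtD !wt_row4; clear; lia.
    - by exists o0, o1; rewrite !wtD !wt_row4; clear; lia.
  rewrite -doubleS line_wt_odd line_wt_even => va vb.
  apply: (@adjacent_td _ _ _ hF hpi B _ _ (row4 (- j%:Z - c - 1) (- c) c (j%:Z + c + 1)) (- j%:Z - c) (- j%:Z - c)) => //.
  - by rewrite /prw !wt_row4; clear; lia.
  - by apply: ord4_ind; rewrite !wtD !wt_row4; clear; lia.
  - by apply: ord4_ind; rewrite !wtD !wt_row4; clear; lia.
  - by left; apply: ord4_ind; rewrite !wtD !wt_row4; clear; lia.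
  - by exists o0, o3; rewrite !wtD !wt_row4; clear; lia.
have [j [->|->]] := evenodd i.
  rewrite line_wt_odd line_wt_even => va vb.
  apply: (@adjacent_td _ _ _ hF hpi B _ _ (row4 (- j%:Z - c - 1) (- c) c (j%:Z + c + 1)) (- j%:Z - c) (- j%:Z - c)) => //.
  - by rewrite /prw !wt_row4; clear; lia.
  - by apply: ord4_ind; rewrite !wtD !wt_row4; clear; lia.
  - by apply: ord4_ind; rewrite !wtD !wt_row4; clear; lia.
  - by left; apply: ord4_ind; rewrite !wtD !wt_row4; clear; lia.
  - by exists o0, o3; rewrite !wtD !wt_row4; clear; lia.
rewrite -doubleS line_wt_odd line_wt_even => va vb.
apply: (@adjacent_td _ _ _ hF hpi B _ _ (row4 (- j%:Z - c - 1) (- c) c (j%:Z + c + 1)) (- j%:Z - c) (- j%:Z - c - 1)) => //.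
- by rewrite /prw !wt_row4; clear; lia.
- by apply: ord4_ind; rewrite !wtD !wt_row4; clear; lia.
- by apply: ord4_ind; rewrite !wtD !wt_row4; clear; lia.
- by right; apply: ord4_ind; rewrite !wtD !wt_row4; clear; lia.
- by exists o0, o1; rewrite !wtD !wt_row4; clear; lia.
Qed.

Lemma coordE a : apartment_coord R a =
  \row_(k < 2) (if (k == 0 :> nat)%N then (wt a o0 - wt a o3)%:~R else (wt a o1 - wt a o2)%:~R).
Proof.
apply/matrixP => i [[|[|k]] hk]; rewrite !mxE //= /wt; congr ((a _ _ - a _ _)%:~R);
  by apply: val_inj.
Qed.

Lemma std_geodesic k g i0 n : GSp4 g -> valid k g ->
  geodesic_path ord pi R n (fun i => vtx (g *m td (line_wt k (i0 + i)%N))).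
Proof.
move=> hg hv; split=> [i hi|]; first by rewrite addnS; exact: std_adjacent.
have [B [m [hB hvt em]]] := GSp4_decomp hg.
exists B, (fun i => line_wt k (i0 + i)%N + row4 0 0 m m).
exists (apartment_coord R (line_wt k i0 + row4 0 0 m m)).
exists (\row_(j < 2) (if (j == 0 :> nat)%N then -1 else if k is Some _ then 0 else -1)).
exists (fun i => i%:R); split => //.
- by apply/eqP => /matrixP/(_ 0 0); rewrite !mxE /= => /eqP; rewrite oppr_eq0 oner_eq0.
- by move=> i _; rewrite ltr_nat.
- move=> i _; rewrite !coordE; apply/matrixP => j [[|[|l]] hl]; rewrite !mxE //= !wtD !wt_row4.
    set x := (X in X%:~R = _); set y := (X in _ = X%:~R + _).
    have -> : x = y - i%:Z.
      by rewrite /x /y; case: k {hv x y} => [b|]; rewrite ?wt_ax ?wt_hyp PoszD; lia.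
    by rewrite rmorphB mulrN1.
  set x := (X in X%:~R = _); set y := (X in _ = X%:~R + _).
  have -> : x = y - (if k is Some _ then 0 else i%:Z).
    by rewrite /x /y; case: k {hv x y} => [b|]; rewrite ?wt_ax ?wt_hyp ?PoszD; lia.
  by rewrite rmorphB /=; move: (y%:~R) => z; case: k {hv x y} => [b|]; rewrite ?mulr0 ?mulrN1 ?subr0 ?addr0.
Qed.

(** An integer of absolute value at most 1 is determined by its sign. As the coordinates of adjacent
    vertices differ by at most 1, a straight path has constant steps, and no slopes occur besides
    those of axes and diagonals. *)
Lemma sgz_step (e : int) (t d : R) : -1 <= e <= 1 -> 0 < t -> e%:~R = t * d -> e = sgz d.
Proof.
move=> he ht h; have := congr1 (@sgz R) h; rewrite sgzM (gtr0_sgz ht) mul1r => <-.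
by rewrite sgz_int; have [->|[->|->]] : e = -1 \/ e = 0 \/ e = 1 by lia.
Qed.

Definition apath n (v : nat -> set (set 'cV[F]_4)) B (x y e1 e2 : int) :=
  symplectic_basis B /\ forall i, (i <= n)%N -> exists a,
    [/\ vw a, v i = vtx (B *m td a), wt a o0 - wt a o3 = x + i%:Z * e1
      & wt a o1 - wt a o2 = y + i%:Z * e2].

Lemma geodesic_apath n v : (0 < n)%N -> geodesic_path ord pi R n v ->
  exists B x y e1 e2, [/\ apath n v B x y e1 e2, -1 <= e1 <= 1, -1 <= e2 <= 1,
    (e1 != 0) || (e2 != 0) & (e1 != 0) && (e2 != 0) -> exists c, x + y = 2 * c].
Proof.
move=> n0 [hadj [B [a [p [d [t [hB hv d0 ht hc]]]]]]].
pose x i := wt (a i) o0 - wt (a i) o3; pose y i := wt (a i) o1 - wt (a i) o2.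
have step i : (i < n)%N -> [/\ vw (a i), vw (a i.+1) &
    exists k, forall j, 0 <= wt (a i.+1) j - wt (a i) j - k <= 1].
  move=> hi; have := hadj i hi; rewrite !hv ?(ltnW hi)//.
  exact: (adjacent_step hF hpi hB).
have c0 i : (i <= n)%N -> (x i)%:~R = p 0 0 + t i * d 0 0.
  move=> hi; have := congr1 (fun M : 'rV[R]_2 => M 0 0) (hc i hi).
  by rewrite coordE !mxE.
have c1 i : (i <= n)%N -> (y i)%:~R = p 0 1 + t i * d 0 1.
  move=> hi; have := congr1 (fun M : 'rV[R]_2 => M 0 1) (hc i hi).
  by rewrite coordE !mxE.
have bx i : (i < n)%N -> -1 <= x i.+1 - x i <= 1.
  move=> hi; have [_ _ [k hk]] := step i hi; rewrite /x; move: (hk o0) (hk o3).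
  move: (wt _ _) (wt _ _) (wt _ _) (wt _ _) => *; clear hc c0 c1; lia.
have by_ i : (i < n)%N -> -1 <= y i.+1 - y i <= 1.
  move=> hi; have [_ _ [k hk]] := step i hi; rewrite /y; move: (hk o1) (hk o2).
  move: (wt _ _) (wt _ _) (wt _ _) (wt _ _) => *; clear hc c0 c1; lia.
have sx i : (i < n)%N -> x i.+1 - x i = sgz (d 0 0).
  move=> hi; apply: (@sgz_step _ (t i.+1 - t i)); rewrite ?bx// ?subr_gt0 ?ht//.
  by rewrite rmorphB /= !c0 ?(ltnW hi)// mulrBl opprD addrACA subrr add0r.
have sy i : (i < n)%N -> y i.+1 - y i = sgz (d 0 1).
  move=> hi; apply: (@sgz_step _ (t i.+1 - t i)); rewrite ?by_// ?subr_gt0 ?ht//.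
  by rewrite rmorphB /= !c1 ?(ltnW hi)// mulrBl opprD addrACA subrr add0r.
exists B, (x 0%N), (y 0%N), (sgz (d 0 0)), (sgz (d 0 1)); split.
- split=> // i hi; exists (a i).
  have hxy : x i = x 0%N + i%:Z * sgz (d 0 0) /\ y i = y 0%N + i%:Z * sgz (d 0 1).
    elim: i hi => [|i IH] hi; first by rewrite !mul0r !addr0.
    have [ex ey] := IH (ltnW hi).
    by rewrite -(subrK (x i) (x i.+1)) -(subrK (y i) (y i.+1)) sx// sy// ex ey intS;
      split; ring.
  split; [|exact: hv|by case: hxy|by case: hxy].
  case: i hi {hxy} => [|i] hi; first by case: (step 0%N n0).
  by case: (step i hi).
- by rewrite -(sx 0%N n0) bx.
- by rewrite -(sy 0%N n0) by_.
- rewrite -negb_and; apply/negP => /andP[]; rewrite !sgz_eq0 => /eqP h0 /eqP h1.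
  case/eqP: d0; apply/matrixP => i j; rewrite (ord1 i) mxE.
  case: j => -[|[|j]] hj //; [rewrite -[RHS]h0|rewrite -[RHS]h1]; congr (d _ _); exact: val_inj.
(* A diagonal step changes both sums of dual weights by the same odd number. Two different sums
   could not both stay admissible for [vw], so the sums agree: the starting vertex is special, and x
   + y is even. *)
- rewrite -(sx 0%N n0) -(sy 0%N n0) => /andP[].
  have [[c hc'] [c' hc''] [k hk]] := step _ n0.
  rewrite /x /y; move: hc' hc'' (hk o0) (hk o1) (hk o2) (hk o3).
  move: (wt (a 0%N) o0) (wt (a 0%N) o1) (wt (a 0%N) o2) (wt (a 0%N) o3)
    (wt (a 1%N) o0) (wt (a 1%N) o1) (wt (a 1%N) o2) (wt (a 1%N) o3) => p0 p1 p2 p3 q0 q1 q2 q3.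
  clear => h1 h2 h3 h4 h5 h6 h7 h8.
  by exists (p0 + p1 - (p0 + p3)); lia.
Qed.

(** The coordinates fix the parities of the two sums of dual weights, and [vw] allows one value for
    each parity once the homothety is fixed. *)
Lemma vtx_td_eq B a a' : vw a -> vw a' -> wt a o0 - wt a o3 = wt a' o0 - wt a' o3 ->
  wt a o1 - wt a o2 = wt a' o1 - wt a' o2 -> vtx (B *m td a) = vtx (B *m td a').
Proof.
move=> [c h] [c' h'] h1 h2.
have -> : a = a' + const_mx (c - c'); last by rewrite vtx_td_const.
apply/matrixP => i; rewrite (ord1 i) => {i} i.
have -> : a 0 i = wt a i by []. have -> : (a' + const_mx (c - c')) 0 i = wt (a' + const_mx (c - c')) i by [].
rewrite wtD wt_const.
move: h h' h1 h2; move: i; apply: ord4_ind; move: (wt a o0) (wt a o1) (wt a o2) (wt a o3) (wt a' o0) (wt a' o1) (wt a' o2) (wt a' o3);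
  clear => *; lia.
Qed.

(** Reflections of the apartment: [s1] exchanges the two coordinates and [s2] negates the second
    one. With them any direction is brought to (-1, 0) or (-1, -1). *)
Lemma apath_s1 n v B x y e1 e2 : apath n v B x y e1 e2 -> apath n v (B *m s1 F) y x e2 e1.
Proof.
move=> [hB h]; have [hs h0 _] := s1_par hF; split.
  by apply/symplectic_simil; rewrite -[1]mulr1; apply: similM (s1_simil F); apply/symplectic_simil.
move=> i hi; have [a [[c hc] -> ex ey]] := h i hi.
exists (row4 (wt a o1) (wt a o0) (wt a o3) (wt a o2)); split; rewrite ?wt_row4//.
  by exists c; rewrite !wt_row4; move: hc; clear; lia.
rewrite -(vtx_mulr hF (B *m td a) _ (inw0_GL4O hs h0)); last by case: hs => /GSp4_unit.
congr vtx; rewrite -!mulmxA; congr (_ *m _); apply/matrixP => j k; rewrite mul_td mul_mx_td.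
by move: j k; apply: ord4_ind; apply: ord4_ind; rewrite !wt_row4 !mxE /= ?mulr0 ?mul0r ?mulr1 ?mul1r.
Qed.

Lemma apath_s2 n v B x y e1 e2 : apath n v B x y e1 e2 -> apath n v (B *m s2 F) x (- y) e1 (- e2).
Proof.
move=> [hB h]; have [hs h0 _] := s2_par hF; split.
  by apply/symplectic_simil; rewrite -[1]mulr1; apply: similM (s2_simil F); apply/symplectic_simil.
move=> i hi; have [a [[c hc] -> ex ey]] := h i hi.
exists (row4 (wt a o0) (wt a o2) (wt a o1) (wt a o3)); split; rewrite ?wt_row4//.
- by exists c; rewrite !wt_row4; move: hc; clear; lia.
- rewrite -(vtx_mulr hF (B *m td a) _ (inw0_GL4O hs h0)); last by case: hs => /GSp4_unit.
  congr vtx; rewrite -!mulmxA; congr (_ *m _); apply/matrixP => j k; rewrite mul_td mul_mx_td.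
  by move: j k; apply: ord4_ind; apply: ord4_ind; rewrite !wt_row4 !mxE /= ?mulr0 ?mul0r ?mulr1 ?mul1r ?mulrN1 ?mulN1r.
- by rewrite mulrN -opprD -ey opprB.
Qed.

Lemma apath_std n v B x y e2 : apath n v B x y (-1) e2 -> e2 = 0 \/ e2 = -1 ->
  (e2 != 0 -> exists c, x + y = 2 * c) ->
  exists g k i0, [/\ GSp4 g, valid k g &
    forall i, (i <= n)%N -> v i = vtx (g *m td (line_wt k (i0 + i)%N))].
Proof.
move=> [hB h] he hc.
have [a [va ev0]] := h 0%N isT; rewrite !mul0r !addr0 => ex ey; case: (va) => c hcc.
have fin A k i0 : (forall i, vw (A + line_wt k (i0 + i)%N)) ->
    wt A o0 + wt A o3 = wt A o1 + wt A o2 ->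
    (if k is Some b then b = (2 %| (wt A o0 + wt A o3))%Z else true) ->
    (forall i : nat, wt A o0 + wt (line_wt k (i0 + i)%N) o0 - wt A o3 - wt (line_wt k (i0 + i)%N) o3 = x - i%:Z) ->
    (forall i : nat, wt A o1 + wt (line_wt k (i0 + i)%N) o1 - wt A o2 - wt (line_wt k (i0 + i)%N) o2 = y + i%:Z * e2) ->
    exists g k i0, [/\ GSp4 g, valid k g &
      forall i, (i <= n)%N -> v i = vtx (g *m td (line_wt k (i0 + i)%N))].
  move=> vA hA hk hx hy; exists (B *m td A), k, i0.
  have sg : simil (pi ^ (wt A o0 + wt A o3)) (B *m td A).
    rewrite -[pi ^ _]mul1r; apply: similM; first exact/symplectic_simil.
    by apply: (td_simil hpi).
  split.
  - by apply/GSp4P; exists (pi ^ (wt A o0 + wt A o3)); rewrite ?(pi_exp_neq0 hpi).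
  - case: k hk {vA hx hy} => // b ->.
    by rewrite /valid (evnE hF _ sg) ?(pi_exp_neq0 hpi)// (ord_pi_exp hF hpi).
  - move=> i hi; have [a' [va' -> ex' ey']] := h i hi.
    rewrite -mulmxA -(tdD hpi); apply: vtx_td_eq => //; rewrite !wtD.
      have := hx i; rewrite ex'; move: (wt _ _) (wt _ _) (wt _ _) (wt _ _); clear => *; lia.
    have := hy i; rewrite ey'; move: (wt _ _) (wt _ _) (wt _ _) (wt _ _); clear => *; lia.
set S := wt a o0 + wt a o3 in hcc; set T := wt a o1 + wt a o2 in hcc.
case: he => he; rewrite he in hc fin *; last first.
  have [c' hc'] : exists c', x + y = 2 * c' by apply: hc.
  have ST : S = T by move: hc' hcc ex ey; rewrite /S /T; move: (wt _ _) (wt _ _) (wt _ _) (wt _ _); clear => *; lia.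
  apply: (fin a None 0%N) => // i; rewrite ?wt_hyp add0n.
  - have [j [ej|ej]] := evenoddz (S + i%:Z); [exists (j - 1)|exists j];
    by move: ej ST; rewrite !wtD !wt_hyp /S /T; clear => *; lia.
  - by rewrite -ex; lia.
  - by rewrite -ey; lia.
have [ST|ST] := eqVneq S T.
  apply: (fin a (Some (2 %| S)%Z) 0%N) => // i; rewrite ?wt_ax add0n; last 2 first.
  - by rewrite -ex; lia.
  - by rewrite -ey; lia.
  have [d [ed|ed]] := evenoddz S; rewrite ed; [rewrite (_ : (2 %| 2 * d)%Z = true); last by rewrite dvdz_mulr|
    rewrite (_ : (2 %| 2 * d + 1)%Z = false); last by apply/negP; lia];
  have [j [->|->]] := evenodd i; rewrite ?line_wt_odd ?line_wt_even.
  - by exists (d + j%:Z - 1); move: ST ed; rewrite !wtD !wt_row4 /S /T; clear => *; lia.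
  - by exists (d + j%:Z); move: ST ed; rewrite !wtD !wt_row4 /S /T; clear => *; lia.
  - by exists (d + j%:Z); move: ST ed; rewrite !wtD !wt_row4 /S /T; clear => *; lia.
  - by exists (d + j%:Z); move: ST ed; rewrite !wtD !wt_row4 /S /T; clear => *; lia.
(* The path starts at a non-special vertex. The line is then based one step earlier, at a special
   vertex, and the path starts at index 1; which sum is the smaller one decides between the first
   steps (0, 1, 1, 1) and (0, 0, 0, 1). *)
have [[e1 e2']|[e1 e2']] : (S = 2 * c + 1 /\ T = 2 * c + 2) \/ (S = 2 * c + 2 /\ T = 2 * c + 1).
  by move: ST hcc; move: S T; clear => *; lia.
- apply: (fin (a + row4 0 (-1) (-1) (-1)) (Some true) 1%N).
  + move=> i; have [j [->|->]] := evenodd (1 + i)%N; rewrite ?line_wt_odd ?line_wt_even;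
    [exists (c + j%:Z - 1)|exists (c + j%:Z)];
    by move: e1 e2'; rewrite !wtD !wt_row4 /S /T; clear => *; lia.
  + by move: e1 e2'; rewrite !wtD !wt_row4 /S /T; clear => *; lia.
  + by move: e1 e2'; rewrite !wtD !wt_row4 /S /T; clear => *; apply/esym; lia.
  + by move=> i; move: ex; rewrite !wtD !wt_row4; clear => *; lia.
  + move=> i; move: ey; rewrite !wtD wt_ax !wt_row4; move: ((_ + _)%N) => q; clear => *; lia.
- apply: (fin (a + row4 0 0 0 (-1)) (Some false) 1%N).
  + move=> i; have [j [->|->]] := evenodd (1 + i)%N; rewrite ?line_wt_odd ?line_wt_even; exists (c + j%:Z);
    by move: e1 e2'; rewrite !wtD !wt_row4 /S /T; clear => *; lia.
  + by move: e1 e2'; rewrite !wtD !wt_row4 /S /T; clear => *; lia.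
  + by move: e1 e2'; rewrite !wtD !wt_row4 /S /T; clear => *; apply/esym/negP; lia.
  + by move=> i; move: ex; rewrite !wtD !wt_row4; clear => *; lia.
  + move=> i; move: ey; rewrite !wtD wt_ax !wt_row4; move: ((_ + _)%N) => q; clear => *; lia.
Qed.

Lemma geodesic_std n v : (0 < n)%N -> geodesic_path ord pi R n v ->
  exists g k i0, [/\ GSp4 g, valid k g &
    forall i, (i <= n)%N -> v i = vtx (g *m td (line_wt k (i0 + i)%N))].
Proof.
move=> n0 /(geodesic_apath n0)[B [x [y [e1 [e2 [h h1 h2 h3 h4]]]]]].
wlog e1n : B x y e1 e2 h h1 h2 h3 h4 / e1 != 0.
  move=> W; have [e10|] := eqVneq e1 0; last exact: W h h1 h2 h3 h4.
  apply: (W _ _ _ _ _ (apath_s1 h)) => //; rewrite 1?orbC 1?andbC//.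
    by move=> hh; have [c hc] := h4 hh; exists c; rewrite addrC.
  by move: h3; rewrite e10 eqxx.
wlog {e1n} e1n : B x y e1 e2 h h1 h2 h3 h4 / e1 = -1.
  move=> W; have [e11|e11] : e1 = -1 \/ e1 = 1 by move: e1n h1; clear => *; lia.
    exact: W h h1 h2 h3 h4 e11.
  apply: (W _ _ _ _ _ (apath_s1 (apath_s2 (apath_s1 h)))) => //; rewrite ?e11 ?oppr_eq0 ?oner_eq0//=.
  move=> he; have [|c hc] := h4; first by rewrite e11 oner_eq0.
  by exists (y - (x + y) + c); move: hc; clear; lia.
rewrite e1n in h h4.
have {}h4 : e2 != 0 -> exists c, x + y = 2 * c by rewrite /= in h4.
wlog e2n : B x y e2 h h2 h4 {h3} / e2 = 0 \/ e2 = -1.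
  move=> W; have [e20|e21] : (e2 = 0 \/ e2 = -1) \/ e2 = 1 by move: h2; clear => *; lia.
    exact: W h h2 h4 e20.
  apply: (W _ _ _ _ (apath_s2 h)); rewrite ?e21//; last by right.
  have [|c hc] := h4; first by rewrite e21.
  by move=> _; exists (c - y); move: hc; clear; lia.
exact: apath_std h e2n h4.
Qed.

End Geodesics.

(** * Lattices *)

Section Lattices.
Variables (F : fieldType) (ord : F -> int) (pi : F).
Hypotheses (hF : nonarch_local_field ord) (hpi : uniformizer ord pi).
Local Notation in_Pn := (in_Pn ord).
Local Notation unitO := (unitO ord).
Local Notation GL4O := (GL4O ord).
Local Notation span := (span_cols ord).
Local Notation form := Defs.form.
Implicit Types (g h s x : 'M[F]_4) (v w : 'cV[F]_4).

Definition intv v := forall i, in_Pn 0 (v i 0).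
Local Notation L0 := intv.

Lemma residues (N : nat) : exists s : seq F, forall x : F, in_Pn 0 x -> exists2 y, y \in s & in_Pn N%:Z (x - y).
Proof.
have [s1 h1] := residue_field_finite hF.
elim: N => [|N [s hs]].
  by exists [:: 0] => x hx; exists 0; rewrite ?mem_head// subr0.
exists [seq y + pi * z | y <- s1, z <- s] => x /h1[y ys hy].
have hx' : in_Pn 0 (pi ^ (-1) * (x - y)) by rewrite (in_Pn_piM hF hpi) sub0r opprK.
have [z zs hz] := hs _ hx'.
exists (y + pi * z); first by apply/allpairsP; exists (y, z).
have -> : x - (y + pi * z) = pi ^ 1%:Z * (pi ^ (-1) * (x - y) - z).
  by rewrite expr1z exprN1 mulrBr mulrA divff ?(pi_neq0 hpi)// mul1r opprD addrA.
rewrite (in_Pn_piM hF hpi); apply: in_Pn_le hz; lia.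
Qed.

Lemma mx_residues (N : nat) : exists S : seq 'M[F]_4,
  forall M, mxin ord 0 M -> exists2 M', M' \in S & mxin ord N%:Z (M - M').
Proof.
have [s hs] := residues N.
exists [seq map_mx (fun i : 'I_(size s) => nth 0 s i) A | A <- enum {: 'M['I_(size s)]_4}] => M hM.
have /choice[f hf] : forall ij : 'I_4 * 'I_4, exists k : 'I_(size s),
    in_Pn N%:Z (M ij.1 ij.2 - nth 0 s k).
  move=> ij; have [y ys hy] := hs _ (hM ij.1 ij.2).
  have hi : (index y s < size s)%N by rewrite index_mem.
  by exists (Ordinal hi); rewrite /= nth_index.
exists (map_mx (fun i : 'I_(size s) => nth 0 s i) (\matrix_(i, j) f (i, j))).
  by apply/mapP; exists (\matrix_(i, j) f (i, j)); rewrite ?mem_enum.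
by move=> i j; rewrite !mxE; exact: (hf (i, j)).
Qed.

(** Compactness of the integral matrices, in the form of a pigeonhole principle modulo P^N. *)
Lemma mx_pigeonhole (N : nat) (f : nat -> 'M[F]_4) : (forall i, mxin ord 0 (f i)) ->
  exists i j, (i < j)%N /\ mxin ord N%:Z (f j - f i).
Proof.
move=> hf; have [S hS] := mx_residues N.
have /choice[r hr] : forall i, exists M', M' \in S /\ mxin ord N%:Z (f i - M').
  by move=> i; have [M' h1 h2] := hS _ (hf i); exists M'.
have hi i : (index (r i) S < size S)%N by rewrite index_mem; case: (hr i).
pose u (i : 'I_(size S).+1) := Ordinal (hi i).
have /injectivePn[i [j ij e]] : ~~ injectiveb u.
  by apply/negP => /injectiveP/leq_card; rewrite !card_ord ltnn.
have e' : r i = r j.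
  have := congr1 val e; rewrite /= => e1.
  by rewrite -(nth_index 0 (proj1 (hr i))) e1 nth_index//; case: (hr j).
have key i' j' : r i' = r j' -> mxin ord N%:Z (f j' - f i').
  move=> e2; have -> : f j' - f i' = (f j' - r j') - (f i' - r i').
    by rewrite e2 opprB addrA subrK.
  by apply: (mxinB hF); [case: (hr j')|case: (hr i')].
have : (i != j :> nat)%N by [].
rewrite neq_ltn => /orP[lt|lt]; first by exists i, j; split=> //; exact: key.
by exists j, i; split=> //; apply: key.
Qed.

Lemma GL4OX s n : GL4O s -> GL4O (s ^+ n).
Proof.
move=> hs; elim: n => [|n IH]; first by rewrite expr0; exact: GL4O1.
by rewrite exprS; apply: (GL4OM hF).
Qed.

Lemma GL4O_power s (N : nat) : GL4O s -> exists2 n, (0 < n)%N & mxin ord N%:Z (s ^+ n - 1).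
Proof.
move=> hs; have [i|i [j [ij h]]] := @mx_pigeonhole N (fun i => s ^+ i).
  by case: (GL4OX i hs).
exists (j - i)%N; first by rewrite subn_gt0.
have [ui _ hi] := GL4OX i hs.
have -> : s ^+ (j - i) - 1 = invmx (s ^+ i) *m (s ^+ j - s ^+ i).
  have e : s ^+ j = s ^+ i *m s ^+ (j - i) by rewrite mulmxE -exprD subnKC// ltnW.
  by rewrite e mulmxBr mulKmx// mulVmx.
by apply: (mxinMeq hF (k := 0) _ hi h); rewrite add0r.
Qed.

Lemma conj_expr h s n : h \in unitmx -> (invmx h *m s *m h) ^+ n = invmx h *m s ^+ n *m h.
Proof.
move=> uh; elim: n => [|n IH]; first by rewrite !expr0 mulmx1 mulVmx.
by rewrite !exprS IH -!mulmxE !mulmxA mulmxK.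
Qed.

Lemma span1 v : span 1%:M v <-> L0 v.
Proof. by split=> [[w hw <-]|hv]; [rewrite mul1mx|exists v; rewrite ?mul1mx]. Qed.

Definition submod (Q : set 'cV[F]_4) :=
  (forall v w, Q v -> Q w -> Q (v + w)) /\ (forall c v, in_Pn 0 c -> Q v -> Q (c *: v)).

Definition bounded (Q : set 'cV[F]_4) := exists k : nat,
  (forall v, L0 v -> Q (pi ^ k%:Z *: v)) /\ (forall v, Q v -> L0 (pi ^ k%:Z *: v)).

Lemma submod_sum Q (I : Type) (r : seq I) (f : I -> 'cV[F]_4) : submod Q -> Q 0 ->
  (forall i, Q (f i)) -> Q (\sum_(i <- r) f i).
Proof. by move=> [hD _] h0 hf; elim/big_ind: _ => // v w; exact: hD. Qed.

Lemma mulmx_sum_col g v : g *m v = \sum_i v i 0 *: col i g.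
Proof.
apply/matrixP => i j; rewrite (ord1 j) mxE summxE.
by apply: eq_bigr => k _; rewrite !mxE mulrC.
Qed.

Lemma submod_span Q g : submod Q -> (forall i, Q (col i g)) -> span g `<=` Q.
Proof.
move=> hQ hg _ [v hv <-]; rewrite mulmx_sum_col; have [_ hZ] := hQ.
apply: submod_sum => //; last by move=> i; apply: hZ.
by rewrite -(scale0r (col o0 g)); apply: hZ; rewrite ?(in_Pn0 ord).
Qed.

Definition set_col i v g : 'M[F]_4 := \matrix_(k, j) if j == i then v k 0 else g k j.

Lemma det_set_col g i w : \det (set_col i (g *m w) g) = \det g * w i 0.
Proof.
rewrite (expand_det_col _ i).
have -> : \det g * w i 0 = (\adj g *m (g *m w)) i 0.
  by rewrite mulmxA mul_adj_mx mul_scalar_mx mxE.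
rewrite mxE; apply: eq_bigr => k _; rewrite [set_col _ _ _ _ _]mxE eqxx mulrC [\adj g _ _]mxE.
congr (_ * _); rewrite /cofactor; congr (_ * \det _).
by apply/matrixP => a b; rewrite !mxE eq_sym (negPf (neq_lift _ _)).
Qed.

Lemma ex_min_int (P : int -> Prop) (n0 : int) : (exists n, P n) -> (forall n, P n -> n0 <= n) ->
  exists2 n, P n & forall m, P m -> n <= m.
Proof.
move=> [n hn] hb; pose p (k : nat) := `[< P (n0 + k%:Z) >].
have ep : exists k, p k.
  by exists `|n - n0|%N; apply/asboolP; have := hb _ hn => h; rewrite (_ : n0 + _ = n)//; lia.
case: (ex_minnP ep) => k /asboolP hk hmin; exists (n0 + k%:Z) => // m hm.
have hm0 := hb _ hm; have := hmin `|m - n0|%N.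
move=> H; have : (k <= `|m - n0|)%N.
  by apply: H; apply/asboolP; rewrite (_ : n0 + _ = m)//; lia.
by lia.
Qed.

(* A matrix of vectors of [Q] whose determinant is of maximal absolute value
   has [Q] as its column span, by Cramer's rule. *)
Lemma lattice_of_submod Q : submod Q -> bounded Q -> exists2 g, g \in unitmx & Q = span g.
Proof.
move=> hQ [k [h1 h2]].
pose P n := exists g, [/\ g \in unitmx, forall i, Q (col i g) & ord (\det g) = n].
have [||n [g [ug hg on]] hmin] := @ex_min_int P (- (k%:Z *+ 4)).
- exists (ord (\det (pi ^ k%:Z *: (1%:M : 'M[F]_4)))), (pi ^ k%:Z *: 1%:M); split=> //.
    by rewrite unitmxZ ?unitmx1// unitfE (pi_exp_neq0 hpi).
  by move=> i; rewrite linearZ /=; apply: h1 => j; exact: ev_int.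
- move=> _ [g [ug hg <-]]; have dg : \det g != 0 by rewrite -unitfE -unitmxE.
  have hk : mxin ord 0 (pi ^ k%:Z *: g).
    by move=> i j; have := h2 _ (hg j) i; rewrite !mxE.
  have := mxin_det hF hk; rewrite in_Pn_ord; last first.
    rewrite detZ; apply: mulf_neq0 => //; apply: expf_neq0; exact: (pi_exp_neq0 hpi).
  by rewrite (ord_detZ hF) ?(pi_exp_neq0 hpi)// (ord_pi_exp hF hpi); lia.
exists g => //; apply/seteqP; split=> [v hv|]; last exact: submod_span.
exists (invmx g *m v); last by rewrite mulKVmx.
move=> i /=; set w := invmx g *m v.
have [->|w0] := eqVneq (w i 0) 0; first exact: in_Pn0.
have dg : \det g != 0 by rewrite -unitfE -unitmxE.
have ev' : \det (set_col i v g) = \det g * w i 0.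
  by rewrite -det_set_col /w mulKVmx.
rewrite in_Pn_ord// -(lerD2l n) addr0 -on -(ordMn0 hF)// -ev' on; apply: hmin.
exists (set_col i v g); split=> //.
  by rewrite unitmxE unitfE ev' mulf_neq0.
move=> j; have [->|ji] := eqVneq j i.
  rewrite (_ : col i _ = v)//; apply/matrixP => a b; by rewrite !mxE eqxx (ord1 b).
rewrite (_ : col j _ = col j g)//; apply/matrixP => a b; by rewrite !mxE (negPf ji).
Qed.

Definition selfdual (Q : set 'cV[F]_4) := forall v, Q v <-> forall w, Q w -> in_Pn 0 (form v w).

Lemma sformC v w : form w v = - form v w. Proof. by rewrite !sformE; ring. Qed.
Lemma sformDl v v' w : form (v + v') w = form v w + form v' w.
Proof. by rewrite !sformE !mxE; ring. Qed.
Lemma sformDr v w w' : form v (w + w') = form v w + form v w'.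
Proof. by rewrite !sformE !mxE; ring. Qed.

Lemma selfdual_unit Q v : submod Q -> selfdual Q -> Q v -> ~ Q (pi^-1 *: v) ->
  exists2 w, Q w & form v w = 1.
Proof.
move=> [_ hZ] hs hv hv'; have [w [hw hvw]] : exists w, Q w /\ ~~ in_Pn 0 (form (pi^-1 *: v) w).
  apply/not_existsP => H; apply: hv'; apply/hs => w hw.
  by apply/negPn/negP => h; apply: (H w).
have u : unitO (form v w).
  apply: unitOP; first exact: (proj1 (hs v) hv).
  apply: contraNN hvw; rewrite sformZl -exprN1 (in_Pn_piM hF hpi); exact: in_Pn_le.
exists ((form v w)^-1 *: w); last by rewrite sformZr mulVf//; case: u.
by apply: hZ => //; apply/unitO_in/(unitOV hF).
Qed.

Lemma scale_primitive Q v : bounded Q -> v != 0 ->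
  exists k : int, Q (pi ^ k *: v) /\ ~ Q (pi^-1 *: (pi ^ k *: v)).
Proof.
move=> [m [h1 h2]] v0.
have [i vi] : exists i, v i 0 != 0.
  apply: contrapT => /forallNP H; case/eqP: v0; apply/matrixP => a b.
  by rewrite (ord1 b) mxE; apply/eqP/negPn/negP; exact: H.
have [||k hk hmin] := @ex_min_int (fun k => Q (pi ^ k *: v)) (- m%:Z - ord (v i 0)).
- have [k hk] := mxin_bound ord v; exists (m%:Z + k%:Z).
  rewrite exprzDr ?unitfE ?(pi_neq0 hpi)// -scalerA; apply: h1 => j.
  by rewrite mxE (in_Pn_piM hF hpi) sub0r.
- move=> k /h2 /(_ i); rewrite !mxE !(in_Pn_piM hF hpi) in_Pn_ord// => h; move: h; move: (ord _) => o h; clear -h; lia.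
exists k; split=> //; rewrite scalerA -exprN1 -exprzDr ?unitfE ?(pi_neq0 hpi)//.
by move=> /hmin; lia.
Qed.

Lemma orthogonal_vector v w : exists2 u, u != 0 & form u v = 0 /\ form u w = 0.
Proof.
pose A := row_mx (Jmx F *m v) (Jmx F *m w).
have : kermx A != 0.
  rewrite kermx_eq0 /row_free; apply/eqP => h.
  by have := rank_leq_col A; rewrite h.
case/rowV0Pn => u /sub_kermxP hu u0; exists u^T.
  by apply: contra u0 => /eqP h; rewrite -[u]trmxK h trmx0.
rewrite /A mul_mx_row in hu.
have [e1 e2] : u *m (Jmx F *m v) = 0 /\ u *m (Jmx F *m w) = 0.
  have := congr1 lsubmx hu; have := congr1 rsubmx hu; rewrite row_mxKl row_mxKr.
  by move=> -> ->; split; apply/matrixP => i j; rewrite !mxE.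
by rewrite /Defs.form trmxK -!mulmxA e1 e2 !mxE.
Qed.

Lemma simil_form g : simil 1 g <-> forall i j, form (col i g) (col j g) = Jmx F i j.
Proof.
have e i j : form (col i g) (col j g) = (g^T *m Jmx F *m g) i j.
  by rewrite sformE pairE /pair !mxE.
split=> [h i j|h]; first by rewrite e h scale1r.
by rewrite /simil scale1r; apply/matrixP => i j; rewrite -e h.
Qed.

(** Symplectic Gram-Schmidt: a primitive vector has a partner of pairing 1 by self-duality, and the
    construction is repeated in the orthogonal complement of this hyperbolic plane. *)
Lemma selfdual_lattice Q : submod Q -> bounded Q -> selfdual Q ->
  exists2 g, simil 1 g & Q = span g.
Proof.
move=> hQ hb hs; have [hD hZ] := hQ.
have e0 : ev F o0 != 0.
  by apply/eqP => /matrixP/(_ o0 0); rewrite evE mxE => /eqP; rewrite oner_eq0.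
have [k0 [q1 q1']] := scale_primitive hb e0; set x1 := _ *: _ in q1 q1'.
clearbody x1; have [x4 q4 e14] := selfdual_unit hQ hs q1 q1'.
have [w w0 [w1 w4]] := orthogonal_vector x1 x4.
have [k [q2 q2']] := scale_primitive hb w0; set x2 := _ *: w in q2 q2'.
have e21 : form x2 x1 = 0 by rewrite sformZl w1 mulr0.
have e24 : form x2 x4 = 0 by rewrite sformZl w4 mulr0.
clearbody x2; have [y qy e2y] := selfdual_unit hQ hs q2 q2'.
(* The projection of [y] orthogonal to [x1] and [x4]; it keeps the pairing 1 with [x2], which is
   orthogonal to both. *)
pose x3 := y + (- form y x4) *: x1 + form y x1 *: x4.
have ff v : form v v = 0 by rewrite sformE; ring.
have q3 : Q x3.
  apply: (hD); last by apply: (hZ) => //; apply: (proj1 (hs y)).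
  apply: hD => //; apply: hZ => //; rewrite (in_PnN hF); exact: (proj1 (hs y)).
have e31 : form x3 x1 = 0.
  by rewrite /x3 !sformDl !sformZl ff (sformC x1 x4) e14; ring.
have e34 : form x3 x4 = 0 by rewrite /x3 !sformDl !sformZl ff e14; ring.
have e23 : form x2 x3 = 1 by rewrite /x3 !sformDr !sformZr e21 e24 e2y; ring.
pose xs (i : 'I_4) := if i == o0 then x1 else if i == o1 then x2 else if i == o2 then x3 else x4.
pose g := \matrix_(k, j) xs j k 0.
have cg i : col i g = xs i by apply/matrixP => a b; rewrite !mxE (ord1 b).
have sg : simil 1 g.
  apply/simil_form => i j; rewrite !cg; move: i j; apply: ord4_ind; apply: ord4_ind;
  rewrite /xs !mxE /= ?ff ?e14 ?e21 ?e24 ?e31 ?e34 ?e23//.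
  - by rewrite sformC e21 oppr0.
  - by rewrite sformC e31 oppr0.
  - by rewrite sformC e23.
  - by rewrite sformC e14.
  - by rewrite sformC e24 oppr0.
  - by rewrite sformC e34 oppr0.
have ug : g \in unitmx by apply: GSp4_unit; apply/GSp4P; exists 1; rewrite ?oner_neq0.
exists g => //; apply/seteqP; split; last first.
  by apply: submod_span => // i; rewrite cg; move: i; apply: ord4_ind.
move=> v hv; exists (invmx g *m v); last by rewrite mulKVmx.
set z := invmx g *m v => i /=.
(* The coordinates of [v] are, up to sign, its pairings with the basis vectors, hence integral
   because [Q] is self-dual. *)
have key j : in_Pn 0 (form (ev F j) z).
  have ej : g *m ev F j = xs j by rewrite -cg /ev !colE mul1mx.
  have qj : Q (xs j) by move: j {ej}; apply: ord4_ind.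
  by have := proj1 (hs (xs j)) qj v hv; rewrite -ej -{1}(mulKVmx ug v) (form_simil _ _ sg) mul1r.
move: (key o0) (key o1) (key o2) (key o3); rewrite !sformE !evE /=.
rewrite !(mul0r, mul1r, mulr0, mulr1, subr0, sub0r, oppr0, add0r, addr0, in_PnN hF).
by move=> *; move: i; apply: ord4_ind.
Qed.

End Lattices.

(** * Galleries of self-dual lattices *)

Section Connected.
Variables (F : fieldType) (ord : F -> int) (pi : F).
Hypotheses (hF : nonarch_local_field ord) (hpi : uniformizer ord pi).
Local Notation in_Pn := (in_Pn ord).
Local Notation unitdet := (unitdet ord).
Local Notation GSp1 := (GSp1 ord).
Local Notation GL4O := (GL4O ord).
Local Notation span := (span_cols ord).
Local Notation form := Defs.form.
Local Notation L0 := (intv ord).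
Implicit Types (g h s x : 'M[F]_4) (v w : 'cV[F]_4).

Lemma GSp1_unit s : GSp1 s -> s \in unitmx. Proof. by case=> /GSp4_unit. Qed.

Lemma L0_form v w : L0 v -> L0 w -> in_Pn 0 (form v w).
Proof.
move=> hv hw; rewrite sformE; have p i j : in_Pn 0 (v i 0 * w j 0).
  by apply: (in_PnMeq hF _ (hv i) (hw j)).
by do 2!apply: (in_PnB hF) => //; apply: (in_PnD hF).
Qed.

Lemma L0_dual v : (forall w, L0 w -> in_Pn 0 (form v w)) -> L0 v.
Proof.
move=> h; have key j : in_Pn 0 (form v (ev F j)) by apply: h => k; exact: ev_int.
move: (key o0) (key o1) (key o2) (key o3); rewrite !sformE !evE /=.
rewrite !(mul0r, mul1r, mulr0, mulr1, subr0, sub0r, oppr0, add0r, addr0, in_PnN hF).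
by move=> *; apply: ord4_ind.
Qed.

Lemma span_form x v w : GSp1 x -> span x v -> span x w -> in_Pn 0 (form v w).
Proof.
move=> /(GSp1P hF)[l ul hl] [a ha <-] [b hb <-]; rewrite (form_simil _ _ hl).
by apply: (in_PnMeq hF _ (unitO_in ul) (L0_form ha hb)).
Qed.

Lemma span_dual x v : GSp1 x -> (forall w, span x w -> in_Pn 0 (form v w)) -> span x v.
Proof.
move=> hx h; have ux := GSp1_unit hx; case/(GSp1P hF): hx => l ul hl.
exists (invmx x *m v); last by rewrite mulKVmx.
apply: L0_dual => w hw; apply: (unitO_mulP hF ul).
by rewrite -(form_simil _ _ hl) mulKVmx//; apply: h; exists w.
Qed.

Lemma L0D v w : L0 v -> L0 w -> L0 (v + w).
Proof. by move=> hv hw i; rewrite mxE; apply: (in_PnD hF). Qed.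

Lemma L0Z c v : in_Pn 0 c -> L0 v -> L0 (c *: v).
Proof. by move=> hc hv i; rewrite mxE; apply: (in_PnMeq hF _ hc (hv i)). Qed.

Lemma submod_L0 g : submod ord (span g).
Proof.
split=> [_ _ [v hv <-] [w hw <-]|c _ hc [v hv <-]].
  by exists (v + w); [exact: L0D|rewrite mulmxDr].
by exists (c *: v); [exact: L0Z|rewrite scalemxAr].
Qed.

Lemma span_bounded g : g \in unitmx -> bounded ord pi (span g).
Proof.
move=> ug; have [k hk] := mxin_bound ord g; have [k' hk'] := mxin_bound ord (invmx g).
exists (k + k')%N; split=> [v hv|_ [v hv <-] i].
  exists (pi ^ (k + k')%N%:Z *: (invmx g *m v)); last by rewrite -scalemxAr mulKVmx.
  move=> i; rewrite mxE (in_Pn_piM hF hpi).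
  have := mxinM hF hk' (B := v) (l := 0) (fun i j => _) i 0.
  rewrite addr0 => H; apply: in_Pn_le (H _); first lia.
  by move=> a b; rewrite (ord1 b).
rewrite mxE (in_Pn_piM hF hpi).
have := mxinM hF hk (B := v) (l := 0) (fun i j => _) i 0.
rewrite addr0 => H; apply: in_Pn_le (H _); first lia.
by move=> a b; rewrite (ord1 b).
Qed.

Section Chain.
Variable x : 'M[F]_4.
Hypothesis hx : GSp1 x.

(* The lattices [chain i] form a gallery of self-dual lattices from the
   standard lattice to that of [x]. *)
Definition csum (i : nat) : set 'cV[F]_4 :=
  [set v | exists a b, [/\ L0 a, span x b & v = pi ^ i%:Z *: a + b]].
Definition chain (i : nat) : set 'cV[F]_4 := [set v | csum i v /\ L0 (pi ^ i%:Z *: v)].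

Lemma csum_submod i : submod ord (csum i).
Proof.
have [hD hZ] := submod_L0 x; split=> [_ _ [a [b [ha hb ->]]] [a' [b' [ha' hb' ->]]]|].
  exists (a + a'), (b + b'); split; [exact: L0D|exact: hD|].
  by rewrite scalerDr addrACA.
move=> c _ hc [a [b [ha hb ->]]]; exists (c *: a), (c *: b); split; [exact: L0Z|exact: hZ|].
by rewrite scalerDr !scalerA mulrC.
Qed.

Lemma L0_0 : L0 0. Proof. by move=> i; rewrite mxE (in_Pn0 ord). Qed.

Lemma span0 g : span g 0. Proof. by exists 0; [exact: L0_0|rewrite mulmx0]. Qed.

Lemma in_O_pi (k : nat) : in_Pn 0 (pi ^ k%:Z).
Proof. by apply: in_Pn_le (in_Pn_pi hF hpi _). Qed.

Lemma csum_bounded i : bounded ord pi (csum i).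
Proof.
have [k [h1 h2]] := span_bounded (GSp1_unit hx).
exists k; split=> [v hv|_ [a [b [ha hb ->]]]].
  by exists 0, (pi ^ k%:Z *: v); split; [exact: L0_0|exact: h1|rewrite scaler0 add0r].
rewrite scalerDr; apply: L0D; last exact: h2.
by do 2!(apply: L0Z; first exact: in_O_pi).
Qed.

Lemma chain_submod i : submod ord (chain i).
Proof.
have [hD hZ] := csum_submod i; split=> [v w [h1 h2] [h3 h4]|c v hc [h1 h2]]; split.
- exact: hD.
- by rewrite scalerDr; exact: L0D.
- exact: hZ.
- by rewrite scalerA mulrC -scalerA; exact: L0Z.
Qed.

Lemma L0_chain i v : L0 v -> chain i (pi ^ i%:Z *: v).
Proof.
move=> hv; split; first by exists v, 0; split=> //; [exact: span0|rewrite addr0].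
by do 2!(apply: L0Z; first exact: in_O_pi).
Qed.

Lemma span_chain i v : span x v -> L0 (pi ^ i%:Z *: v) -> chain i v.
Proof.
move=> hv h; split=> //; exists 0, v; split=> //; first exact: L0_0.
by rewrite scaler0 add0r.
Qed.

Lemma chain_bounded i : bounded ord pi (chain i).
Proof.
exists i; split=> [v hv|v [_ h]//]; exact: L0_chain.
Qed.

(** The dual basis of a basis of [csum i] pairs integrally with [csum i], hence with both of its
    summands, so it lies in [chain i]. The pairings of [v] with it are the coordinates of [v] up to
    sign. *)
Lemma csum_dual i v : (forall w, chain i w -> in_Pn 0 (form v w)) -> csum i v.
Proof.
move=> h; have [g ug eC] := lattice_of_submod hF hpi (csum_submod i) (csum_bounded i).
have uJ : Jmx F \in unitmx by rewrite unitmxE unitfE detJ_neq0.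
pose d j : 'cV[F]_4 := (row j (invmx (Jmx F *m g)))^T.
have fd j z : form (d j) (g *m z) = z j 0.
  rewrite /Defs.form /d trmxK -!mulmxA [Jmx F *m (g *m z)]mulmxA -row_mul mulmxA mulVmx.
    by rewrite mul1mx mxE.
  by rewrite unitmx_mul uJ.
have dx j : span x (d j).
  apply: span_dual => // w hw; have : csum i w.
    by exists 0, w; split=> //; [exact: L0_0|rewrite scaler0 add0r].
  by rewrite eC => -[z hz <-]; rewrite fd.
have dL j : L0 (pi ^ i%:Z *: d j).
  apply: L0_dual => w hw; rewrite sformZl -sformZr; have : csum i (pi ^ i%:Z *: w).
    by exists w, 0; split=> //; [exact: span0|rewrite addr0].
  by rewrite eC => -[z hz <-]; rewrite fd.
rewrite eC; exists (invmx g *m v); last by rewrite mulKVmx.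
move=> j /=; rewrite -fd mulKVmx// sformC (in_PnN hF); apply: h.
exact: span_chain.
Qed.

Lemma chain_selfdual i : selfdual ord (chain i).
Proof.
move=> v; split.
  move=> [[a [b [ha hb ev1]]] hv] w [[a' [b' [ha' hb' ew]]] hw].
  (* The factors pi^i are moved onto the whole of [v] or [w], whose multiples by pi^i are integral;
     only the last term uses the lattice of [x]. *)
  have -> : form v w = form a (pi ^ i%:Z *: w) + (form (pi ^ i%:Z *: v) a'
      - form (pi ^ i%:Z *: a) (pi ^ i%:Z *: a')) + form b b'.
    rewrite ev1 ew; rewrite !(sformDl, sformDr, sformZl, sformZr); ring.
  apply: (in_PnD hF); last exact: (span_form hx).
  have hp := in_O_pi i.
  apply: (in_PnD hF); first exact: L0_form.
  by apply: (in_PnB hF); apply: L0_form => //; exact: L0Z.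
move=> h; split; first exact: csum_dual.
apply: L0_dual => w hw; rewrite sformZl -sformZr; apply: h; exact: L0_chain.
Qed.

Lemma chain0 : chain 0 = span 1%:M.
Proof.
apply/seteqP; split=> v; rewrite span1; first by rewrite /chain /= expr0z scale1r => -[].
by move=> hv; have := L0_chain 0 hv; rewrite expr0z scale1r.
Qed.

Lemma chain_end : exists i, chain i = span x.
Proof.
have [k [h1 h2]] := span_bounded (GSp1_unit hx); exists k.
have [hD _] := submod_L0 x.
apply/seteqP; split=> [_ [[a [b [ha hb ->]]] _]|v hv]; first by apply: hD => //; exact: h1.
by apply: span_chain => //; exact: h2.
Qed.

Lemma chain_step i v : chain i v -> chain i.+1 (pi *: v).
Proof.
move=> [[a [b [ha hb ->]]] h]; have [_ hZ] := submod_L0 x.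
have Opi : in_Pn 0 pi by have := in_O_pi 1.
split.
  exists a, (pi *: b); split=> //; first exact: hZ.
  by rewrite scalerDr scalerA -!exprnP exprS.
rewrite scalerA mulrC -scalerA; apply: L0Z => //.
by rewrite -!exprnP exprS -scalerA; apply: L0Z.
Qed.

Lemma chain_step' i v : chain i.+1 v -> chain i (pi *: v).
Proof.
move=> [[a [b [ha hb ->]]] h]; have [_ hZ] := submod_L0 x.
have Opi : in_Pn 0 pi by have := in_O_pi 1.
split.
  exists (pi *: (pi *: a)), (pi *: b); split; [|exact: hZ|].
    by apply: L0Z => //; apply: L0Z.
  by rewrite scalerDr !scalerA -!exprnP exprS; congr (_ *: _ + _); ring.
by move: h; rewrite !scalerA -!exprnP exprSr.
Qed.

End Chain.

Definition bdd (k : nat) x := mxin ord (- k%:Z) x /\ mxin ord (- k%:Z) (invmx x).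

Lemma mxin_piZ m n (k : int) l (A : 'M[F]_(m, n)) : mxin ord l (pi ^ k *: A) <-> mxin ord (l - k) A.
Proof. by split=> h i j; have := h i j; rewrite mxE (in_Pn_piM hF hpi). Qed.

(** Consecutive lattices of the gallery contain each other's multiples by [pi], so bases of them
    differ by an element of size 1. This turns the gallery into an induction principle: change of
    basis of a lattice, and moves of size 1. *)
Lemma GSp1_connected (P : set 'M[F]_4) : P 1%:M ->
  (forall x k, GSp1 x -> P x -> GL4O k -> GSp1 (x *m k) -> P (x *m k)) ->
  (forall x z, GSp1 x -> P x -> GSp1 z -> bdd 1 z -> P (x *m z)) ->
  forall x, GSp1 x -> P x.
Proof.
move=> h1 hk hz x hx.
have key i : forall g, GSp1 g -> span g = chain x i -> P g.
  elim: i => [|i IH] g hg eg.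
    rewrite chain0 in eg; have := span_eqP hF (unitmx1 _ _) (GSp1_unit hg).
    rewrite invmx1 mul1mx => -[/(_ (esym eg)) h _].
    rewrite -[g]mul1mx; apply: hk; rewrite ?mul1mx//.
    by split; [exact: GSp4_1|rewrite /unitdet det1; exact: unitO1].
  have [g' sg' eg'] := selfdual_lattice hF hpi (chain_submod x i) (chain_bounded x i) (chain_selfdual hx i).
  have hg' : GSp1 g' := simil1_GSp1 hF (unitO1 hF) sg'.
  have Pg' : P g' by apply: IH.
  have ug := GSp1_unit hg; have ug' := GSp1_unit hg'.
  rewrite -(mulKVmx ug' g); apply: hz => //; first by apply: (GSp1M hF) => //; exact: (GSp1V hF).
  split.
    have := proj1 (span_subP hF (pi *: g) ug'); rewrite -scalemxAr => H.
    have /mxin_piZ : mxin ord 0 (pi ^ 1 *: (invmx g' *m g)).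
      rewrite expr1z; apply: H; rewrite -dilate_span eg -eg'.
      by move=> _ [v hv <-]; exact: chain_step'.
    by rewrite sub0r.
  rewrite invmxM ?unitmx_inv// invmxK.
  have := proj1 (span_subP hF (pi *: g') ug); rewrite -scalemxAr => H.
  have /mxin_piZ : mxin ord 0 (pi ^ 1 *: (invmx g *m g')).
    rewrite expr1z; apply: H; rewrite -dilate_span eg -eg'.
    by move=> _ [v hv <-]; exact: chain_step.
  by rewrite sub0r.
have [i ei] := chain_end hx.
by apply: (key i).
Qed.

End Connected.

(** * Freeness of the action *)

Section Lattice.
Variables (F : fieldType) (ord : F -> int) (pi : F) (Gamma : set 'M[F]_4).
Hypotheses (hF : nonarch_local_field ord) (hpi : uniformizer ord pi).
Hypotheses (hG : is_subgroup Gamma) (hd : discrete ord Gamma)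
  (htf : torsion_free_mod_center Gamma) (hG0 : Gamma `<=` G0 ord)
  (hcc : cocompact_mod_center ord Gamma).
Local Notation unitO := (unitO ord).
Local Notation inw := (inw ord).
Local Notation unitdet := (unitdet ord).
Local Notation GSp1 := (GSp1 ord).
Local Notation td := (td pi).
Local Notation GL4O := (GL4O ord).
Local Notation vtx := (vtx ord).
Local Notation bdd := (bdd ord).
Implicit Types (g h s x : 'M[F]_4).

Lemma mxBE (A B : 'M[F]_4) i j : (A - B) i j = A i j - B i j.
Proof. by rewrite !mxE. Qed.

Lemma Gamma_GSp4 g : Gamma g -> GSp4 g. Proof. by case: hG => h _ _ _ /h. Qed.
Lemma Gamma_unit g : Gamma g -> g \in unitmx. Proof. by move/Gamma_GSp4/GSp4_unit. Qed.
Lemma Gamma1 : Gamma 1%:M. Proof. by case: hG. Qed.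
Lemma GammaM g h : Gamma g -> Gamma h -> Gamma (g *m h). Proof. by case: hG => _ _ H _; exact: H. Qed.
Lemma GammaV g : Gamma g -> Gamma (invmx g). Proof. by case: hG => _ _ _; exact. Qed.

Lemma scalar_center (c : F) : (c%:M : 'M[F]_4) \in unitmx -> center (c%:M : 'M[F]_4).
Proof. by rewrite unitmxE det_scalar unitfE expf_eq0 /= => c0; exists c. Qed.

(** Compactness is applied to the cover by the sets Gamma r K(n) Z, where K(n) is the congruence
    subgroup of level n; they are open and stable under [Gamma] and the center. *)
Lemma Gamma_reps (n : nat) : (0 < n)%N -> exists S : seq 'M[F]_4,
  (forall r, r \in S -> GSp4 r) /\
  forall g, GSp4 g -> exists gam r k (z : F), [/\ Gamma gam, r \in S, GSp4 k, mxin ord n%:Z (k - 1%:M)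
     & z != 0 /\ g = z *: (gam *m r *m k)].
Proof.
move=> n0.
pose U r : set 'M[F]_4 := [set g | exists gam k (z : F), [/\ Gamma gam, GSp4 k, mxin ord n%:Z (k - 1%:M),
   z != 0 & g = z *: (gam *m r *m k)]].
have n1 : 1 <= n%:Z by lia.
pose C : set (set 'M[F]_4) := [set V | exists2 r, GSp4 r & V = U r].
have [||| D [Dfin DC Dcov]] := hcc (C := C).
- move=> _ [r hr ->]; split.
    move=> _ [gam [k [z [hgam hk hk1 z0 ->]]]]; apply: GSp4Z => //.
    by apply: GSp4M => //; apply: GSp4M => //; exact: Gamma_GSp4.
  move=> _ [gam [k [z [hgam hk hk1 z0 ->]]]].
  pose x := z *: (gam *m r); have hx : GSp4 x.
    by apply: GSp4Z => //; apply: GSp4M => //; exact: Gamma_GSp4.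
  have [N hN] := mxin_bound ord (invmx x).
  (* Multiplying the difference by the inverse of [x] loses at most [N] in precision. *)
  exists (n%:Z + N%:Z) => h hh hclose; exists gam, (invmx x *m h), z; split => //.
  - by apply: GSp4M => //; exact: GSp4V.
  - have -> : invmx x *m h - 1%:M = invmx x *m (h - z *: (gam *m r *m k)) + (k - 1%:M).
      rewrite mulmxBr -[z *: (_ *m k)]/(_) scalemxAl -/x mulKmx ?GSp4_unit//.
      by rewrite addrA subrK.
    apply: (mxinD hF) => //; apply: (mxinMeq hF (k := - N%:Z) (l := n%:Z + N%:Z)) => //; first by lia.
    by move=> i j; rewrite mxBE; exact: hclose.
  - have -> : z *: (gam *m r *m (invmx x *m h)) = x *m (invmx x *m h) by rewrite /x scalemxAl.
    by rewrite mulKVmx ?GSp4_unit.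
- move=> _ gam' g z' [r hr ->] hgam' [c c0 ->] [gam [k [z [hgam hk hk1 z0 ->]]]].
  exists (gam' *m gam), k, (z * c); split=> //; first exact: GammaM.
    by rewrite mulf_neq0.
  by rewrite mul_mx_scalar -scalemxAr scalerA mulrC !mulmxA.
- move=> g hg; exists (U g); first by exists g.
  exists 1%:M, 1%:M, 1; split; rewrite ?oner_neq0//; [exact: Gamma1|exact: GSp4_1| |].
    by rewrite subrr => i j; rewrite mxE (in_Pn0 ord).
  by rewrite scale1r mul1mx mulmx1.
have /finite_seqP[sD eD] := Dfin.
have /choice[rf hrf] : forall V : set 'M[F]_4, exists r, D V -> GSp4 r /\ V = U r.
  move=> V; have [DV|nDV] := pselect (D V); last by exists 1%:M.
  by have [r hr e] := DC _ DV; exists r.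
exists [seq rf V | V <- sD]; split.
  by move=> r /mapP[V VD ->]; have [] := hrf V _; rewrite // eD.
move=> g hg; have [V DV] := Dcov _ hg; have [_ ->] := hrf _ DV.
move=> [gam [k [z [hgam hk hk1 z0 ->]]]]; exists gam, (rf V), k, z; split=> //.
by apply: map_f; move: DV; rewrite eD.
Qed.

(** [Gamma] times the center, cut down to unit determinant, so that it acts on lattices with bounded
    index considerations. The scalar [z] is not controlled, so discreteness of [Gamma] cannot be
    applied directly to these elements. *)
Definition GammaZ s := GSp1 s /\ exists2 z, z != 0 & Gamma (z *: s).

Lemma GammaZM s s' : GammaZ s -> GammaZ s' -> GammaZ (s *m s').
Proof.
move=> [h [z z0 hz]] [h' [z' z0' hz']]; split; first exact: (GSp1M hF).
exists (z * z'); first by rewrite mulf_neq0.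
by have := GammaM hz hz'; rewrite -scalemxAl -scalemxAr scalerA.
Qed.

Lemma GammaZV s : GammaZ s -> GammaZ (invmx s).
Proof.
move=> [h [z z0 hz]]; split; first exact: (GSp1V hF).
exists z^-1; first by rewrite invr_eq0.
by have := GammaV hz; rewrite invmxZ//; exact: Gamma_unit.
Qed.

Lemma GammaZ1 : GammaZ 1%:M.
Proof.
split; last by exists 1; rewrite ?oner_neq0// scale1r; exact: Gamma1.
exact: GSp1_1.
Qed.

Lemma GammaZX s n : GammaZ s -> GammaZ (s ^+ n).
Proof.
move=> hs; elim: n => [|n IH]; first by rewrite expr0; exact: GammaZ1.
by rewrite exprS; apply: GammaZM.
Qed.

Lemma exprZ_mx (z : F) s n : (z *: s) ^+ n = z ^+ n *: s ^+ n.
Proof.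
elim: n => [|n IH]; first by rewrite !expr0 scale1r.
by rewrite !exprS IH -!mulmxE -scalemxAl -scalemxAr scalerA.
Qed.

Lemma GammaZ_torsion s n : GammaZ s -> (0 < n)%N -> is_scalar_mx (s ^+ n) -> is_scalar_mx s.
Proof.
move=> [hs [z z0 hz]] n0 /is_scalar_mxP[c ec].
have : center ((z *: s) ^+ n).
  rewrite exprZ_mx ec scale_scalar_mx; apply: scalar_center.
  rewrite -scale_scalar_mx -ec -exprZ_mx.
  elim: {ec n0}n => [|n IH]; first by rewrite expr0 unitmx1.
  by rewrite exprS -mulmxE unitmx_mul Gamma_unit.
move/(htf hz n0) => [a a0 ea]; apply/is_scalar_mxP; exists (z^-1 * a).
by rewrite -scale_scalar_mx -ea scalerA mulVf// scale1r.
Qed.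

Lemma GL4O_conj_close x s (N : nat) : x \in unitmx -> GL4O (invmx x *m s *m x) ->
  exists2 n, (0 < n)%N & mxin ord N%:Z (s ^+ n - 1%:M).
Proof.
move=> ux hs; have [k hk] := mxin_bound ord x; have [k' hk'] := mxin_bound ord (invmx x).
(* Conjugating back by [x] costs [k] on one side and [k'] on the other. *)
have [n n0 hn] := GL4O_power hF hpi (N + k + k')%N hs; exists n => //.
have -> : s ^+ n - 1%:M = x *m ((invmx x *m s *m x) ^+ n - 1) *m invmx x.
  rewrite conj_expr// mulmxBr mulmxBl !mulmxA mulmxV// mul1mx mulmxK//.
  by rewrite mulmx1 mulmxV.
apply: (mxinMeq hF (k := N%:Z + k'%:Z) _ _ hk'); first by lia.
by apply: (mxinMeq hF _ hk hn); lia.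
Qed.

(* The stabilizer of a lattice in [Gamma] is finite by discreteness, hence torsion. *)
Lemma Gamma_fix_scalar x s : Gamma s -> GSp1 s -> x \in unitmx -> GL4O (invmx x *m s *m x) -> is_scalar_mx s.
Proof.
move=> hs h1 ux hx; have [N hN] := hd Gamma1.
have [n n0 hn] := GL4O_conj_close `|N|%N ux hx.
have hz : GammaZ s by split=> //; exists 1; rewrite ?oner_neq0// scale1r.
apply: (GammaZ_torsion hz n0); rewrite (hN (s ^+ n)); first exact: scalar_mx_is_scalar.
  elim: {hn n0}n => [|n IH]; first by rewrite expr0; exact: Gamma1.
  by rewrite exprS -mulmxE; exact: GammaM.
move=> i j; rewrite -mxBE; apply: in_Pn_le (hn i j); lia.
Qed.

Lemma bddM k k' x x' : bdd k x -> bdd k' x' -> x \in unitmx -> x' \in unitmx -> bdd (k + k') (x *m x').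
Proof.
move=> [h1 h2] [h1' h2'] ux ux'; split; first by apply: (mxinMeq hF _ h1 h1'); lia.
by rewrite invmxM//; apply: (mxinMeq hF _ h2' h2); lia.
Qed.

Lemma bddV k x : bdd k x -> bdd k (invmx x).
Proof. by move=> [h1 h2]; split; rewrite ?invmxK. Qed.

Lemma bdd_GL4O x : GL4O x -> bdd 0 x.
Proof. by case. Qed.

(** Cocompactness for lattices instead of lattice classes: the finitely many representatives are
    rescaled to unit determinant, and then a common bound exists. *)
Lemma GammaZ_cofinite : exists k, forall x, GSp1 x -> exists a b, [/\ GammaZ a, GSp1 b, bdd k b & x = a *m b].
Proof.
have [S [hS hrep]] := Gamma_reps (ltn0Sn 0).
have /choice[edge_kind hkf] : forall r : 'M[F]_4, exists k, forall m, unitdet (pi ^ m *: r) -> bdd k (pi ^ m *: r).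
  move=> r; have [[m hm]|hm] := pselect (exists m, unitdet (pi ^ m *: r)); last first.
    by exists 0%N => m h; case: hm; exists m.
  have [k1 h1] := mxin_bound ord (pi ^ m *: r); have [k2 h2] := mxin_bound ord (invmx (pi ^ m *: r)).
  exists (k1 + k2)%N => m' hm'.
  (* The exponent is determined by the determinant, so one bound serves for all rescalings of [r] to
     unit determinant. *)
  have -> : m' = m.
    have ur : r \in unitmx.
      by have := unitdet_unit hm; rewrite unitmxZ// unitfE (pi_exp_neq0 hpi).
    case: hm hm' => _ om [_ om']; move: om om'; rewrite !(ord_detZ hF) ?(pi_exp_neq0 hpi)//.
    by rewrite !(ord_pi_exp hF hpi); lia.
  by split; [apply: mxin_le h1|apply: mxin_le h2]; lia.
exists (\max_(r <- S) edge_kind r)%N => x hx; have [hx4 ux] := hx.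
have [gam [r [k [z [hgam hr hk hk1 [z0 ex]]]]]] := hrep _ hx4.
have kO : GL4O k := GL4O_1P hF hk1.
have hr4 := hS _ hr; have ur := GSp4_unit hr4; have ug := Gamma_unit hgam.
have [_ uk] := proj1 (GL4OP hF _) kO.
(* [Gamma] lies in [G0] and scalars have determinants of order divisible by 4, so [r] inherits this
   divisibility from [x]. *)
have [m em] : exists m, ord (\det r) = m * 4.
  have [q hq] : exists q : int, ord (\det gam) = q * 4 by case: (hG0 hgam) => _ /dvdzP.
  case: ux => _; rewrite ex (ord_detZ hF)//; last by rewrite !unitmx_mul ug ur (GL4O_unit kO).
  rewrite !det_mulmx !(ordMn0 hF); rewrite ?mulf_neq0 -?unitfE -?unitmxE ?ug ?ur ?(GL4O_unit kO)//.
  rewrite hq; case: uk => _ -> h; exists (- ord z - q).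
  by move: h; move: (ord z) (ord (\det r)); clear => a b h; lia.
have ud : unitdet (pi ^ (- m) *: r).
  have p0 := pi_exp_neq0 hpi (- m).
  split; last by rewrite (ord_detZ hF)// (ord_pi_exp hF hpi) em; lia.
  by rewrite detZ mulf_neq0 ?expf_neq0// -unitfE -unitmxE.
pose b := pi ^ (- m) *: r *m k.
have hb : GSp1 b.
  split; last exact: (unitdetM hF).
  by apply: GSp4M => //; apply: GSp4Z => //; exact: (pi_exp_neq0 hpi).
have bb : bdd (\max_(r <- S) edge_kind r) b.
  have := bddM (hkf _ _ ud) (bdd_GL4O kO) (unitdet_unit ud) (GL4O_unit kO).
  rewrite addn0 => -[h1 h2].
  have le : (edge_kind r <= \max_(r <- S) edge_kind r)%N.
    by rewrite (big_rem r)//= leq_maxl.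
  by split; [apply: mxin_le h1|apply: mxin_le h2]; lia.
have ub := GSp1_unit hb.
exists (x *m invmx b), b; split=> //; last by rewrite mulmxKV.
split; first by apply: (GSp1M hF) => //; exact: (GSp1V hF).
exists (z * pi ^ m)^-1; first by rewrite invr_eq0 mulf_neq0// (pi_exp_neq0 hpi).
suff -> : (z * pi ^ m)^-1 *: (x *m invmx b) = gam by [].
apply: (can_inj (mulmxK ub)); rewrite -scalemxAl mulmxKV// ex /b.
rewrite scalerA -scalemxAl -!scalemxAr !mulmxA; congr (_ *: _).
by rewrite invfM mulrAC mulVf// mul1r invr_expz.
Qed.

(** An element fixing all lattices of an apartment is diagonal in its basis. Being diagonal both in
    the standard basis and in its transforms by the two simple unipotents forces equal
    eigenvalues. *)
Lemma fix_all_scalar s : (forall x, GSp1 x -> GL4O (invmx x *m s *m x)) -> is_scalar_mx s.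
Proof.
move=> h.
have diag u : simil 1 u -> forall i j, i != j -> (invmx u *m s *m u) i j = 0.
  move=> hu i j ij; set M := _ *m u; apply/eqP; apply: contraT => Mij.
  (* The four weights are pairwise distinct for nonzero k, so large k of one sign or the other
     contradicts any finite order of an off-diagonal entry. *)
  pose w (k : int) := row4 (2 * k) k (- k) (- (2 * k)).
  have hw k : simil 1 (td (w k)).
    by rewrite -[1]/(pi ^ 0); apply: (td_simil hpi); rewrite !wt_row4; lia.
  have key k : inw (w k) M.
    apply/(inwE hF hpi).
    have hux : GSp1 (u *m td (w k)).
      by apply: (GSp1M hF); apply: (simil1_GSp1 hF (unitO1 hF)).
    have [_] := h _ hux; rewrite invmxM ?(td_unit hpi)//; last first.
      by apply: GSp4_unit; apply/GSp4P; exists 1; rewrite ?oner_neq0.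
    by rewrite !mulmxA.
  have := key (`|ord (M i j)|%N%:Z + 1) i j; have := key (- (`|ord (M i j)|%N%:Z + 1)) i j.
  rewrite !in_Pn_ord//; move: (ord _) => o; move: ij; clear.
  by move: i j; apply: ord4_ind; apply: ord4_ind => //; rewrite !wt_row4; lia.
have d1 := diag _ (simil1 F).
have e1 i j : i != j -> s i j = 0.
  by move=> ij; have := d1 i j ij; rewrite invmx1 mul1mx mulmx1.
have comm u : simil 1 u -> exists2 D : 'M[F]_4, (forall i j, i != j -> D i j = 0) & s *m u = u *m D.
  move=> hu; exists (invmx u *m s *m u); first exact: diag.
  rewrite -!mulmxA mulKVmx//.
  by apply: GSp4_unit; apply/GSp4P; exists 1; rewrite ?oner_neq0.
(* The entries of s u = u D equate eigenvalues wherever [u] is nonzero: columns of [u] with two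
   nonzero entries link two eigenvalues of [s]. *)
have [D hD /matrixP eD] := comm _ (x12_simil 1).
have [D' hD' /matrixP eD'] := comm _ (x23_simil 1).
have zz (A B : 'M[F]_4) i j : (forall i j, i != j -> A i j = 0) -> (A *m B) i j = A i i * B i j.
  move=> hA; rewrite mxE (bigD1 i)//= big1 ?addr0// => k ki.
  by rewrite hA ?mul0r// eq_sym.
have zz' (A B : 'M[F]_4) i j : (forall i j, i != j -> A i j = 0) -> (B *m A) i j = B i j * A j j.
  move=> hA; rewrite mxE (bigD1 j)//= big1 ?addr0// => k ki.
  by rewrite hA ?mulr0.
have q i j : s i i * x12 1 i j = x12 1 i j * D j j by rewrite -zz// -zz'.
have q' i j : s i i * x23 1 i j = x23 1 i j * D' j j by rewrite -zz// -zz'.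
have := q o0 o1; have := q o1 o1; have := q o2 o3; have := q o3 o3; have := q' o1 o2; have := q' o2 o2.
rewrite !mxE /= !(mulr1, mul1r, mulrN1, mulN1r) => a1 a2 a3 /oppr_inj a4 a5 a6.
apply/is_scalar_mxP; exists (s o0 o0); apply/matrixP => i j; rewrite [RHS]mxE.
have [<-|/e1 ->//] := eqVneq i j; rewrite mulr1n; move: i; apply: ord4_ind => //.
- by rewrite a5 a6.
- by rewrite a1 -a2 a5 a6.
- by rewrite a3 -a4 a1 -a2 a5 a6.
Qed.

Lemma scalar_det_unit s s' (c : F) : GSp1 s -> GSp1 s' -> s' = c *: s -> unitO c.
Proof.
move=> hs hs' e; have us := GSp1_unit hs; have us' := GSp1_unit hs'.
have c0 : c != 0.
  apply/eqP => c0; move: us'; rewrite e c0 scale0r unitmxE det0 unitr0.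
  by [].
split=> //; case: hs' => _ [_]; rewrite e (ord_detZ hF)//.
by case: hs => _ [_ ->]; lia.
Qed.

Lemma GammaZ_free a h : GammaZ a -> h \in unitmx -> GL4O (invmx h *m a *m h) -> is_scalar_mx a.
Proof.
move=> ha uh hah; have [k hk] := GammaZ_cofinite.
(* Conjugation by an element of size m costs 2 m. Sizes up to 2 k + 2 will occur, and 4 k + 5 still
   leaves a congruence to 1 modulo P. *)
have [j j0 hj] := GL4O_conj_close (4 * k + 5)%N uh hah.
set b := a ^+ j in hj; have hb : GammaZ b := GammaZX j ha.
have [hb1 _] := hb; have ub := GSp1_unit hb1.
have fix_ball m x : (m <= 2 * k + 2)%N -> x \in unitmx -> bdd m x -> GL4O (invmx x *m b *m x).
  move=> hm ux [h1 h2]; apply: (GL4O_1P hF).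
  have -> : invmx x *m b *m x - 1%:M = invmx x *m (b - 1%:M) *m x.
    by rewrite mulmxBr mulmxBl mulmx1 mulVmx.
  apply: (mxinMeq hF (k := (4 * k + 5)%N%:Z - m%:Z) _ _ h1); first by lia.
  by apply: (mxinMeq hF _ h2 hj); lia.
(* The induction along galleries keeps a factor in [GammaZ] that commutes with [b] up to a scalar,
   while the remaining factor stays of size [k]. *)
pose comm s := exists c, b *m s = c *: (s *m b).
pose P x := exists s t, [/\ GammaZ s, comm s, bdd k t & x = s *m t].
have Pall : forall x, GSp1 x -> P x.
  apply: (GSp1_connected hF hpi).
  - have [s [t [hs ht ht' e]]] := hk _ (proj1 GammaZ1).
    exists 1%:M, 1%:M; split; [exact: GammaZ1|exists 1; by rewrite scale1r mul1mx mulmx1| |by rewrite mulmx1].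
    by split; rewrite ?invmx1; refine (mxin_le (l := 0) _ (mxin1 hF (n := 4))); lia.
  - move=> x k' hx [s [t [hs cs ht e]]] hk' _; exists s, (t *m k'); split=> //; last by rewrite mulmxA e.
    rewrite -(addn0 k); apply: bddM => //; [exact: bdd_GL4O| |exact: GL4O_unit hk'].
    by have := GSp1_unit hx; rewrite e unitmx_mul => /andP[].
  - move=> x z hx [s [t [hs [c cs] ht e]]] hz hz1.
    have ut : t \in unitmx by have := GSp1_unit hx; rewrite e unitmx_mul => /andP[].
    have us : s \in unitmx by have := GSp1_unit hx; rewrite e unitmx_mul => /andP[].
    have ht1 : GSp1 t.
      rewrite -(mulKmx us t) -e; apply: (GSp1M hF) => //; apply: (GSp1V hF); by case: hs.
    have [d [t' [hd' ht' bt' e']]] := hk _ (GSp1M hF ht1 hz).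
    have ud : d \in unitmx by case: hd' => /GSp1_unit.
    have ut' := GSp1_unit ht'.
    have bd : bdd (2 * k + 1) d.
      have -> : d = t *m z *m invmx t' by rewrite e' mulmxK.
      have := bddM (bddM ht hz1 ut (GSp1_unit hz)) (bddV bt'); rewrite unitmx_mul ut unitmx_inv ut' (GSp1_unit hz).
      by move=> /(_ isT isT) [h1 h2]; split; [apply: mxin_le h1|apply: mxin_le h2]; lia.
    have n1 : GammaZ (b *m d *m invmx b *m invmx d).
      by apply: GammaZM; [apply: GammaZM; [exact: GammaZM|exact: GammaZV]|exact: GammaZV].
    (* The scalars carrying [b] and [d] into [Gamma] cancel in the commutator, which therefore lies
       in [Gamma] itself, where discreteness can be used. *)
    have n2 : Gamma (b *m d *m invmx b *m invmx d).
      case: hb => _ [z1 z10 g1]; case: hd' => _ [z2 z20 g2].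
      have := GammaM (GammaM (GammaM g1 g2) (GammaV g1)) (GammaV g2).
      rewrite !invmxZ ?Gamma_unit// -!scalemxAl -!scalemxAr -!scalemxAl !scalerA.
      by rewrite [X in X *: _](_ : _ = 1) ?scale1r//; field; rewrite z10 z20.
    have : is_scalar_mx (b *m d *m invmx b *m invmx d).
      apply: (Gamma_fix_scalar n2 (proj1 n1) ud).
      (* The commutator fixes the lattice of [d]: after conjugation it is a product of two elements,
         both integral because [b] fixes the lattice of [d] and the standard one. *)
      have -> : invmx d *m (b *m d *m invmx b *m invmx d) *m d = (invmx d *m b *m d) *m invmx b.
        by rewrite !mulmxA mulmxKV.
      apply: (GL4OM hF); first by apply: fix_ball ud bd; lia.
      apply: GL4OV; have := fix_ball 0%N 1%:M; rewrite invmx1 mul1mx mulmx1; apply=> //.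
        exact: unitmx1.
      by apply: bdd_GL4O; exact: GL4O1.
    case/is_scalar_mxP => c' ec.
    have cd : b *m d = c' *: (d *m b).
      by rewrite -[LHS](mulmxKV ub) -[b *m d *m invmx b](mulmxKV ud) ec mul_scalar_mx scalemxAl.
    exists (s *m d), t'; split=> //; first exact: GammaZM.
      exists (c * c'); rewrite mulmxA cs -scalemxAl -!mulmxA cd -scalemxAr scalerA.
      by rewrite !mulmxA.
    by rewrite e -!mulmxA e'.
(* With x = s t and b s = c s b, the conjugate of [b] by [x] is [c] times its conjugate by [t]; [c]
   is a unit by determinants and [t] is small. *)
apply: (GammaZ_torsion ha j0); rewrite -/b; apply: fix_all_scalar => x hx.
have [s [t [hs [c cs] ht e]]] := Pall x hx; have ux := GSp1_unit hx.
have [us ut] : s \in unitmx /\ t \in unitmx by move: ux; rewrite e unitmx_mul => /andP[].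
have hs1 : GSp1 s by case: hs.
have uc : unitO c by apply: scalar_det_unit cs; exact: (GSp1M hF).
rewrite e invmxM// -!mulmxA [b *m _]mulmxA cs -scalemxAl -!scalemxAr -!mulmxA mulKmx//.
by apply: (GL4OZ hF) => //; rewrite mulmxA; apply: fix_ball ht => //; lia.
Qed.

Lemma Gamma_free gam h : Gamma gam -> h \in unitmx -> vtx (gam *m h) = vtx h -> center gam.
Proof.
move=> hg uh /esym; have ug := Gamma_unit hg.
move=> /(vtxP hF); rewrite unitmx_mul ug uh => /(_ isT isT) [c c0 hc].
have : is_scalar_mx (c *: gam).
  apply: (@GammaZ_free _ h) => //; last by rewrite -scalemxAr -scalemxAl -mulmxA.
  split; last by exists c^-1; rewrite ?invr_eq0// scalerA mulVf// scale1r.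
  split; first by apply: GSp4Z => //; exact: Gamma_GSp4.
  have [_] := proj1 (GL4OP hF _) hc; rewrite /(unitdet _) !detZ !det_mulmx det_inv.
  by rewrite [X in _ * X]mulrCA mulVf ?mulr1// -unitfE -unitmxE.
case/is_scalar_mxP => a ea; have e : gam = (c^-1 * a)%:M.
  by rewrite -scale_scalar_mx -ea scalerA mulVf// scale1r.
by rewrite e; apply: scalar_center; rewrite -e.
Qed.

End Lattice.

(** * Formal power series *)

Section FormalPowerSeries.
Variable C : comNzRingType.
Implicit Types (a b c s : nat -> C) (p q : {poly C}) (n k : nat).

(** Identities between series are checked one coefficient at a time on truncations, where they
    become identities in the ring of polynomials. *)
Definition trunc n a : {poly C} := \poly_(i < n.+1) a i.

Lemma coef_trunc n a k : (k <= n)%N -> (trunc n a)`_k = a k.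
Proof. by move=> kn; rewrite coef_poly ltnS kn. Qed.

Lemma fps_mul_coef a b p q n : (forall i, (i <= n)%N -> p`_i = a i) ->
  (forall i, (i <= n)%N -> q`_i = b i) -> forall k, (k <= n)%N -> fps_mul a b k = (p * q)`_k.
Proof.
move=> hp hq k kn; rewrite coefM; apply: eq_bigr => i _.
have ik : (i <= k)%N by rewrite -ltnS.
by rewrite hp ?hq// (leq_trans _ kn)// leq_subr.
Qed.

Lemma fps_mul_trunc a b n : fps_mul a b n = (trunc n a * trunc n b)`_n.
Proof. by apply: fps_mul_coef (leqnn n) => i; exact: coef_trunc. Qed.

Lemma fps_mulC a b : fps_mul a b = fps_mul b a.
Proof. by apply/funext => n; rewrite !fps_mul_trunc mulrC. Qed.

Lemma fps_mulA a b c : fps_mul a (fps_mul b c) = fps_mul (fps_mul a b) c.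
Proof.
apply/funext => n.
rewrite (@fps_mul_coef _ _ (trunc n a) (trunc n b * trunc n c) n _ _ n)//.
- rewrite (@fps_mul_coef _ _ (trunc n a * trunc n b) (trunc n c) n _ _ n) ?mulrA//.
  + by move=> i hi; rewrite (fps_mul_coef (n := n) (p := trunc n a) (q := trunc n b))// => j; exact: coef_trunc.
  + by move=> i; exact: coef_trunc.
- by move=> i; exact: coef_trunc.
- by move=> i hi; rewrite (fps_mul_coef (n := n) (p := trunc n b) (q := trunc n c))// => j; exact: coef_trunc.
Qed.

Lemma fps_mul_eq a b a' b' n : (forall i, (i <= n)%N -> a i = a' i) ->
  (forall i, (i <= n)%N -> b i = b' i) -> fps_mul a b n = fps_mul a' b' n.
Proof.
move=> ha hb; apply: eq_bigr => i _; have ik : (i <= n)%N by rewrite -ltnS.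
by rewrite ha// hb// leq_subr.
Qed.

Lemma fps_mul1 a : fps_mul (fps_one C) a = a.
Proof.
apply/funext => n; rewrite /fps_mul big_ord_recl /= /fps_one eqxx mul1r subn0 big1 ?addr0//.
by move=> i _; rewrite mul0r.
Qed.

Lemma fps_mul_poly p q : fps_mul (fps_of_poly p) (fps_of_poly q) = fps_of_poly (p * q).
Proof. by apply/funext => n; rewrite /fps_of_poly coefM. Qed.

Lemma fps_poly1 : fps_of_poly 1 = fps_one C.
Proof. by apply/funext => n; rewrite /fps_of_poly coef1. Qed.

Lemma euler_factorP l : (0 < l)%N -> fps_mul (fps_of_poly (1 - 'X^l)) (euler_factor C l) = fps_one C.
Proof.
move=> l0; apply/funext => n.
rewrite (fps_mul_coef (p := 1 - 'X^l) (q := trunc n (euler_factor C l)) (n := n))//; last first.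
  by move=> i; exact: coef_trunc.
rewrite mulrBl mul1r coefB coefXnM coef_trunc// /euler_factor /fps_one.
have [nl|ln] := ltnP n l.
  rewrite subr0; case: n nl => [|n] nl; first by rewrite dvdn0.
  by rewrite (negPf (_ : ~~ (l %| n.+1)%N))// gtnNdvd.
have dl : (l %| n - l)%N = (l %| n)%N by rewrite -{2}(subnK ln) dvdn_addl.
rewrite coef_trunc ?leq_subr// dl subrr.
by case: n ln {dl} => //; rewrite leqNgt l0.
Qed.

(** The derivation u d/du. *)
Definition theta a : nat -> C := fun n => n%:R * a n.

Lemma theta_mul a b n : theta (fps_mul a b) n = fps_mul (theta a) b n + fps_mul a (theta b) n.
Proof.
rewrite /theta /fps_mul mulr_sumr -big_split /=; apply: eq_bigr => i _.
have ik : (i <= n)%N by rewrite -ltnS.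
rewrite -{1}(subnKC ik) natrD; ring.
Qed.

(** The series [s] is - u a'/a, stated without division. With this sign 1 - u^l has a nonnegative
    series, the sum of l u^(k l) over positive k. *)
Definition logderiv a s := forall n, theta a n = - fps_mul a s n.

Lemma fps_mulDr a b c n : fps_mul a (fun k => b k + c k) n = fps_mul a b n + fps_mul a c n.
Proof. by rewrite /fps_mul -big_split; apply: eq_bigr => i _; rewrite mulrDr. Qed.

Lemma fps_mulN a b n : fps_mul a (fun k => - b k) n = - fps_mul a b n.
Proof. by rewrite /fps_mul -sumrN; apply: eq_bigr => i _; rewrite mulrN. Qed.

Lemma logderivM a b s t : logderiv a s -> logderiv b t ->
  logderiv (fps_mul a b) (fun k => s k + t k).
Proof.
move=> ha hb n; rewrite theta_mul fps_mulDr opprD.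
have -> : theta a = (fun k => - fps_mul a s k) by apply/funext.
have -> : theta b = (fun k => - fps_mul b t k) by apply/funext.
rewrite fps_mulN [fps_mul _ b]fps_mulC fps_mulN !fps_mulA; congr (- fps_mul _ _ _ + _).
by rewrite fps_mulC.
Qed.

Lemma logderiv_euler l : (0 < l)%N ->
  logderiv (fps_of_poly (1 - 'X^l)) (fun k => ((0 < k)%N && (l %| k)%N)%:R * l%:R).
Proof.
move=> l0 n; set s := (X in fps_mul _ X).
rewrite (fps_mul_coef (p := 1 - 'X^l) (q := trunc n s) (n := n))//; last first.
  by move=> i; exact: coef_trunc.
rewrite mulrBl mul1r coefB coefXnM coef_trunc// /theta /fps_of_poly coefB coef1 coefXn /s.
have [nl|ln] := ltnP n l.
  rewrite subr0 [n == l]eqn_leq [(l <= n)%N]leqNgt nl andbF subr0.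
  case: n nl => [|n] nl; first by rewrite !mul0r oppr0.
  by rewrite (negPf (_ : ~~ (l %| n.+1)%N)) ?gtnNdvd// mulr0 mul0r oppr0.
have dl : (l %| n - l)%N = (l %| n)%N by rewrite -{2}(subnK ln) dvdn_addl.
rewrite coef_trunc ?leq_subr// dl subn_gt0 (leq_trans l0 ln) /=.
have -> : (n == 0%N) = false by case: n ln {dl s} => //; rewrite leqNgt l0.
rewrite sub0r; have [->|nl] := eqVneq n l.
  by rewrite ltnn dvdnn /= mul0r subr0 mul1r mulrN mulr1.
by rewrite ltn_neqAle eq_sym nl ln subrr !oppr0 mulr0.
Qed.

End FormalPowerSeries.

(** * Jacobi's formula and the logarithmic derivative of det(1 - uA) *)

Section Jacobi.
Variable C : comNzRingType.

Lemma deriv_prod (I : eqType) (r : seq I) (f : I -> {poly C}) : uniq r ->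
  (\prod_(i <- r) f i)^`() = \sum_(i <- r) (f i)^`() * \prod_(j <- r | j != i) f j.
Proof.
elim: r => [|x r IH] /=; first by rewrite !big_nil -polyC1 derivC.
move=> /andP[xr ur]; rewrite !big_cons derivM IH// eqxx /=; congr (_ * _ + _).
  by rewrite [RHS]big_mkcond [LHS]big_seq [RHS]big_seq; apply: eq_bigr => i ir;
    case: eqVneq => // e; rewrite -e ir in xr.
rewrite mulr_sumr [LHS]big_seq [RHS]big_seq; apply: eq_bigr => i ir.
rewrite big_cons; case: eqVneq => [e|_]; first by rewrite e ir in xr.
by rewrite mulrCA.
Qed.

(** Differentiating the Leibniz formula row by row gives determinants with one row differentiated,
    and each is expanded along that row. *)
Lemma deriv_det n (M : 'M[{poly C}]_n) :
  (\det M)^`() = \sum_i \sum_j (M i j)^`() * cofactor M i j.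
Proof.
pose Mi i := \matrix_(k, j) if k == i then (M i j)^`() else M k j.
transitivity (\sum_i \det (Mi i)).
  rewrite /determinant exchange_big /= linear_sum /=; apply: eq_bigr => s _.
  have -> : ((-1) ^+ s * \prod_i M i (s i))^`() = (-1) ^+ s * (\prod_i M i (s i))^`().
    by case: (odd_perm s); rewrite ?expr0 ?expr1 ?mul1r// !mulN1r derivN.
  rewrite deriv_prod ?index_enum_uniq// mulr_sumr; apply: eq_bigr => i _; congr (_ * _).
  rewrite [RHS](bigD1 i)//= mxE eqxx; congr (_ * _); apply: eq_bigr => j /negPf ji.
  by rewrite mxE ji.
apply: eq_bigr => i _; rewrite (expand_det_row _ i); apply: eq_bigr => j _.
rewrite mxE eqxx; congr (_ * _); rewrite /cofactor; congr (_ * \det _).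
by apply/matrixP => a b; rewrite !mxE eq_sym (negPf (neq_lift _ _)).
Qed.

(** By Jacobi's formula the derivative of det M is - tr(adj M A). Modulo a power of u the adjugate
    is det M times a partial geometric series in u A, whence the traces of powers of [A]. *)
Lemma logderiv_det n (A : 'M[C]_n) :
  logderiv (fps_of_poly (\det (1%:M - 'X *: map_mx polyC A)))
    (fun k => (0 < k)%N%:R * \tr (iter k (mulmx A) 1%:M)).
Proof.
set M := 1%:M - _; set D := \det M; case=> [|k]; set s := (X in fps_mul _ X).
  by rewrite /theta mul0r /fps_mul big_ord1 /s mul0r mulr0 oppr0.
pose B := map_mx polyC A.
pose p i := iter i (mulmx A) 1%:M.
(* A truncation of the inverse of [M]: the product [M *m G m] differs from 1 only from degree m
   on. *)
pose G m := \sum_(i < m) 'X^i *: map_mx polyC (p i).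
have MG m : M *m G m = 1%:M - 'X^m *: map_mx polyC (p m).
  rewrite /G; elim: m => [|m IH].
    by rewrite big_ord0 mulmx0 expr0 scale1r map_mx1 subrr.
  rewrite big_ord_recr /= mulmxDr IH mulmxBl mul1mx -scalemxAl -scalemxAr -map_mxM scalerA -exprS.
  by rewrite addrA subrK.
have adjM : \adj M = D *: G k.+1 + 'X^(k.+1) *: (\adj M *m map_mx polyC (p k.+1)).
  apply/eqP; rewrite -subr_eq; apply/eqP.
  transitivity (\adj M *m (M *m G k.+1)); first by rewrite MG mulmxBr mulmx1 scalemxAr.
  by rewrite mulmxA mul_adj_mx mul_scalar_mx.
have dD : D^`() = - \tr (\adj M *m B).
  rewrite /D deriv_det mxtrace_mulC /mxtrace -sumrN; apply: eq_bigr => i _.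
  rewrite mxE -sumrN; apply: eq_bigr => j _; rewrite [\adj M _ _]mxE -mulNr; congr (_ * _).
  rewrite !mxE derivB derivM derivX derivC mulr0 addr0 mul1r.
  by rewrite derivMn -polyC1 derivC mul0rn sub0r.
rewrite /theta -[X in _ * X]/(D`_k.+1) mulr_natl -coef_deriv dD coefN; congr (- _).
rewrite adjM mulmxDl -!scalemxAl mxtraceD !mxtraceZ coefD ['X^_ * _]mulrC coefMXn ltnSn addr0.
rewrite coefM /fps_mul [RHS]big_ord_recr /= subnn /s mul0r mulr0 addr0.
apply: eq_bigr => i _; congr (_ * _).
have ik : (i <= k)%N by rewrite -ltnS.
rewrite subn_gt0 ltn_ord mul1r subSn// iterS -/(p _) [RHS]mxtrace_mulC /G mulmx_suml raddf_sum coef_sum.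
rewrite (bigD1 (Ordinal (leq_subr i k : (k - i < k.+1)%N)))//= big1 ?addr0.
  by rewrite -scalemxAl mxtraceZ coefXnM ltnn subnn -map_mxM trace_map_mx coefC.
move=> j jk; rewrite -scalemxAl mxtraceZ coefXnM -map_mxM trace_map_mx coefC.
case: ltnP => // jk'; case: eqP => // e; case/eqP: jk; apply: val_inj => /=.
by apply/eqP; rewrite eqn_leq jk' -subn_eq0 e.
Qed.

End Jacobi.

(** * Recovering a series from its logarithmic derivative *)

Section Uniqueness.
Variable C : numFieldType.

(** The coefficient of degree n, multiplied by n, is a combination of strictly earlier ones, because
    [s] has no constant term; characteristic zero allows division by n. *)
Lemma logderiv_unique (a b s t : nat -> C) n : a 0%N = b 0%N -> s 0%N = 0 -> t 0%N = 0 ->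
  logderiv a s -> logderiv b t -> (forall i, (i <= n)%N -> s i = t i) ->
  forall i, (i <= n)%N -> a i = b i.
Proof.
move=> ab s0 t0 ha hb st; elim/ltn_ind => -[|k] IH kn //.
have k0 : (k.+1%:R : C) != 0 by rewrite pnatr_eq0.
apply: (mulfI k0); have := ha k.+1; have := hb k.+1; rewrite /theta => -> ->; congr (- _).
rewrite /fps_mul [LHS]big_ord_recr [RHS]big_ord_recr /= subnn s0 t0 !mulr0; congr (_ + _).
apply: eq_bigr => i _; rewrite IH// ?(leq_trans (ltnW (ltn_ord i)))// st//.
by rewrite (leq_trans (leq_subr _ _)).
Qed.

(** The geometric series in 1 - D, whose powers have increasing valuation; each coefficient is read
    off a long enough partial sum. *)
Lemma fps_inverse (D : {poly C}) : D`_0 = 1 -> exists Z, fps_mul Z (fps_of_poly D) = fps_one C.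
Proof.
move=> D0; pose E := 1 - D.
have E0 m : exists q, E ^+ m = q * 'X^m.
  have [q hq] : exists q, E = q * 'X.
    have /factor_theorem[q hq] : root E 0 by rewrite rootE horner_coef0 coefB coef1 D0 subrr.
    by exists q; rewrite hq subr0.
  by exists (q ^+ m); rewrite hq exprMn.
pose S m := \sum_(i < m) E ^+ i.
have DS m : S m * D = 1 - E ^+ m.
  have -> : D = 1 - E by rewrite /E opprB addrC subrK.
  rewrite /S; elim: m => [|m IH]; first by rewrite big_ord0 mul0r expr0 subrr.
  by rewrite big_ord_recr /= mulrDl IH exprSr; ring.
have stab m i : (i < m)%N -> (S m)`_i = (S i.+1)`_i.
  move=> im; rewrite -(subnKC im); move: (m - _)%N => d; elim: d => [|d IH]; first by rewrite addn0.
  rewrite addnS /S big_ord_recr /= coefD -/(S _) IH; have [q ->] := E0 (i.+1 + d)%N.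
  by rewrite coefMXn ltn_addr// addr0.
exists (fun n => (S n.+1)`_n); apply/funext => n.
rewrite (fps_mul_coef (p := S n.+1) (q := D) (n := n))//; last by move=> i hi; apply: stab.
rewrite DS coefB; have [q ->] := E0 n.+1; rewrite coefMXn ltnSn subr0 coef1.
by [].
Qed.

(* Any two series with the same logarithmic derivative agree; this turns the
   counting of closed words into the Euler product. *)
Lemma euler_product_prefix (ls : seq nat) (D : {poly C}) (Z tau : nat -> C) n :
  all (leq 1) ls -> D`_0 = 1 -> tau 0%N = 0 -> logderiv (fps_of_poly D) tau ->
  fps_mul Z (fps_of_poly D) = fps_one C ->
  (forall i, (0 < i <= n)%N -> tau i = (\sum_(l <- ls | (l %| i)%N) l)%:R) ->
  (\big[@fps_mul C/fps_one C]_(l <- ls) euler_factor C l) n = Z n.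
Proof.
move=> hls D0 tau0 hD hZ htau.
pose P := \prod_(l <- ls) (1 - 'X^l : {poly C}).
set E := \big[_/_]_(_ <- _) _.
have PE : fps_mul (fps_of_poly P) E = fps_one C.
  rewrite /P /E; elim: ls hls {htau P E} => [|l ls IH] /=.
    by rewrite !big_nil fps_poly1 fps_mul1.
  move=> /andP[l0 hl]; rewrite !big_cons -fps_mul_poly -fps_mulA.
  rewrite [X in fps_mul _ X]fps_mulA [X in fps_mul (fps_of_poly (1 - _)) (fps_mul X _)]fps_mulC.
  by rewrite -fps_mulA IH// [X in fps_mul _ X]fps_mulC fps_mul1 euler_factorP.
pose sig k : C := \sum_(l <- ls) ((0 < k)%N && (l %| k)%N)%:R * l%:R.
have lP : logderiv (fps_of_poly P) sig.
  rewrite /P /sig; elim: ls hls {htau P E PE sig} => [|l ls IH] /=.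
    move=> _ k; rewrite big_nil fps_poly1 fps_mul1 big_nil oppr0 /theta /fps_one.
    by case: k => [|k]; rewrite ?mul0r// mulr0.
  move=> /andP[l0 hl]; have := logderivM (logderiv_euler C l0) (IH hl).
  rewrite fps_mul_poly => h k; rewrite big_cons h; congr (- fps_mul _ _ _).
  by apply/funext => j; rewrite big_cons.
(* The hypothesis on [tau] matches the logarithmic derivatives of P and D up to degree n, so P and D
   agree there, and so do their inverses E and Z. *)
have PD i : (i <= n)%N -> P`_i = D`_i.
  apply: (@logderiv_unique (fps_of_poly P) (fps_of_poly D) sig tau n) => //.
  - rewrite /fps_of_poly D0 /P; elim: ls hls {htau P E PE sig lP} => [|l ls IH] /=.
      by rewrite big_nil coef1.
    move=> /andP[l0 hl]; rewrite big_cons coef0M IH// coefB coef1 coefXn.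
    by case: l l0 => //= l _; rewrite subr0 mulr1.
  - by rewrite /sig big1// => l _; rewrite mul0r.
  - move=> [|j] hj; first by rewrite tau0 /sig big1// => l _; rewrite mul0r.
    rewrite htau// /sig natr_sum [RHS]big_mkcond; apply: eq_bigr => l _ /=.
    by case: (l %| _)%N; rewrite ?mul1r ?mul0r.
rewrite -[E]fps_mul1 -hZ -fps_mulA.
rewrite (fps_mul_eq (a' := Z) (b' := fps_one C)) ?[fps_mul Z _]fps_mulC ?fps_mul1// => i hi.
rewrite -PE; apply: fps_mul_eq => // j hj; apply/esym/PD.
exact: leq_trans hj hi.
Qed.

End Uniqueness.

(** * Closed words *)

Section Words.
Variable T : choiceType.
Implicit Types (w x y c : seq T) (e : rel T).
Local Notation pow k x := (flatten (nseq k x)).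
Local Notation r1 := (@rot T 1).

Lemma size_pow k x : size (pow k x) = (k * size x)%N.
Proof. by rewrite size_flatten /shape map_nseq sumn_nseq mulnC. Qed.

Lemma powD j k x : pow (j + k) x = pow j x ++ pow k x.
Proof. by rewrite nseqD flatten_cat. Qed.

Lemma powM j k x : pow j (pow k x) = pow (j * k) x.
Proof. by elim: j => //= j ->; rewrite mulSn powD. Qed.

Lemma iter_rot1 k w : (k <= size w)%N -> iter k r1 w = rot k w.
Proof.
elim: k => [|k IH] kw; first by rewrite rot0.
by rewrite iterS IH ?(ltnW kw)// -rotS.
Qed.

Lemma iter_mul (f : seq T -> seq T) a q w : iter a f w = w -> iter (q * a) f w = w.
Proof. by move=> h; elim: q => // q IH; rewrite mulSn iterD IH. Qed.

Lemma iter_gcd (f : seq T -> seq T) a b w : (0 < a)%N -> iter a f w = w -> iter b f w = w ->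
  iter (gcdn a b) f w = w.
Proof.
move=> a0 ha hb; have [k _ /dvdnP[q hq]] := Bezoutl b a0.
by rewrite -{1}(iter_mul k hb) -iterD hq iter_mul.
Qed.

Lemma comm_pow q (u v : seq T) : u ++ v = v ++ u -> size v = (q * size u)%N -> v = pow q u.
Proof.
elim: q v => [|q IH] v huv hs; first by apply: size0nil; rewrite hs mul0n.
have e : v = u ++ drop (size u) v.
  have := congr1 (take (size u)) huv; rewrite take_size_cat// takel_cat => [eu|].
    by rewrite -{1}(cat_take_drop (size u) v) -eu.
  by rewrite hs mulSn leq_addr.
rewrite e /=; congr (_ ++ _); apply: IH; last by rewrite size_drop hs mulSn addKn.
by move: huv; rewrite {1 2}e -catA => /eqP; rewrite eqseq_cat// eqxx => /eqP.
Qed.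

Lemma period_pow g w : (0 < g)%N -> (g %| size w)%N -> iter g r1 w = w ->
  w = pow (size w %/ g) (take g w).
Proof.
move=> g0 gw h; have [w0|w0] := posnP (size w); first by rewrite w0 div0n; exact: size0nil.
have gle : (g <= size w)%N by apply: dvdn_leq.
have hq : size w = ((size w %/ g).-1.+1 * g)%N.
  by rewrite prednK ?divnK// divn_gt0.
rewrite -{1}(cat_take_drop g w) -(@prednK (size w %/ g)) ?divn_gt0//=; congr (_ ++ _).
apply: comm_pow; last by rewrite size_drop size_takel// {1}hq mulSn addKn.
by rewrite cat_take_drop -{1}h iter_rot1.
Qed.

Definition primitive_word c := forall c' k, (1 < k)%N -> c <> pow k c'.

Lemma primw_period g x : (0 < g)%N -> (g %| size x)%N -> iter g r1 x = x -> primitive_word x ->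
  x <> [::] -> g = size x.
Proof.
move=> g0 gx h px x0; have xs : (0 < size x)%N by case: x x0 {gx h px}.
have := period_pow g0 gx h; have [|le] := ltnP 1 (size x %/ g).
  by move=> h1 e; case: (px _ _ h1 e).
have : (size x %/ g == 1)%N by rewrite eqn_leq le divn_gt0// dvdn_leq.
by move=> /eqP e _; rewrite -[RHS](divnK gx) e mul1n.
Qed.

Lemma rot_pow k x : iter (size x) r1 (pow k x) = pow k x.
Proof.
case: k => [|k]; first by elim: (size x) => //= n ->.
rewrite iter_rot1 /= ?size_cat ?leq_addr// rot_size_cat.
by rewrite -{2}[x]cats0 -[x ++ [::]]/(pow 1 x) -powD addn1.
Qed.

Lemma take_pow j k x : (j <= k)%N -> take (j * size x) (pow k x) = pow j x.
Proof. by move=> jk; rewrite -(subnKC jk) powD take_size_cat// size_pow. Qed.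

(** The common word has both lengths as rotation periods, hence their gcd by Bezout. A period
    dividing the length of a primitive word must be that length, so both lengths equal the gcd. *)
Lemma pow_inj a b x y : (0 < a)%N -> (0 < b)%N -> primitive_word x -> primitive_word y -> x <> [::] -> y <> [::] ->
  pow a x = pow b y -> x = y.
Proof.
move=> a0 b0 px py x0 y0 e.
have key (c d : nat) (z z' : seq T) : (0 < c)%N -> (0 < d)%N -> primitive_word z -> z <> [::] -> z' <> [::] -> pow c z = pow d z' ->
    gcdn (size z) (size z') = size z.
  move=> c0 d0 pz z0 z0' ez; have zs : (0 < size z)%N by case: z z0 {pz ez}.
  set g := gcdn _ _; have g0 : (0 < g)%N by rewrite gcdn_gt0 zs.
  have gz : (g %| size z)%N := dvdn_gcdl _ _.
  have gw : (g %| size (pow c z))%N by rewrite size_pow dvdn_mull.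
  have hg : iter g r1 (pow c z) = pow c z.
    by apply: iter_gcd; rewrite ?rot_pow// ez rot_pow.
  have ew := period_pow g0 gw hg; set u := take g _ in ew.
  have su : size u = g.
    by rewrite size_takel// dvdn_leq// size_pow muln_gt0 c0.
  have ezu : z = pow (size z %/ g) u.
    rewrite -(@take_pow _ (size (pow c z) %/ g)); last by rewrite leq_div2r// size_pow leq_pmull.
    by rewrite su divnK// -ew -[X in take X _]mul1n take_pow//= cats0.
  have [|le] := ltnP 1 (size z %/ g); first by move=> h1; case: (pz _ _ h1 ezu).
  have : (size z %/ g == 1)%N by rewrite eqn_leq le divn_gt0// dvdn_leq.
  by move=> /eqP e1; rewrite -[RHS](divnK gz) e1 mul1n.
have e1 := key _ _ _ _ a0 b0 px x0 y0 e.
have e2 := key _ _ _ _ b0 a0 py y0 x0 (esym e).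
have sxy : size x = size y by rewrite -e1 gcdnC e2.
have := congr1 (take (1 * size x)) e; rewrite take_pow// sxy take_pow//=.
by rewrite !cats0.
Qed.

Lemma pow_root w : w <> [::] -> exists x k, [/\ primitive_word x, x <> [::], (0 < k)%N & w = pow k x].
Proof.
have [n] := ubnP (size w); elim: n w => // n IH w wn w0.
have [pw|npw] := pselect (primitive_word w); first by exists w, 1%N; rewrite /= cats0.
have [c' [k [k1 e]]] : exists c' k, (1 < k)%N /\ w = pow k c'.
  apply: contrapT => H; apply: npw => c' k k1 e; apply: H; by exists c', k.
have c0 : c' <> [::].
  by move=> e'; apply: w0; apply: size0nil; rewrite e size_pow e' muln0.
have cs : (0 < size c')%N by case: c' c0 {e}.
have [|x [j [px x0 j0 ec]]] := IH c' _ c0.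
  apply: (@leq_trans (size w)); last by rewrite -ltnS.
  by rewrite e size_pow -{1}[size c']mul1n ltn_mul2r cs.
by exists x, (k * j)%N; rewrite muln_gt0 j0 (ltnW k1) e ec powM.
Qed.

Lemma rot1_pow k x : r1 (pow k x) = pow k (r1 x).
Proof.
case: x => [|y s]; first by have -> : pow k [::] = [::] by move=> U; elim: k.
rewrite rot1_cons; case: k => // k; rewrite /= rot1_cons.
elim: k => [|k IH] /=; first by rewrite !cats0.
by rewrite rcons_cat /= -IH rcons_cat cat_rcons.
Qed.

Lemma iter_rot_pow j k x : iter j r1 (pow k x) = pow k (iter j r1 x).
Proof. by elim: j => //= j ->; rewrite rot1_pow. Qed.

Lemma primw_iter j x : primitive_word x -> primitive_word (iter j r1 x).
Proof.
move=> px c' k k1 e; pose q := (j * size x)%N.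
have := iter_mul j (rot_pow 1 x); rewrite /= cats0 => hx.
have [x0|x0] := posnP (size x).
  by apply: (px [::] k k1); rewrite (size0nil x0); elim: (k).
have jq : (j <= j * size x)%N by rewrite leq_pmulr.
apply: (px (iter (j * size x - j) r1 c') k k1).
by rewrite -iter_rot_pow -e -iterD subnK.
Qed.

Lemma rotE k w : exists j, (j <= size w)%N /\ rot k w = iter j r1 w.
Proof.
have [h|h] := leqP k (size w); first by exists k; rewrite iter_rot1.
by exists 0%N; rewrite rot_oversize// ltnW.
Qed.

Lemma primw_rot k x : primitive_word x -> primitive_word (rot k x).
Proof. by have [j [_ ->]] := rotE k x; exact: primw_iter. Qed.

(** Equal rotations would give the positive period j - i; with the full length its gcd is also a
    period, which primitivity forces to be the length, larger than j - i. *)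
Lemma rot_prim_inj x i j : primitive_word x -> (i < size x)%N -> (j < size x)%N -> rot i x = rot j x -> i = j.
Proof.
wlog ij : i j / (i <= j)%N.
  by move=> W; case/orP: (leq_total i j) => h ? ? ? ?; [exact: W|apply/esym; exact: W].
move=> px hi hj e; apply/eqP; rewrite eqn_leq ij /= leqNgt; apply/negP => lt.
have d0 : (0 < j - i)%N by rewrite subn_gt0.
pose y := rot i x; have sy : size y = size x by rewrite size_rot.
have hy : iter (j - i) r1 y = y.
  by rewrite /y -{1}iter_rot1 ?(ltnW hi)// -iterD subnK// iter_rot1 ?(ltnW hj)// e.
have hs : iter (size y) r1 y = y by rewrite iter_rot1// rot_size.
have := @primw_period (gcdn (j - i) (size y)) y.
rewrite gcdn_gt0 d0 dvdn_gcdr => /(_ isT isT (iter_gcd d0 hy hs) (primw_rot px)) H.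
have y0 : y <> [::] by move=> y0; move: sy hi; rewrite y0 => <-.
have := dvdn_gcdl (j - i) (size y); rewrite H// sy => /(dvdn_leq d0).
by rewrite leqNgt (leq_ltn_trans (leq_subr _ _) hj).
Qed.

Lemma cycle_pow e k x : (0 < k)%N -> cycle e (pow k x) = cycle e x.
Proof.
case: x => [|y s]; first by have -> : pow k [::] = [::] by move=> U; elim: k.
case: k => // k _.
have key j : path e y (pow j.+1 (rcons s y)) = path e y (rcons s y).
  elim: j => [|j IH]; first by rewrite /= cats0.
  by rewrite -addn1 addnC powD /= cats0 cat_path last_rcons IH andbb.
rewrite /= -[RHS](key k); congr (path e y _).
by have := rot1_pow k.+1 (y :: s); rewrite -[pow k.+1 (y :: s)]/(y :: (s ++ pow k (y :: s))) !rot1_cons.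
Qed.

Definition rot_class c : set (seq T) := [set rot k c | k in setT].

Lemma rcls_self c : rot_class c c. Proof. by exists 0%N => //; rewrite rot0. Qed.

Lemma rcls_iter c x : rot_class c x <-> exists j, x = iter j r1 c.
Proof.
split=> [[k _ <-]|[j ->]]; first by have [j [_ ->]] := rotE k c; exists j.
elim: j => [|j [k _ ek]]; first exact: rcls_self.
rewrite iterS -ek; have [j' [_ ->]] := rotE k c.
have [c0|c0] := posnP (size c).
  have -> : iter j' r1 c = c by rewrite (size0nil c0); elim: j' => //= ? ->.
  by rewrite {2}(size0nil c0) (size0nil c0); exact: rcls_self.
rewrite -iterS; exists (j'.+1 %% size c)%N => //.
rewrite -iter_rot1; last by rewrite ltnW// ltn_mod.
rewrite {2}(divn_eq j'.+1 (size c)) addnC iterD iter_mul// iter_rot1// rot_size//.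
Qed.

Lemma rcls_eq c x : rot_class c x -> rot_class x = rot_class c.
Proof.
move=> /rcls_iter[j ej]; apply/seteqP; split=> y /rcls_iter[i ei]; apply/rcls_iter.
  by exists (i + j)%N; rewrite iterD -ej.
exists (i + (j * size c - j))%N; rewrite iterD.
suff -> : iter (j * size c - j) r1 x = c by [].
rewrite ej -iterD; have [c0|c0] := posnP (size c).
  by rewrite (size0nil c0); elim: (_ + _)%N => //= ? ->.
by rewrite subnK ?leq_pmulr// iter_mul// iter_rot1// rot_size.
Qed.

(** * Closed walks, traces and the Euler product *)

Section Counting.
Variables (m : nat) (eps : 'I_m -> T) (e : rel T).
Hypotheses (eps_inj : injective eps) (e_ran : forall x y : T, e x y -> exists i, x = eps i).
Variable C : numFieldType.

Definition prime_cycles : set (set (seq T)) :=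
  [set rot_class c | c in [set c | [/\ c <> [::], cycle e c & primitive_word c]]].

Definition cycle_len (P : set (seq T)) : nat := size (xget [::] P).

Lemma prime_cyclesP P : prime_cycles P -> let c := xget [::] P in
  [/\ P = rot_class c, c <> [::], cycle e c & primitive_word c].
Proof.
move=> [c [c0 cc pc] <-] /=.
have h : rot_class c (xget [::] (rot_class c)) by case: xgetP => [x _ //|/(_ c)/(_ (rcls_self c))].
split; first by rewrite (rcls_eq h).
- case: h => k _ <- e0; apply: c0; apply: size0nil.
  by rewrite -(size_rot k c) e0.
- by case: h => k _ <-; rewrite rot_cycle.
- by case: h => k _ <-; exact: primw_rot.
Qed.

Definition words n : seq (seq T) :=
  [seq w <- [seq map eps (tval t) | t <- enum {: n.-tuple 'I_m}] | cycle e w].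

Lemma words_uniq n : uniq (words n).
Proof.
apply: filter_uniq; rewrite map_inj_uniq ?enum_uniq// => s t h.
by apply: val_inj; apply: (inj_map eps_inj).
Qed.

Lemma cycle_ran w : cycle e w -> exists s, w = map eps s.
Proof.
move=> cw; have h (x : T) : x \in w -> exists i, x = eps i.
  by move=> xw; apply: e_ran (next_cycle cw xw).
elim: w h {cw} => [|x w IH] h; first by exists [::].
have [i ei] := h x (mem_head _ _); have [|s ->] := IH; last by exists (i :: s); rewrite ei.
by move=> y yw; apply: h; rewrite inE yw orbT.
Qed.

Lemma mem_words n w : (w \in words n) = (size w == n) && cycle e w.
Proof.
rewrite mem_filter andbC; apply/andP/andP => -[h cw]; split=> //.
  by case/mapP: h => t _ ->; rewrite size_map size_tuple.
have [s es] := cycle_ran cw; have ss : size s == n by rewrite es size_map in h.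
by apply/mapP; exists (Tuple ss); rewrite ?mem_enum.
Qed.

Lemma finite_primes n : finite_set [set P | prime_cycles P /\ (cycle_len P <= n)%N].
Proof.
apply: (@sub_finite_set _ _ (rot_class @` [set` flatten [seq words i | i <- iota 0 n.+1]])); last first.
  exact/finite_image/finite_seq.
move=> P [hP hl]; have [eP c0 cc pc] := prime_cyclesP hP.
exists (xget [::] P) => //.
suff : xget [::] P \in flatten [seq words i | i <- iota 0 n.+1] by [].
apply/flattenP; exists (words (cycle_len P)).
  by apply: map_f; rewrite mem_iota add0n ltnS.
by rewrite mem_words eqxx.
Qed.

(** Every closed word of length n is a power of a unique primitive word, which is a unique rotation
    of the representative of its class. So a class of length l contributes l words when l divides n
    and none otherwise. *)
Lemma size_words n (B : seq (set (seq T))) : (0 < n)%N -> uniq B -> (forall P, P \in B -> prime_cycles P) ->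
  (forall P, prime_cycles P -> (cycle_len P <= n)%N -> P \in B) ->
  size (words n) = \sum_(P <- B | (cycle_len P %| n)%N) cycle_len P.
Proof.
move=> n0 uB hB hB'.
pose B' := [seq P <- B | (cycle_len P %| n)%N].
pose L := [seq pow (n %/ cycle_len P)%N (rot k (xget [::] P)) | P <- B', k <- iota 0 (cycle_len P)].
have hB'' P : P \in B' -> [/\ prime_cycles P, (cycle_len P %| n)%N & (0 < cycle_len P)%N].
  rewrite mem_filter => /andP[h1 /hB hP]; have [_ c0 _ _] := prime_cyclesP hP.
  by split=> //; rewrite /cycle_len; case: xget c0.
have <- : size L = \sum_(P <- B | (cycle_len P %| n)%N) cycle_len P.
  rewrite size_allpairs_dep -big_filter -/B' sumnE big_map.
  by apply: eq_bigr => P _; rewrite size_iota.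
apply/perm_size/uniq_perm; first exact: words_uniq.
  apply: allpairs_uniq_dep; first exact: filter_uniq.
    by move=> P _; exact: iota_uniq.
  move=> _ _ /allpairsPdep[P [k [PB hk ->]]] /allpairsPdep[P' [k' [PB' hk' ->]]] /=.
  have [hP dP lP] := hB'' _ PB; have [hP' dP' lP'] := hB'' _ PB'.
  have [eP c0 cc pc] := prime_cyclesP hP; have [eP' c0' cc' pc'] := prime_cyclesP hP'.
  move=> epow; have er : rot k (xget [::] P) = rot k' (xget [::] P').
    have nn : forall (k : nat) (c : seq T), c <> [::] -> rot k c <> [::].
      by move=> j c hc h; apply: hc; apply: size0nil; rewrite -(size_rot j) h.
    apply: (@pow_inj (n %/ cycle_len P)%N (n %/ cycle_len P')%N _ _ _ _ _ _ _ _ epow).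
    - by rewrite divn_gt0// dvdn_leq.
    - by rewrite divn_gt0// dvdn_leq.
    - exact: primw_rot.
    - exact: primw_rot.
    - exact: nn.
    - exact: nn.
  have ePP : P = P'.
    rewrite eP eP' -(rcls_eq (c := xget [::] P) (x := rot k (xget [::] P))); last by exists k.
    by rewrite er; apply: rcls_eq; exists k'.
  subst P'; congr (existT _ _ _); apply: rot_prim_inj er => //.
    by move: hk; rewrite mem_iota add0n.
  by move: hk'; rewrite mem_iota add0n.
move=> w; rewrite mem_words; apply/andP/allpairsPdep.
  move=> [/eqP sw cw]; have w0 : w <> [::] by move=> w0; move: sw n0; rewrite w0 => <-.
  have [x [j [px x0 j0 ew]]] := pow_root w0.
  have cx : cycle e x by rewrite -(cycle_pow e x j0) -ew.
  have hP : prime_cycles (rot_class x) by exists x.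
  have [eP c0 cc pc] := prime_cyclesP hP.
  have [k0 _ ek0] : rot_class (xget [::] (rot_class x)) x by rewrite -eP; exact: rcls_self.
  have sx : size (xget [::] (rot_class x)) = size x by have := congr1 size ek0; rewrite size_rot.
  have xs : (0 < size x)%N by case: (x) x0.
  have en : n = (j * size x)%N by rewrite -sw ew size_pow.
  have [k [kx ek]] : exists k, (k < size x)%N /\ rot k (xget [::] (rot_class x)) = x.
    have [h|h] := ltnP k0 (size x); first by exists k0.
    by exists 0%N; rewrite rot0; split=> //; move: ek0; rewrite rot_oversize// sx.
  exists (rot_class x), k; split.
  - rewrite mem_filter /cycle_len sx en dvdn_mull//=; apply: hB' => //.
    by rewrite /cycle_len sx en leq_pmull.
  - by rewrite mem_iota add0n /cycle_len sx.
  - by rewrite ek /cycle_len sx en mulnK// ew.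
move=> [P [k [PB hk ->]]]; have [hP dP lP] := hB'' _ PB; have [eP c0 cc pc] := prime_cyclesP hP.
rewrite size_pow size_rot divnK// eqxx cycle_pow ?rot_cycle//.
by rewrite divn_gt0// dvdn_leq.
Qed.

Definition transition_mx : 'M[C]_m := \matrix_(i, j) (e (eps i) (eps j))%:R.

Lemma sum_tuple_cons (V : nmodType) n (f : seq 'I_m -> V) :
  \sum_(t : n.+1.-tuple 'I_m) f t = \sum_i \sum_(t : n.-tuple 'I_m) f (i :: t).
Proof.
rewrite pair_bigA /= (reindex (fun p : 'I_m * n.-tuple 'I_m => [tuple of p.1 :: p.2])) //=.
exists (fun t : n.+1.-tuple 'I_m => (thead t, [tuple of behead t])) => [[i t] _|t _] /=.
  by congr (_, _); apply: val_inj.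
by rewrite [RHS]tuple_eta.
Qed.

Lemma iter_mulmx_paths n i j : iter n.+1 (mulmx transition_mx) 1%:M i j =
  \sum_(t : n.-tuple 'I_m) (path e (eps i) (rcons (map eps t) (eps j)))%:R.
Proof.
elim: n i j => [|n IH] i j.
  rewrite /= mulmx1 mxE (big_pred1 [tuple]) /= ?andbT// => t.
  by apply/esym/eqP; rewrite (tuple0 t).
rewrite iterS mxE (sum_tuple_cons n (fun t => (path e (eps i) (rcons (map eps t) (eps j)))%:R)).
apply: eq_bigr => k _.
rewrite IH mulr_sumr; apply: eq_bigr => t _ /=.
by rewrite mxE -natrM mulnb.
Qed.

Lemma trace_words n : \tr (iter n.+1 (mulmx transition_mx) 1%:M) = (size (words n.+1))%:R.
Proof.
transitivity (\sum_(t : n.+1.-tuple 'I_m) (cycle e (map eps t))%:R : C).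
  rewrite (sum_tuple_cons n (fun t => (cycle e (map eps t))%:R)); apply: eq_bigr => i _.
  by rewrite iter_mulmx_paths.
rewrite -natr_sum; congr _%:R; rewrite size_filter count_map -sum1_count [RHS]big_mkcond [RHS]big_enum /=.
by apply: eq_big => // t _; case: cycle.
Qed.

Theorem euler_product_det : exists Z,
  is_euler_product prime_cycles cycle_len Z /\
  fps_mul Z (fps_of_poly (\det (1%:M - 'X *: map_mx polyC transition_mx))) = fps_one C.
Proof.
set D := \det _.
have D0 : D`_0 = 1.
  rewrite -horner_coef0 /D -horner_evalE -det_map_mx (_ : map_mx _ _ = 1%:M) ?det1//.
  apply/matrixP => i j; rewrite !mxE rmorphB rmorphM rmorph_nat /= /horner_eval.
  by rewrite hornerX mul0r subr0.
have [Z hZ] := fps_inverse D0; exists Z; split=> // n.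
(* Classes longer than n do not affect the coefficient of degree n, so any finite set of primes
   containing all those of length at most n yields this coefficient. *)
have /finite_fsetP[A0 eA0] := finite_primes n.
exists A0 => [P|B AB BS].
  by move=> /= PA; have : [set` A0] P by []; rewrite -eA0 => -[].
rewrite -(big_map cycle_len xpredT (fun l => euler_factor C l)).
apply: (euler_product_prefix (D := D) (tau := fun k => (0 < k)%N%:R * \tr (iter k (mulmx transition_mx) 1%:M))) => //.
- apply/allP => l /mapP[P PB ->]; have [_ c0 _ _] := prime_cyclesP (BS _ PB).
  by rewrite /cycle_len; case: xget c0.
- by rewrite mul0r.
- exact: logderiv_det.
move=> [|i] //= hi; rewrite mul1r trace_words; congr _%:R.
rewrite big_map (@size_words i.+1 (enum_fset B))//.
- exact: fset_uniq.
- move=> P hP hl; apply/(fsubsetP AB).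
  have : [set` A0] P by rewrite -eA0; split=> //; exact: leq_trans hl hi.
  by [].
Qed.

End Counting.
End Words.

(** * Edges of the quotient *)

Section Edges.
Variables (F : fieldType) (ord : F -> int) (pi : F) (Gamma : set 'M[F]_4).
Hypotheses (hF : nonarch_local_field ord) (hpi : uniformizer ord pi).
Hypotheses (hG : is_subgroup Gamma) (hd : discrete ord Gamma)
  (htf : torsion_free_mod_center Gamma) (hG0 : Gamma `<=` G0 ord)
  (hcc : cocompact_mod_center ord Gamma).
Local Notation inw := (inw ord).
Local Notation GSp1 := (GSp1 ord).
Local Notation td := (td pi).
Local Notation GL4O := (GL4O ord).
Local Notation vtx := (vtx ord).
Local Notation even_simil := (even_simil ord).
Local Notation valid := (valid ord).
Implicit Types (g h s : 'M[F]_4) (k : option bool).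
Local Notation vertex := (set (set 'cV[F]_4)).
Local Notation edge := (set (vertex * vertex)).

Lemma edge_orbitP (v w v' w' : vertex) : edge_orbit Gamma v w = edge_orbit Gamma v' w' <->
  exists gam, [/\ Gamma gam, v' = act gam v & w' = act gam w].
Proof.
have act1 (u : vertex) : act 1%:M u = u.
  have im1 (L : set 'cV[F]_4) : [set 1%:M *m x | x in L] = L.
    apply/seteqP; split=> [_ [x hx <-]|x hx]; first by rewrite mul1mx.
    by exists x; rewrite ?mul1mx.
  apply/seteqP; split=> [_ [L hL <-]|L hL]; first exact: (eq_ind_r u hL (im1 L)).
  by exists L => //; exact: im1.
have actM g h (u : vertex) : act g (act h u) = act (g *m h) u.
  have imM (L : set 'cV[F]_4) : [set g *m x | x in [set h *m x | x in L]] = [set g *m h *m x | x in L].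
    apply/seteqP; split=> [_ [_ [x hx <-] <-]|_ [x hx <-]]; first by exists x; rewrite ?mulmxA.
    by exists (h *m x); [exists x|rewrite mulmxA].
  apply/seteqP; split=> [_ [_ [L hL <-] <-]|_ [L hL <-]].
    by exists L => //; apply/esym; exact: imM.
  by exists [set h *m x | x in L]; [exists L|exact: imM].
split=> [e|[gam [hg -> ->]]].
  have : edge_orbit Gamma v' w' (v', w') by exists 1%:M; [exact: Gamma1|rewrite !act1].
  by rewrite -e => -[gam hg [<- <-]]; exists gam.
have ug := Gamma_unit hG hg.
apply/seteqP; split=> _ [h hh <-].
  exists (h *m invmx gam); first by apply: GammaM => //; exact: GammaV.
  by rewrite !actM mulmxKV.
by exists (h *m gam); [exact: GammaM|rewrite !actM].
Qed.

Definition std_edge k i g : edge :=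
  edge_orbit Gamma (vtx (g *m td (line_wt k i))) (vtx (g *m td (line_wt k i.+1))).

Lemma std_edgeP k i g h : GSp4 g -> GSp4 h -> std_edge k i g = std_edge k i h <->
  exists gam c s, [/\ Gamma gam, c != 0, GSp1 s, inw (line_wt k i) s /\ inw (line_wt k i.+1) s
    & h = c *: (gam *m g *m s)].
Proof.
move=> hg hh; split=> [/edge_orbitP[gam [hgam]]|[gam [c [s [hgam c0 hs [h1 h2] ->]]]]].
  rewrite !vtx_act !mulmxA => /esym e1 /esym e2.
  have hgg : GSp4 (gam *m g) by apply: GSp4M => //; exact: Gamma_GSp4 hG _ hgam.
  have [c [s [c0 hs s1 s2 e]]] := edge_eq_inw hF hpi hgg hh e1 e2.
  by exists gam, c, s.
have [_ us] := hs.
apply/edge_orbitP; exists gam; split=> //; rewrite vtx_act -scalemxAl vtxZ// !mulmxA;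
by rewrite (vtx_stab hF hpi) ?unitmx_mul ?(GSp4_unit hg) ?(Gamma_unit hG hgam).
Qed.

Lemma std_edge_mulr k i g s : GSp4 g -> GSp1 s -> inw (line_wt k i) s -> inw (line_wt k i.+1) s ->
  std_edge k i (g *m s) = std_edge k i g.
Proof.
move=> hg hs h1 h2; apply/esym/std_edgeP => //; first by apply: GSp4M => //; case: hs.
exists 1%:M, 1, s; split=> //; rewrite ?oner_neq0//; first exact: Gamma1.
by rewrite mul1mx scale1r.
Qed.

Lemma std_edge_act k i g gam c : GSp4 g -> Gamma gam -> c != 0 -> std_edge k i (c *: (gam *m g)) = std_edge k i g.
Proof.
move=> hg hgam c0; apply/esym/std_edgeP => //.
  by apply: GSp4Z => //; apply: GSp4M => //; exact: Gamma_GSp4 hG _ hgam.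
exists gam, c, 1%:M; split=> //; last by rewrite mulmx1.
  exact: GSp1_1.
by split; exact: inw1.
Qed.

Lemma vtx_det g h : g \in unitmx -> h \in unitmx -> vtx g = vtx h ->
  exists m : int, ord (\det h) = ord (\det g) + 4 * m.
Proof.
move=> ug uh /(vtxP hF ug uh)[c c0 /(GL4OP hF)[_ [_]]].
rewrite (ord_detZ hF)//; last by rewrite unitmx_mul unitmx_inv ug.
rewrite det_mulmx det_inv (ordMn0 hF) ?invr_eq0 -?unitfE -?unitmxE//.
rewrite (ordV hF) -?unitfE -?unitmxE// => h0.
exists (- ord c); move: h0; move: (ord c) (ord (\det h)) (ord (\det g)); clear => *; lia.
Qed.

Lemma ord_det_td g a : g \in unitmx ->
  ord (\det (g *m td a)) = ord (\det g) + (wt a o0 + wt a o1 + wt a o2 + wt a o3).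
Proof.
move=> ug; rewrite det_mulmx det_diag /= (eq_bigr (fun i => pi ^ wt a i)); last by move=> i _; rewrite mxE.
rewrite (ordMn0 hF) -?unitfE -?unitmxE//; last first.
  by rewrite unitfE; apply/prodf_neq0 => i _; exact: (pi_exp_neq0 hpi).
congr (_ + _); rewrite !big_ord_recl big_ord0 mulr1 -!exprzDr ?unitfE ?(pi_neq0 hpi)//.
rewrite (ord_pi_exp hF hpi) !addrA; congr (wt a _ + wt a _ + wt a _ + wt a _); exact: val_inj.
Qed.

(** Homotheties and elements of [G0] change the order of the determinant by multiples of 4, so its
    residue at each end depends only on the orbit of the edge. *)
Lemma std_edge_det k i g k' i' g' : GSp4 g -> GSp4 g' -> std_edge k i g = std_edge k' i' g' ->
  (exists m : int, ord (\det (g' *m td (line_wt k' i'))) = ord (\det (g *m td (line_wt k i))) + 4 * m) /\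
  exists m : int, ord (\det (g' *m td (line_wt k' i'.+1))) = ord (\det (g *m td (line_wt k i.+1))) + 4 * m.
Proof.
move=> hg hg' /edge_orbitP[gam [hgam]]; rewrite !vtx_act !mulmxA.
have ug := GSp4_unit hg; have ug' := GSp4_unit hg'; have um := Gamma_unit hG hgam.
have [q hq] : exists q : int, ord (\det gam) = 4 * q.
  by have [_ /dvdzP[q hq]] := hG0 hgam; exists q; rewrite hq mulrC.
have key a b : vtx (g' *m td b) = vtx (gam *m g *m td a) ->
    exists m : int, ord (\det (g' *m td b)) = ord (\det (g *m td a)) + 4 * m.
  move=> /esym /vtx_det; rewrite !unitmx_mul um ug ug' !(td_unit hpi) => /(_ isT isT)[m ->].
  exists (q + m); rewrite -mulmxA [in LHS]det_mulmx (ordMn0 hF) -?unitfE -?unitmxE ?unitmx_mul ?ug ?(td_unit hpi)//.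
  by rewrite hq; move: (ord (\det (g *m _))) => x; clear; lia.
by move=> /key[m hm] /key[m' hm']; split; [exists m|exists m'].
Qed.

Lemma evnP g : GSp4 g -> exists q : int, ord (\det g) = if even_simil g then 4 * q else 4 * q + 2.
Proof.
move=> hg; have [l l0 hl] := proj1 (GSp4P g) hg.
rewrite (evnE hF l0 hl) (ord_det hF l0 hl).
have [j [->|->]] := evenoddz (ord l); exists j; first by rewrite dvdz_mulr//; lia.
by rewrite (_ : (2 %| 2 * j + 1)%Z = false); [lia|apply/negP; lia].
Qed.

Definition edge_step (e e' : edge) : bool := `[< exists g k i,
  [/\ GSp4 g, valid k g, e = std_edge k i g & e' = std_edge k i.+1 g] >].

(** Along an axis the parity of the index says whether the edge leaves a special or a non-special
    vertex; along a diagonal all edges look alike. *)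
Definition same_phase k (i i' : nat) := if k is Some _ then odd i = odd i' else true.

(** The residues modulo 4 at the two ends are even at special vertices and odd at the others, which
    separates the kinds and phases; the residue at the special end of an axis edge recovers the
    parity of the similitude factor. *)
Lemma std_edge_phase k i g k' i' g' : GSp4 g -> GSp4 g' -> valid k g -> valid k' g' ->
  std_edge k i g = std_edge k' i' g' -> k = k' /\ same_phase k i i'.
Proof.
move=> hg hg' hv hv' /(std_edge_det hg hg')[[m]]; rewrite !ord_det_td ?GSp4_unit// => h1 [m' h2].
have [q hq] := evnP hg; have [q' hq'] := evnP hg'; move: h1 h2; rewrite hq hq'.
case: k hv => [b|] hv; case: k' hv' => [b'|] hv'; rewrite ?(hv : b = even_simil g) ?(hv' : b' = even_simil g') //=;
  rewrite ?wt_hyp.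
- have [j [->|->]] := evenodd i; have [j' [->|->]] := evenodd i'; rewrite -?doubleS ?line_wt_odd ?line_wt_even !wt_row4 /= ?odd_double /=;
  by case: (even_simil g); case: (even_simil g') => /= h1 h2; split=> //; exfalso; move: h1 h2; clear; lia.
- have [j [->|->]] := evenodd i; rewrite -?doubleS ?line_wt_odd ?line_wt_even !wt_row4 /=;
  by case: (even_simil g); case: (even_simil g') => /= h1 h2; exfalso; move: h1 h2; clear; lia.
- have [j [->|->]] := evenodd i'; rewrite -?doubleS ?line_wt_odd ?line_wt_even !wt_row4 /=;
  by case: (even_simil g); case: (even_simil g') => /= h1 h2; exfalso; move: h1 h2; clear; lia.
Qed.

(** The line is carried to itself by a translation, by any number of steps along a diagonal and by
    an even number along an axis; the base [g] absorbs it. *)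
Lemma std_edge_shift k i i' g : GSp4 g -> valid k g -> same_phase k i i' -> exists h,
  [/\ GSp4 h, valid k h, std_edge k i h = std_edge k i' g & std_edge k i.+1 h = std_edge k i'.+1 g].
Proof.
move=> hg hv hph.
have key t : GSp4 t -> (if k is Some _ then even_simil t else true) -> valid k (g *m t).
  move=> ht; case: k hv {hph} => // b hv e; rewrite /valid (evnM hF)// e.
  by rewrite (hv : b = even_simil g); case: (even_simil g).
pose n : int := if k is Some _ then i'./2%:Z - i./2%:Z else i'%:Z - i%:Z.
pose a : 'rV[int]_4 := if k is Some _ then row4 0 n n (2 * n) else row4 0 0 n n.
have sa : simil (pi ^ (if k is Some _ then 2 * n else n)) (td a).
  by apply: (td_simil hpi); rewrite /a; case: (k); rewrite !wt_row4; clear; lia.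
have ga : GSp4 (td a).
  by apply/GSp4P; eexists; [|exact: sa]; exact: (pi_exp_neq0 hpi).
have e0 j : (if k is Some _ then odd j = odd i else true) -> line_wt k i + a = line_wt k i'.
  move=> _; rewrite [LHS]row4E [RHS]row4E; congr row4; rewrite -!/(wt _ _) wtD;
  by rewrite /a /n; case: k hph {hv a sa ga n key} => [b|] hph; rewrite ?wt_ax ?wt_hyp !wt_row4;
    have := odd_double_half i; have := odd_double_half i'; rewrite -!muln2 -?hph; clear; lia.
have e1 : line_wt k i.+1 + a = line_wt k i'.+1.
  rewrite [LHS]row4E [RHS]row4E; congr row4; rewrite -!/(wt _ _) wtD;
  by rewrite /a /n; case: k hph {hv a sa ga n e0 key} => [b|] hph; rewrite ?wt_ax ?wt_hyp !wt_row4 /= ?uphalf_half -?hph;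
    have := odd_double_half i; have := odd_double_half i'; rewrite -!muln2 -?hph; clear; lia.
exists (g *m td a); split.
- exact: GSp4M.
- apply: key => //; rewrite (evnE hF _ sa) ?(pi_exp_neq0 hpi)// (ord_pi_exp hF hpi).
  by case: (k) => // _; rewrite dvdz_mulr.
- by rewrite /std_edge -!mulmxA -!(tdD hpi) ![a + _]addrC (e0 i) ?e1//; case: (k).
- suff e2 : line_wt k i.+2 + a = line_wt k i'.+2 by rewrite /std_edge -!mulmxA -!(tdD hpi) ![a + _]addrC e1 e2.
  rewrite [LHS]row4E [RHS]row4E; congr row4; rewrite -!/(wt _ _) wtD;
  by rewrite /a /n; case: k hph {hv a sa ga n e0 e1 key} => [b|] hph; rewrite ?wt_ax ?wt_hyp !wt_row4 /= ?negbK -?hph;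
    have := odd_double_half i; have := odd_double_half i'; rewrite -!muln2 -?hph; clear; lia.
Qed.

(** Gluing of two lines that share edge n: the element given by [factor] bends the line of [g] after
    this edge so that it follows that of [h], without moving the edges before. *)
Lemma std_edge_chain k n g h : GSp4 g -> GSp4 h -> valid k g -> std_edge k n g = std_edge k n h ->
  exists g', [/\ GSp4 g', valid k g', forall i, (i <= n)%N -> std_edge k i g' = std_edge k i g
    & std_edge k n.+1 g' = std_edge k n.+1 h].
Proof.
move=> hg hh hv /(std_edgeP k n hg hh)[gam [c [s [hgam c0 hs [h1 h2] ->]]]].
have [u [hu hui hum]] := factor hF hpi hs h1 h2.
have gu : GSp4 (g *m u) by apply: GSp4M => //; case: hu.
exists (g *m u); split=> //.
- case: k hv {h1 h2 hui hum} => // b hv; rewrite /valid (evnM hF)//; last by case: hu.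
  by rewrite (hv : b = even_simil g) (evn_GSp1 hu); case: (even_simil g).
- by move=> i hi; apply: std_edge_mulr => //; apply: hui => //; rewrite ltnW.
have uu := GSp1_unit hu; have gs : GSp4 (g *m s) by apply: GSp4M => //; case: hs.
rewrite -!mulmxA std_edge_act//; have -> : g *m s = (g *m u) *m (invmx u *m s) by rewrite -mulmxA mulKVmx.
rewrite [RHS]std_edge_mulr//.
  by apply: (GSp1M hF) => //; exact: (GSp1V hF).
by apply: (inwM hF) => //; apply: (inwV hF hpi); [exact: hui|case: hu].
Qed.

Lemma edge_step_phase e e' k i g : edge_step e e' -> GSp4 g -> valid k g -> e = std_edge k i g ->
  exists h, [/\ GSp4 h, valid k h, e = std_edge k i h & e' = std_edge k i.+1 h].
Proof.
move=> /asboolP[g0 [k0 [i0 [hg0 hv0 -> ->]]]] hg hv eqe.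
have [ek ph] := std_edge_phase hg0 hg hv0 hv eqe; subst k0.
have [|h [hh hvh eh eh']] := @std_edge_shift k i i0 g0 hg0 hv0.
  by case: (k) ph => //= _ ->.
by exists h.
Qed.

Lemma edge_step_chain (es : nat -> edge) n : (forall i, (i < n)%N -> edge_step (es i) (es i.+1)) -> (0 < n)%N ->
  exists g k i0, [/\ GSp4 g, valid k g & forall i, (i <= n)%N -> es i = std_edge k (i0 + i)%N g].
Proof.
move=> htr n0; have /asboolP[g0 [k [i0 [hg0 hv0 e0 _]]]] := htr 0%N n0.
suff [g [hg hv h]] : exists g, [/\ GSp4 g, valid k g & forall i, (i <= n)%N -> es i = std_edge k (i0 + i)%N g].
  by exists g, k, i0.
elim: n htr {n0} => [|n IH] htr.
  by exists g0; split=> // i; rewrite leqn0 => /eqP ->; rewrite addn0.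
have [|g [hg hv h]] := IH; first by move=> i hi; apply: htr; exact: ltnW.
have [h' [hh' hv' e1 e2]] := edge_step_phase (htr n (ltnSn n)) hg hv (h n (leqnn n)).
have [|g' [hg' hvg' e3 e4]] := @std_edge_chain k (i0 + n)%N g h' hg hh' hv; first by rewrite -e1 -h.
exists g'; split=> // i; rewrite leq_eqVlt => /orP[/eqP ->|].
  by rewrite addnS e4 e2.
by rewrite ltnS => hi; rewrite e3 ?leq_add2l// h.
Qed.

Lemma vtx_free gam h : Gamma gam -> h \in unitmx -> vtx (gam *m h) = vtx h ->
  forall g, vtx (gam *m g) = vtx g.
Proof.
move=> hg uh e g; have [a a0 ->] := Gamma_free hF hpi hG hd htf hG0 hcc hg uh e.
by rewrite mul_scalar_mx vtxZ.
Qed.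

Lemma finite_seq_enum (T : choiceType) (S : set T) : finite_set S ->
  exists m (eps : 'I_m -> T), injective eps /\ forall x, S x <-> exists i, x = eps i.
Proof.
move=> /finite_seqP[s ->]; exists (size (undup s)), (tnth (in_tuple (undup s))); split.
  by apply/tuple_uniqP; exact: undup_uniq.
move=> x; split=> [xs|[i ->]].
  have : x \in in_tuple (undup s) by rewrite /= mem_undup.
  by move=> /tnthP.
by have := mem_tnth i (in_tuple (undup s)); rewrite mem_undup.
Qed.

(** The weights of the first three vertices of a line lie between 0 and 2, which is why level 2
    suffices. *)
Lemma congr2_inw s : GSp4 s -> mxin ord 2 (s - 1%:M) ->
  GSp1 s /\ forall k j, (j <= 2)%N -> inw (line_wt k j) s.
Proof.
move=> hs hs1; split.
  split=> //; suff /(GL4OP hF)[_ []] : GL4O s by [].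
  by apply: (GL4O_1P hF) => p q; apply: in_Pn_le (hs1 p q).
move=> k j hj p q; have := hs1 p q; rewrite mxBE mxE.
have [->|pq] := eqVneq p q.
  rewrite subrr => h; have -> : s q q = (s q q - 1%:R) + 1 by rewrite subrK.
  by apply: (in_PnD hF); [apply: in_Pn_le h|exact: in_Pn1].
rewrite subr0; apply: in_Pn_le.
have b0 t : 0 <= wt (line_wt k j) t <= 2.
  move: t; apply: ord4_ind; case: k => [b|]; rewrite ?wt_ax ?wt_hyp//;
  by move: hj; case: j => [|[|[|j]]] //; case: b.
by have := b0 p; have := b0 q; move: (wt _ p) (wt _ q); clear => *; lia.
Qed.

Definition edge_set (edge_kind : 'M[F]_4 -> option bool) i : set edge := [set std_edge (edge_kind g) i g | g in @GSp4 F].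

Lemma finite_edge_set edge_kind i : (i <= 1)%N -> (forall g s, GSp4 g -> GSp1 s -> edge_kind (g *m s) = edge_kind g) ->
  (forall g gam c, GSp4 g -> Gamma gam -> c != 0 -> edge_kind (c *: (gam *m g)) = edge_kind g) ->
  finite_set (edge_set edge_kind i).
Proof.
move=> i1 edge_kindM edge_kindG; have [S [hS hrep]] := Gamma_reps hF hG hcc (isT : (0 < 2)%N).
apply: (@sub_finite_set _ _ ((fun g => std_edge (edge_kind g) i g) @` [set` S])); last first.
  exact/finite_image/finite_seq.
move=> _ [g hg <-]; have [gam [r [s [z [hgam hr hs hs1 [z0 ->]]]]]] := hrep _ hg.
have hr4 := hS _ hr.
have [h1 hw] := congr2_inw hs hs1.
exists r => //=; rewrite -mulmxA edge_kindG//; last by apply: GSp4M.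
rewrite edge_kindM// std_edge_act//; last exact: GSp4M.
by rewrite std_edge_mulr//; apply: hw => //; apply: leq_trans i1 _.
Qed.

End Edges.

(** * Hecke operators *)

Section HeckeMatrix.
Variables (F : fieldType) (R : realType) (Gamma P : set 'M[F]_4) (d : 'M[F]_4).
Variables (X : choiceType) (first_edge : 'M[F]_4 -> X) (m : nat) (eps : 'I_m -> X) (A : 'M[R[i]]_m).
Hypotheses (eps_inj : injective eps)
  (first_edge_eq : forall g g', GSp4 g -> GSp4 g' -> first_edge g = first_edge g' ->
     exists gam p z, [/\ Gamma gam, P p, center z & g' = gam *m g *m (p *m z)])
  (first_edge_inv : forall gam g p z, Gamma gam -> GSp4 g -> P p -> center z ->
     GSp4 (gam *m g *m (p *m z)) /\ first_edge (gam *m g *m (p *m z)) = first_edge g)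
  (omega_ran : forall g, GSp4 g -> exists i, first_edge g = eps i)
  (eps_ran : forall i, exists2 g, GSp4 g & first_edge g = eps i)
  (rep_GSp4 : forall C, left_cosets (double_coset P d) P C -> GSp4 (xget 1%:M C))
  (count : forall i j g, GSp4 g -> first_edge g = eps i ->
     \sum_(C \in left_cosets (double_coset P d) P) ((first_edge (g *m xget 1%:M C) == eps j)%:R : R[i]) = A i j).

(** The hypotheses identify the fibres of [first_edge] with the double cosets of [Gamma] and P Z, so
    their indicator functions form a basis. Applying the operator to indicator j at a point of fibre
    i counts the cosets that lead to fibre j. *)
Lemma Hecke_det (p : {poly R[i]}) :
  is_det_1sub (automorphic Gamma P) (Hecke P d) p (\det (1%:M - p *: map_mx polyC A)).
Proof.
pose b (j : 'I_m) (g : 'M[F]_4) : R[i] := (`[< GSp4 g >] && (first_edge g == eps j))%:R.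
have bE j g i : GSp4 g -> first_edge g = eps i -> b j g = (i == j)%:R.
  by move=> hg e; rewrite /b (asboolT hg) e /= (inj_eq eps_inj).
have b0 j g : ~ GSp4 g -> b j g = 0 by move=> hg; rewrite /b (asboolF hg).
exists m, b, A; split=> //.
  split.
  - move=> j; split=> [g|gam g p' z hgam hg hp hz]; first exact: b0.
    have [h1 h2] := first_edge_inv hgam hg hp hz.
    by rewrite /b (asboolT h1) (asboolT hg) h2.
  - move=> c hc i; have [g hg e] := eps_ran i.
    have := hc g; rewrite (bigD1 i)//= (bE _ _ _ hg e) eqxx mulr1 big1 ?addr0// => j ji.
    by rewrite (bE _ _ _ hg e) eq_sym (negPf ji) mulr0.
  - move=> f [f0 fE]; have /choice[gi hgi] : forall i, exists g, GSp4 g /\ first_edge g = eps i.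
      by move=> i; have [g hg e] := eps_ran i; exists g.
    exists (fun i => f (gi i)) => g; have [hg|hg] := pselect (GSp4 g); last first.
      by rewrite f0// big1// => i _; rewrite b0// mulr0.
    have [i e] := omega_ran hg; have [h1 h2] := hgi i.
    rewrite (bigD1 i)//= (bE _ _ _ hg e) eqxx mulr1 big1 ?addr0.
      have [|gam [p' [z [hgam hp hz ->]]]] := first_edge_eq h1 hg; first by rewrite h2 e.
      exact: fE.
    by move=> j ji; rewrite (bE _ _ _ hg e) eq_sym (negPf ji) mulr0.
move=> j g; have [hg|hg] := pselect (GSp4 g); last first.
  rewrite [RHS]big1; last by move=> i _; rewrite b0// mulr0.
  rewrite /Hecke fsbig1// => C hC; apply: b0 => h; apply: hg.
  have hr := rep_GSp4 hC.
  by rewrite -(mulmxK (GSp4_unit hr) g); apply: GSp4M => //; exact: GSp4V.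
have [i e] := omega_ran hg.
rewrite [RHS](bigD1 i)//= (bE _ _ _ hg e) eqxx mulr1 [X in _ + X]big1 ?addr0.
  rewrite -(count j hg e) /Hecke; apply: eq_fsbigr => C; rewrite inE => hC.
  by rewrite /b asboolT//; apply: GSp4M => //; exact: rep_GSp4.
by move=> k ki; rewrite (bE _ _ _ hg e) eq_sym (negPf ki) mulr0.
Qed.

End HeckeMatrix.

Lemma fsum_unique (K : numDomainType) (I : choiceType) (S : set I) (p : I -> bool) : finite_set S ->
  (forall i j, S i -> S j -> p i -> p j -> i = j) ->
  \sum_(i \in S) ((p i)%:R : K) = (`[< exists2 i, S i & p i >])%:R.
Proof.
move=> fS hS; have [[i Si pi]|n] := pselect (exists2 i, S i & p i).
  rewrite (fsbigD1 i)// pi asboolT; last by exists i.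
  rewrite /= fsbig1 ?addr0// => j [Sj ji]; case: (boolP (p j)) => // pj.
  by case: ji; apply: hS.
rewrite (asboolF n) fsbig1// => j Sj; case: (boolP (p j)) => // pj.
by case: n; exists j.
Qed.

(** * Cosets in P d P / P as walks in the quotient *)

Section HeckeCounts.
Variables (F : fieldType) (ord : F -> int) (pi : F) (R : realType) (Gamma : set 'M[F]_4).
Hypotheses (hF : nonarch_local_field ord) (hpi : uniformizer ord pi).
Hypotheses (hG : is_subgroup Gamma) (hd : discrete ord Gamma)
  (htf : torsion_free_mod_center Gamma) (hG0 : Gamma `<=` G0 ord)
  (hcc : cocompact_mod_center ord Gamma).
Local Notation in_Pn := (in_Pn ord).
Local Notation unitO := (unitO ord).
Local Notation inw := (inw ord).
Local Notation GSp1 := (GSp1 ord).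
Local Notation td := (td pi).
Local Notation vtx := (vtx ord).
Local Notation even_simil := (even_simil ord).
Local Notation valid := (valid ord).
Implicit Types (g h s : 'M[F]_4) (k : option bool).
Local Notation std_edge := (std_edge ord pi Gamma).
Local Notation edge_step := (edge_step ord pi Gamma).

(* [ax] selects the edges along the axes of the apartments, which are those
   between a special and a non-special vertex; their stabilizers are conjugates
   of the Klingen subgroup, and the translation advances by two edges. *)
Definition parahoric (ax : bool) : set 'M[F]_4 := if ax then P2 ord else P1 ord.
Definition translation (ax : bool) : 'M[F]_4 := td (line_wt (if ax then Some true else None) ax.+1).
Definition edge_kind (ax : bool) g : option bool := if ax then Some (even_simil g) else None.

Lemma line_wt0 k : line_wt k 0 = 0.
Proof.
by apply/matrixP => i j; rewrite (ord1 i); move: j; apply: ord4_ind; case: k => [b|]; rewrite !mxE.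
Qed.

(** For axis edges the subgroup is the stabilizer of (0, 1, 1, 1), and duality makes it also that of
    (0, 0, 0, 1), so the parity [b] does not matter. *)
Lemma parahoric_stab k s : parahoric (isSome k) s <-> [/\ GSp1 s, inw (line_wt k 0) s & inw (line_wt k 1) s].
Proof.
case: k => [b|]; rewrite line_wt0; last exact: (P1E hF hpi s).
rewrite /parahoric /= (propext (P2E hF hpi s)).
have ewl : line_wt (Some true) 1 = wl by [].
rewrite /par -ewl; split=> -[h h0 h1]; split=> //; case: b h1 => // h1.
  exact: (ax_dual hF hpi (b := true) (i := 1) h h1).
exact: (ax_dual hF hpi (b := false) (i := 1) h h1).
Qed.

Lemma edge_kind_some ax g : isSome (edge_kind ax g) = ax. Proof. by case: ax. Qed.
Lemma edge_kind_valid ax g : valid (edge_kind ax g) g. Proof. by case: ax. Qed.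

Lemma parahoricP ax g s : parahoric ax s <-> [/\ GSp1 s, inw (line_wt (edge_kind ax g) 0) s & inw (line_wt (edge_kind ax g) 1) s].
Proof. by rewrite -(propext (parahoric_stab _ _)) edge_kind_some. Qed.

Lemma parahoric_GSp1 ax s : parahoric ax s -> GSp1 s.
Proof. by move=> /(parahoricP _ 1%:M)[]. Qed.

Lemma parahoricM ax s t : parahoric ax s -> parahoric ax t -> parahoric ax (s *m t).
Proof.
move=> /(parahoricP _ 1%:M)[h0 h1 h2] /(parahoricP _ 1%:M)[h0' h1' h2']; apply/(parahoricP _ 1%:M).
by split; [exact: (GSp1M hF)|exact: (inwM hF)|exact: (inwM hF)].
Qed.

Lemma parahoricV ax s : parahoric ax s -> parahoric ax (invmx s).
Proof.
move=> /(parahoricP _ 1%:M)[h0 h1 h2]; apply/(parahoricP _ 1%:M); have [_ u0] := h0.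
by split; [exact: (GSp1V hF)|exact: (inwV hF hpi)|exact: (inwV hF hpi)].
Qed.

Lemma parahoric1 ax : parahoric ax 1%:M.
Proof.
by apply/(parahoricP _ 1%:M); split; [exact: GSp1_1|exact: inw1|exact: inw1].
Qed.

Lemma edge_kindM ax g s : GSp4 g -> GSp1 s -> edge_kind ax (g *m s) = edge_kind ax g.
Proof.
case: ax => // hg hs; rewrite /edge_kind (evnM hF)//; last by case: hs.
by rewrite (evn_GSp1 hs); case: even_simil.
Qed.

Lemma edge_kindG ax g gam c : GSp4 g -> Gamma gam -> c != 0 -> edge_kind ax (c *: (gam *m g)) = edge_kind ax g.
Proof.
case: ax => // hg hgam c0; have h := Gamma_GSp4 hG hgam.
rewrite /edge_kind (evnZ hF)//; last exact: GSp4M.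
by rewrite (evnM hF)//; have [_] := hG0 hgam; rewrite /(even_simil _) => ->; case: (X in true == X).
Qed.

Lemma translation_GSp4 ax : GSp4 (translation ax).
Proof.
apply/GSp4P; exists (pi ^ (if ax then 2 else 1)); first exact: (pi_exp_neq0 hpi).
by apply: (td_simil hpi); case: ax; rewrite !wt_row4.
Qed.

Lemma edge_kind_translation ax g : GSp4 g -> edge_kind ax (g *m translation ax) = edge_kind ax g.
Proof.
case: ax => // hg; rewrite /edge_kind (evnM hF)//; last exact: translation_GSp4.
have hs : simil (pi ^ 2) (translation true) by apply: (td_simil hpi); rewrite !wt_row4.
by rewrite (evnE hF _ hs) ?(pi_exp_neq0 hpi)// (ord_pi_exp hF hpi); case: even_simil.
Qed.

Lemma translation_line k i : translation (isSome k) *m td (line_wt k i) = td (line_wt k ((isSome k).+1 + i)%N).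
Proof.
rewrite -(tdD hpi); congr td; rewrite [LHS]row4E [RHS]row4E; congr row4; rewrite -!/(wt _ _) wtD;
by case: k => [b|] /=; rewrite ?wt_ax ?wt_hyp ?wt_row4 /= ?negbK; clear; lia.
Qed.

Lemma translation_edge_kind ax g i : translation ax *m td (line_wt (edge_kind ax g) i) = td (line_wt (edge_kind ax g) (ax.+1 + i)%N).
Proof. by rewrite -[X in translation X](edge_kind_some ax g) translation_line edge_kind_some. Qed.

Lemma std_edge_translation ax g i : GSp4 g -> std_edge (edge_kind ax g) i (g *m translation ax) = std_edge (edge_kind ax g) (ax.+1 + i)%N g.
Proof. by move=> hg; rewrite /(std_edge _ _ _) -!mulmxA !translation_edge_kind addnS. Qed.

Definition first_edge ax g := std_edge (edge_kind ax g) 0 g.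

Local Notation cosets ax := (left_cosets (double_coset (parahoric ax) (translation ax)) (parahoric ax)).

Lemma coset_rep ax C : cosets ax C -> exists p q, [/\ parahoric ax p, parahoric ax q & xget 1%:M C = p *m translation ax *m q].
Proof.
move=> [_ [p [q [hp hq ->]]] eC].
have : C (xget 1%:M C).
  case: xgetP => [x _ //|/(_ (p *m translation ax *m q))[]].
  by rewrite eC; exists 1%:M; [exact: parahoric1|rewrite mulmx1].
rewrite {1}eC => -[x hx <-]; exists p, (q *m x); split=> //; first exact: parahoricM.
by rewrite mulmxA.
Qed.

Lemma coset_eq ax C x : cosets ax C -> C x -> C = [set x *m p | p in parahoric ax].
Proof.
move=> [a _ ->] [p hp <-]; have up := GSp1_unit (parahoric_GSp1 hp).
apply/seteqP; split=> _ [q hq <-].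
  by exists (invmx p *m q); [apply: parahoricM => //; exact: parahoricV|rewrite -!mulmxA mulKVmx].
by exists (p *m q); [exact: parahoricM|rewrite mulmxA].
Qed.

Lemma coset_xget ax C : cosets ax C -> C (xget 1%:M C).
Proof.
move=> [a ha ->]; case: xgetP => [x _ //|/(_ a)[]].
by exists 1%:M; [exact: parahoric1|rewrite mulmx1].
Qed.

Section Axis.
Variable ax : bool.
(** A choice of p in each coset C with C = p d P. For given g the line based at g p starts with the
    edge of g and reaches the edge of g p d after one step, or two along an axis. *)
Variable pp : set 'M[F]_4 -> 'M[F]_4.
Hypothesis hpp : forall C, cosets ax C ->
  exists q, [/\ parahoric ax (pp C), parahoric ax q & xget 1%:M C = pp C *m translation ax *m q].

Lemma pp_parahoric C : cosets ax C -> parahoric ax (pp C).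
Proof. by move=> /hpp[q []]. Qed.

Lemma rep_GSp4 C : cosets ax C -> GSp4 (xget 1%:M C).
Proof.
move=> /hpp[q [/parahoric_GSp1[hp _] /parahoric_GSp1[hq _] ->]].
by apply: GSp4M => //; apply: GSp4M => //; exact: translation_GSp4.
Qed.

Lemma pp_coset C : cosets ax C -> C = [set pp C *m translation ax *m p | p in parahoric ax].
Proof.
move=> hC; apply: (coset_eq hC); have [q [hp hq e]] := hpp hC.
suff : [set xget 1%:M C *m p | p in parahoric ax] (pp C *m translation ax).
  by rewrite -(coset_eq hC (coset_xget hC)).
exists (invmx q); first exact: parahoricV.
have uq := GSp1_unit (parahoric_GSp1 hq).
by rewrite e -mulmxA mulmxV ?mulmx1.
Qed.

Lemma gpp_GSp4 g C : GSp4 g -> cosets ax C -> GSp4 (g *m pp C) /\ edge_kind ax (g *m pp C) = edge_kind ax g.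
Proof.
move=> hg /pp_parahoric/parahoric_GSp1 h; split; last exact: edge_kindM.
by apply: GSp4M => //; case: h.
Qed.

Lemma std_edge_parahoric g s : GSp4 g -> parahoric ax s -> std_edge (edge_kind ax g) 0 (g *m s) = std_edge (edge_kind ax g) 0 g.
Proof. by move=> hg /(parahoricP _ g)[h1 h2 h3]; exact: (std_edge_mulr hF hpi hG). Qed.

Lemma coset_chain g C : GSp4 g -> cosets ax C ->
  std_edge (edge_kind ax g) ax.+1 (g *m pp C) = first_edge ax (g *m xget 1%:M C).
Proof.
move=> hg hC; have [q [hp hq ->]] := hpp hC; have [h1 h2] := gpp_GSp4 hg hC.
have h3 := translation_GSp4 ax.
have h4 : GSp4 (g *m pp C *m translation ax) by exact: GSp4M.
rewrite /first_edge !mulmxA (edge_kindM _ h4 (parahoric_GSp1 hq)) (std_edge_parahoric h4 hq) edge_kind_translation// h2.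
by rewrite -h2 std_edge_translation// addn0.
Qed.

(** Here freeness enters. The two lifted paths start with the same edge; an element of [Gamma]
    matching the next edges fixes their common vertex, hence every vertex, so the paths agree in X.
    Stabilizing the last edge then means differing by P. *)
Lemma coset_chain_inj g C C' : GSp4 g -> cosets ax C -> cosets ax C' ->
  (forall i, (0 < i <= ax.+1)%N -> std_edge (edge_kind ax g) i (g *m pp C) = std_edge (edge_kind ax g) i (g *m pp C')) -> C = C'.
Proof.
move=> hg hC hC' he.
have [g1 _] := gpp_GSp4 hg hC; have [g1' _] := gpp_GSp4 hg hC'.
have vE i : (i <= ax.+2)%N ->
    vtx (g *m pp C *m td (line_wt (edge_kind ax g) i)) = vtx (g *m pp C' *m td (line_wt (edge_kind ax g) i)).
  have ug := GSp4_unit hg.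
  elim: i => [_|i IH hi].
    have /(parahoricP _ g)[[_ u1] h2 h3] := pp_parahoric hC; have /(parahoricP _ g)[[_ u1'] h2' h3'] := pp_parahoric hC'.
    by rewrite !(vtx_stab hF hpi).
  case: i hi IH => [_ _|i hi IH].
    have /(parahoricP _ g)[[_ u1] h2 h3] := pp_parahoric hC; have /(parahoricP _ g)[[_ u1'] h2' h3'] := pp_parahoric hC'.
    by rewrite !(vtx_stab hF hpi).
  have /edge_orbitP-/(_ hG)[gam [hgam e1 e2]] := he i.+1 hi.
  rewrite e2 vtx_act; apply/esym/(vtx_free hF hpi hG hd htf hG0 hcc hgam (h := g *m pp C *m td (line_wt (edge_kind ax g) i.+1))).
    by rewrite unitmx_mul (GSp4_unit g1) (td_unit hpi).
  by rewrite -vtx_act -e1 IH// ltnW.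
have e0 := vE ax.+1 (leqnSn _); have e1 := vE ax.+2 (leqnn _).
have f0 := translation_edge_kind ax g 0; have f1 := translation_edge_kind ax g 1; rewrite addn0 in f0; rewrite addn1 in f1.
move: e0 e1; rewrite -f0 -f1 !mulmxA => e0 e1.
have hd4 := translation_GSp4 ax.
have [c [s [c0 hs s0 s1 e]]] := edge_eq_inw hF hpi (GSp4M g1 hd4) (GSp4M g1' hd4) e0 e1.
have hsP : parahoric ax s by apply/(parahoricP _ g).
have e' : pp C' *m translation ax = pp C *m translation ax *m (c *: s).
  by apply: (can_inj (mulKmx (GSp4_unit hg))); rewrite !mulmxA e -scalemxAr.
have [hp _] := parahoric_GSp1 (pp_parahoric hC); have [hp' _] := parahoric_GSp1 (pp_parahoric hC').
have hcs : parahoric ax (c *: s).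
  (* Both sides of [e'] have determinants of the same order, apart from the factor c^4. *)
  have oc : unitO c.
    split=> //; have := congr1 (fun M => ord (\det M)) e'.
    have nz M : GSp4 M -> \det M != 0 by move=> /GSp4_unit; rewrite unitmxE unitfE.
    rewrite -scalemxAr (ord_detZ hF)//; last first.
      by rewrite !unitmx_mul (GSp4_unit hp) (GSp4_unit hd4) (GSp4_unit (proj1 hs)).
    rewrite !det_mulmx !(ordMn0 hF) ?mulf_neq0 ?nz//; last by case: hs.
    have [_ [_ ->]] := parahoric_GSp1 (pp_parahoric hC); have [_ [_ ->]] := parahoric_GSp1 (pp_parahoric hC').
    have [_ [_ ->]] := hs; move: (ord c) (ord _) => x y; clear; lia.
  apply/(parahoricP _ g); move/(parahoricP _ g): hsP => [h1 h2 h3].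
  have sc a t : inw a t -> inw a (c *: t).
    move=> h i j; rewrite mxE -[X in in_Pn X]add0r; have [_ o] := oc.
    by apply: (in_PnM hF) (h i j); rewrite /Defs.in_Pn o lexx orbT.
  split; [|exact: sc|exact: sc].
  split; first by apply: GSp4Z => //; case: h1.
  have us := GSp1_unit h1.
  split; first by rewrite detZ mulf_neq0 ?expf_neq0// -unitfE -unitmxE.
  by rewrite (ord_detZ hF)//; have [_ ->] := oc; have [_ [_ ->]] := h1; rewrite mul0rn.
rewrite (pp_coset hC); apply/esym/coset_eq => //.
by rewrite (pp_coset hC'); exists (invmx (c *: s)); [exact: parahoricV|rewrite e' mulmxK//; exact: GSp1_unit (parahoric_GSp1 hcs)].
Qed.

(** A walk lifts to a line by gluing. Its first edge is that of [g], so the base is g s up to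
    [Gamma] and scalars with s in P, and the coset is that of s d; it remains to see that replacing
    s by the chosen representative does not change the edges. *)
Lemma coset_chain_surj g (es : nat -> set (set (set 'cV[F]_4) * set (set 'cV[F]_4))) :
  GSp4 g -> es 0%N = first_edge ax g ->
  (forall i, (i < ax.+1)%N -> edge_step (es i) (es i.+1)) ->
  exists2 C, cosets ax C & forall i, (i <= ax.+1)%N -> es i = std_edge (edge_kind ax g) i (g *m pp C).
Proof.
move=> hg e0 ht; set k := edge_kind ax g.
have [g' [hg' hv' he]] : exists g', [/\ GSp4 g', valid k g' & forall i, (i <= ax.+1)%N -> es i = std_edge k i g'].
  elim: ax.+1 ht => [|n IH] ht.
    by exists g; split=> //; [exact: edge_kind_valid|move=> i; rewrite leqn0 => /eqP ->].
  have [|g1 [hg1 hv1 he1]] := IH; first by move=> i hi; apply: ht; exact: ltnW.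
  have [h [hh hvh eh1 eh2]] := edge_step_phase hF hpi hG hG0 (ht n (ltnSn n)) hg1 hv1 (he1 n (leqnn n)).
  have [|g2 [hg2 hv2 e1 e2]] := @std_edge_chain _ _ _ _ hF hpi hG k n g1 h hg1 hh hv1.
    by rewrite -eh1 -he1.
  exists g2; split=> // i; rewrite leq_eqVlt => /orP[/eqP ->|]; first by rewrite e2.
  by rewrite ltnS => hi; rewrite (e1 _ hi) (he1 _ hi).
have := he 0%N isT; rewrite e0 => /(std_edgeP hF hpi hG _ _ hg hg')[gam [c [s [hgam c0 hs [h0 h1] eg']]]].
have hsP : parahoric ax s by apply/(parahoricP _ g).
pose C := [set s *m translation ax *m p | p in parahoric ax].
have hC : cosets ax C.
  exists (s *m translation ax) => //; exists s, 1%:M; split=> //; [exact: parahoric1|by rewrite mulmx1].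
exists C => // i hi; rewrite he// eg' -mulmxA (std_edge_act hF hpi hG)//; last first.
  by apply: GSp4M => //; case: hs.
have : C (pp C *m translation ax).
  by rewrite {1}(pp_coset hC); exists 1%:M; [exact: parahoric1|rewrite mulmx1].
move=> [x hx ex].
have us := GSp1_unit hs; have hpC := pp_parahoric hC; have hp1 := parahoric_GSp1 hpC.
have [u uE] : exists u, u = invmx s *m pp C by eexists.
have hu : parahoric ax u by rewrite uE; apply: parahoricM => //; exact: parahoricV.
have hu1 := parahoric_GSp1 hu.
have eu : u *m translation ax = translation ax *m x by rewrite uE -mulmxA -ex -!mulmxA mulKmx.
(* Membership of [u] in P covers the indices 0 and 1, and that of its conjugate [x] the indices ax +
   1 and ax + 2; together these are all indices. *)
have hw j : (j <= ax.+2)%N -> inw (line_wt k j) u.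
  have [c0' c1] : inw (line_wt k 0) u /\ inw (line_wt k 1) u by move/(parahoricP _ g): hu => [].
  have tr' j' : inw (line_wt k j') x -> inw (line_wt k (ax.+1 + j')) u.
    move=> /(inwE hF hpi) h; apply/(inwE hF hpi); rewrite -translation_edge_kind.
    rewrite invmxM ?(td_unit hpi) ?(GSp4_unit (translation_GSp4 ax))//.
    by rewrite -!mulmxA (mulmxA u) eu -!mulmxA mulKmx ?(GSp4_unit (translation_GSp4 ax))// mulmxA.
  move/(parahoricP _ g): hx => [_ x0 x1].
  move: (tr' 0%N x0) (tr' 1%N x1); rewrite addn0 addn1.
  by case: (ax) => y0 y1; case: j => [|[|[|[|j]]]].
have -> : g *m pp C = g *m s *m u by rewrite uE -mulmxA mulKVmx.
apply/esym/(std_edge_mulr hF hpi hG) => //; first by apply: GSp4M => //; case: hs.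
  by apply: hw; apply: leqW.
exact: hw.
Qed.

Lemma coset_chain_step g C i : GSp4 g -> cosets ax C ->
  edge_step (std_edge (edge_kind ax g) i (g *m pp C)) (std_edge (edge_kind ax g) i.+1 (g *m pp C)).
Proof.
move=> hg hC; have [h1 h2] := gpp_GSp4 hg hC.
by apply/asboolP; exists (g *m pp C), (edge_kind ax g), i; split=> //; rewrite -h2; exact: edge_kind_valid.
Qed.

Lemma finite_edge_kind_set i : (i <= 1)%N -> finite_set (edge_set ord pi Gamma (edge_kind ax) i).
Proof.
move=> hi; apply: (finite_edge_set hF hpi hG hcc hi) => [g s|g gam c].
  exact: edge_kindM.
exact: edge_kindG.
Qed.

(** A coset is determined by its walk from the identity, and X_Gamma has finitely many edges. *)
Lemma finite_cosets : finite_set (cosets ax).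
Proof.
have h1 : GSp4 (1%:M : 'M[F]_4) := GSp4_1 F.
pose f C := (std_edge (edge_kind ax 1%:M) 1 (1%:M *m pp C), std_edge (edge_kind ax 1%:M) ax.+1 (1%:M *m pp C)).
have fC : {in cosets ax &, injective f}.
  move=> C C'; rewrite !inE => hC hC' [e1 e2]; apply: (coset_chain_inj h1 hC hC').
  case=> [//|[_|i hi]]; first exact: e1.
  have hax : ax.+1 = i.+2 by move: hi; case: (ax); case: (i).
  by rewrite -hax.
rewrite -(eq_finite_set (inj_card_eq fC)).
apply: (@sub_finite_set _ _ (edge_set ord pi Gamma (edge_kind ax) 1 `*` edge_set ord pi Gamma (edge_kind ax) 0)).
  move=> _ [C hC <-]; have [hC1 hC2] := gpp_GSp4 h1 hC; split=> /=.
    by exists (1%:M *m pp C); [exact: hC1|rewrite hC2].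
  rewrite coset_chain//; exists (1%:M *m xget 1%:M C); last by [].
  by rewrite mul1mx; exact: rep_GSp4.
by apply: finite_setX; exact: finite_edge_kind_set.
Qed.

End Axis.

End HeckeCounts.

(** * The Hecke operators as transition matrices *)

Section HeckeDet.
Variables (F : fieldType) (ord : F -> int) (pi : F) (R : realType) (Gamma : set 'M[F]_4).
Hypotheses (hF : nonarch_local_field ord) (hpi : uniformizer ord pi).
Hypotheses (hG : is_subgroup Gamma) (hd : discrete ord Gamma)
  (htf : torsion_free_mod_center Gamma) (hG0 : Gamma `<=` G0 ord)
  (hcc : cocompact_mod_center ord Gamma).
Implicit Types (g h s : 'M[F]_4) (k : option bool).
Local Notation valid := (valid ord).
Local Notation std_edge := (std_edge ord pi Gamma).
Local Notation edge_step := (edge_step ord pi Gamma).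
Local Notation parahoric := (parahoric ord).
Local Notation translation := (translation pi).
Local Notation edge_kind := (edge_kind ord).
Local Notation first_edge := (first_edge ord pi Gamma).
Local Notation edge_set ax i := (edge_set ord pi Gamma (edge_kind ax) i).
Local Notation cosets ax := (left_cosets (double_coset (parahoric ax) (translation ax)) (parahoric ax)).
Local Notation edge := (set (set (set 'cV[F]_4) * set (set 'cV[F]_4))).

Lemma first_edge_eq ax g g' : GSp4 g -> GSp4 g' -> first_edge ax g = first_edge ax g' ->
  exists gam p z, [/\ Gamma gam, parahoric ax p, center z & g' = gam *m g *m (p *m z)].
Proof.
move=> hg hg' e; have [ek _] := std_edge_phase hF hpi hG hG0 hg hg' (edge_kind_valid _ ax g) (edge_kind_valid _ ax g') e.
move: e; rewrite /first_edge -ek => /(std_edgeP hF hpi hG _ _ hg hg')[gam [c [s [hgam c0 hs [h0 h1] ->]]]].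
exists gam, s, c%:M; split=> //; first exact/(parahoricP hF hpi _ g).
  by exists c.
by rewrite mul_mx_scalar -scalemxAr.
Qed.

Lemma first_edge_inv ax gam g p z : Gamma gam -> GSp4 g -> parahoric ax p -> center z ->
  GSp4 (gam *m g *m (p *m z)) /\ first_edge ax (gam *m g *m (p *m z)) = first_edge ax g.
Proof.
move=> hgam hg hp [c c0 ->]; rewrite mul_mx_scalar -scalemxAr -mulmxA.
have [hp4 _] := parahoric_GSp1 hF hpi hp; have hgp := GSp4M hg hp4.
split; first by apply: GSp4Z => //; apply: GSp4M => //; exact: Gamma_GSp4 hG _ hgam.
rewrite /first_edge (edge_kindG hF hG hG0)// (std_edge_act hF hpi hG)// (edge_kindM hF)//; last exact: (parahoric_GSp1 hF hpi hp).
exact: (std_edge_parahoric hF hpi hG).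
Qed.

Lemma edge_set_disjoint ax ax' i i' e : (i <= 1)%N -> (i' <= 1)%N -> edge_set ax i e -> edge_set ax' i' e ->
  ax = ax' /\ (ax -> i = i').
Proof.
move=> hi hi' [g hg <-] [g' hg' /esym ee].
have [ek ph] := std_edge_phase hF hpi hG hG0 hg hg' (edge_kind_valid _ ax g) (edge_kind_valid _ ax' g') ee.
have eax : ax = ax' by rewrite -(edge_kind_some ord ax g) ek edge_kind_some.
split=> // axt; move: ph; rewrite axt /=.
by move: hi hi'; case: i i' {ee} => [|[|i]] [|[|i']].
Qed.

Lemma std_edge_in_set k i g : GSp4 g -> valid k g ->
  edge_set (isSome k) (if k is Some _ then odd i else 0%N) (std_edge k i g).
Proof.
move=> hg hv; have [|h [hh hvh <- _]] := @std_edge_shift _ _ _ Gamma hF hpi k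
  (if k is Some _ then nat_of_bool (odd i) else 0%N) i g hg hv.
  by case: (k) => //= _; case: (odd i).
have ek : edge_kind (isSome k) h = k by case: (k) hvh => //= b ->.
by exists h; [exact: hh|rewrite ek].
Qed.

Lemma edge_step_in_set ax i e e' : (i <= 1)%N -> edge_step e e' -> edge_set ax i e ->
  edge_set ax (if ax then 1 - i else 0)%N e'.
Proof.
move=> hi htr [g hg /esym ee].
have [h [hh hvh _ ->]] := edge_step_phase hF hpi hG hG0 htr hg (edge_kind_valid _ ax g) ee.
have := std_edge_in_set i.+1 hh hvh; rewrite edge_kind_some.
by case: ax {ee hvh} => //; move: hi; case: i => [|[|i]].
Qed.

Section Count.
Variables (m : nat) (ax : bool) (eps : 'I_m -> edge).
Hypotheses (eps_inj : injective eps) (eps_ran : forall x, edge_set ax 0 x <-> exists i, x = eps i).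
Variable A : 'M[R[i]]_m.
Hypothesis count : forall pp, (forall C, cosets ax C ->
    exists q, [/\ parahoric ax (pp C), parahoric ax q & xget 1%:M C = pp C *m translation ax *m q]) ->
  forall i j g, GSp4 g -> first_edge ax g = eps i ->
  \sum_(C \in cosets ax) ((first_edge ax (g *m xget 1%:M C) == eps j)%:R : R[i]) = A i j.

Lemma Hecke_det_count (p : {poly R[i]}) :
  is_det_1sub (automorphic Gamma (parahoric ax)) (Hecke (parahoric ax) (translation ax)) p
    (\det (1%:M - p *: map_mx polyC A)).
Proof.
have /choice[pp hpp] : forall C, exists p, cosets ax C ->
    exists q, [/\ parahoric ax p, parahoric ax q & xget 1%:M C = p *m translation ax *m q].
  move=> C; have [hC|n] := pselect (cosets ax C); last by exists 1%:M.
  by have [p0 [q hq]] := coset_rep hF hpi hC; exists p0 => _; exists q.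
apply: (Hecke_det eps_inj (@first_edge_eq ax) (@first_edge_inv ax)).
- by move=> g hg; apply/eps_ran; exists g.
- by move=> i; have [g hg e] := proj2 (eps_ran _) (ex_intro _ i erefl); exists g.
- by move=> C hC; exact: (rep_GSp4 hF hpi hpp hC).
- by move=> i j g hg e; exact: (count hpp).
Qed.

End Count.

Lemma Hecke_det1 m (eps : 'I_m -> edge) (p : {poly R[i]}) : injective eps ->
  (forall x, edge_set false 0 x <-> exists i, x = eps i) ->
  is_det_1sub (automorphic Gamma (parahoric false)) (Hecke (parahoric false) (translation false)) p
    (\det (1%:M - p *: map_mx polyC (\matrix_(i, j) ((edge_step (eps i) (eps j))%:R : R[i])))).
Proof.
move=> eps_inj eps_ran; apply: (Hecke_det_count eps_inj eps_ran) => pp hpp i j g hg eg.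
have fC := finite_cosets hF hpi hG hd htf hG0 hcc hpp.
rewrite mxE fsum_unique//; last first.
  move=> C C' hC hC' /eqP e /eqP e'; apply: (coset_chain_inj hF hpi hG hd htf hG0 hcc hpp hg hC hC').
  case=> [|[|l]] // _; rewrite (coset_chain hF hpi hG hpp hg hC) (coset_chain hF hpi hG hpp hg hC').
  by rewrite e e'.
congr ((_ : bool)%:R); apply/asboolP/idP => [[C hC /eqP e]|ht].
  have := coset_chain_step Gamma hF hpi hpp 0 hg hC.
  rewrite (coset_chain hF hpi hG hpp hg hC) e (std_edge_parahoric hF hpi hG hg (pp_parahoric hpp hC)).
  by rewrite -/(first_edge false g) eg.
have [||C hC he] := coset_chain_surj hF hpi hG hG0 hpp (es := fun l => if l is 0%N then eps i else eps j) hg.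
- by rewrite eg.
- by case.
by exists C => //; rewrite (he 1%N isT) -(coset_chain hF hpi hG hpp hg hC).
Qed.

Lemma Hecke_det2 m n (eps : 'I_m -> edge) (eps' : 'I_n -> edge) (p : {poly R[i]}) :
  injective eps -> injective eps' ->
  (forall x, edge_set true 0 x <-> exists i, x = eps i) ->
  (forall x, edge_set true 1 x <-> exists i, x = eps' i) ->
  is_det_1sub (automorphic Gamma (parahoric true)) (Hecke (parahoric true) (translation true)) p
    (\det (1%:M - p *: map_mx polyC ((\matrix_(i, k) ((edge_step (eps i) (eps' k))%:R : R[i])) *m
                                     (\matrix_(k, j) ((edge_step (eps' k) (eps j))%:R : R[i]))))).
Proof.
move=> eps_inj eps_inj' eps_ran eps_ran'; apply: (Hecke_det_count eps_inj eps_ran) => pp hpp i j g hg eg.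
have fC := finite_cosets hF hpi hG hd htf hG0 hcc hpp.
pose mid C := std_edge (edge_kind true g) 1 (g *m pp C).
pose w C := first_edge true (g *m xget 1%:M C).
(* The cosets are sorted by the middle edge of their walk; given the middle and the last edge there
   is at most one coset, so each term is a product of 0-1 entries of the two matrices. *)
transitivity (\sum_(C \in cosets true) \sum_k ((((mid C == eps' k) && (w C == eps j)) : bool)%:R : R[i])).
  apply: eq_fsbigr => C; rewrite inE => hC.
  have [h1 h2] := gpp_GSp4 hF hpi hpp hg hC.
  have /eps_ran'[k0 ek] : edge_set true 1 (mid C) by exists (g *m pp C) => //; rewrite h2.
  rewrite (bigD1 k0)//= ek eqxx big1 ?addr0// => k kk.
  by rewrite (inj_eq eps_inj') eq_sym (negPf kk).
rewrite fsbig_finite//= exchange_big mxE /=; apply: eq_bigr => k _.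
rewrite -(fsbig_finite _ (fun C => ((((mid C == eps' k) && (w C == eps j)) : bool)%:R : R[i])))//=.
rewrite fsum_unique//; last first.
  move=> C C' hC hC' /andP[/eqP m1 /eqP w1] /andP[/eqP m2 /eqP w2].
  apply: (coset_chain_inj hF hpi hG hd htf hG0 hcc hpp hg hC hC').
  case=> [|[|[|l]]] // _; first by rewrite -/(mid C) -/(mid C') m1 m2.
  rewrite (coset_chain hF hpi hG hpp hg hC) (coset_chain hF hpi hG hpp hg hC').
  by rewrite -/(w C) -/(w C') w1 w2.
rewrite !mxE -natrM mulnb; congr ((_ : bool)%:R); apply/asboolP/andP => [[C hC /andP[/eqP e1 /eqP e2]]|[ht1 ht2]].
  have := coset_chain_step Gamma hF hpi hpp 0 hg hC.
  have := coset_chain_step Gamma hF hpi hpp 1 hg hC.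
  rewrite (coset_chain hF hpi hG hpp hg hC) (std_edge_parahoric hF hpi hG hg (pp_parahoric hpp hC)).
  by rewrite -/(first_edge true g) eg -/(mid C) -/(w C) e1 e2.
have [||C hC he] := coset_chain_surj hF hpi hG hG0 hpp
    (es := fun l => if l is l'.+1 then (if l' is 0%N then eps' k else eps j) else eps i) hg.
- by rewrite eg.
- by case=> [|[|l]].
exists C => //; rewrite /mid -(he 1%N isT) eqxx /w -(coset_chain hF hpi hG hpp hg hC).
by rewrite -(he 2%N isT) eqxx.
Qed.

End HeckeDet.

(** * Determinants of block matrices *)

Lemma det_block_1 (K : comNzRingType) m n (B : 'M[K]_(m, n)) (C : 'M[K]_(n, m)) :
  \det (block_mx 1%:M B C 1%:M) = \det (1%:M - B *m C).
Proof.
have := congr1 determinant (mulmx_block 1%:M (- B) 0 1%:M 1%:M B C 1%:M).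
rewrite !mul1mx !mul0mx !mulmx1 !add0r addrN det_mulmx det_ublock det_lblock !det1 !mul1r mulr1.
by rewrite mulNmx.
Qed.

Lemma det_1sub_block (K : comNzRingType) m n l (A : 'M[K]_m) (X : 'M[K]_(n, l)) (Y : 'M[K]_(l, n)) :
  \det (1%:M - 'X *: map_mx polyC (block_mx A 0 0 (block_mx 0 X Y 0))) =
  \det (1%:M - 'X *: map_mx polyC A) * \det (1%:M - 'X^2 *: map_mx polyC (X *m Y)).
Proof.
rewrite !map_block_mx !raddf0 !scale_block_mx !scaler0 !scalar_mx_block !opp_block_mx !add_block_mx.
rewrite !oppr0 !addr0 !add0r det_ublock det_block_1; congr (_ * \det (_ - _)).
by rewrite mulNmx mulmxN opprK -scalemxAl -scalemxAr scalerA map_mxM expr2.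
Qed.

(** * Prime cycles *)

Section PrimeClasses.
Variables (F : fieldType) (ord : F -> int) (pi : F) (R : realType) (Gamma : set 'M[F]_4).
Hypotheses (hF : nonarch_local_field ord) (hpi : uniformizer ord pi).
Hypotheses (hG : is_subgroup Gamma) (hG0 : Gamma `<=` G0 ord).
Local Notation std_edge := (std_edge ord pi Gamma).
Local Notation edge_step := (edge_step ord pi Gamma).
Local Notation vtx := (vtx ord).
Local Notation td := (td pi).
Local Notation edge := (set (set (set 'cV[F]_4) * set (set 'cV[F]_4))).
Implicit Types (c : seq edge).

Lemma edge_step_target e e' : edge_step e e' -> target e = source e'.
Proof.
move=> /asboolP[g [k [i [_ _ -> ->]]]].
by rewrite /target /source /edge_orbit !image_comp.
Qed.

(** One step changes the order of the determinant by 2 along a diagonal and by an odd number along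
    an axis, never by a multiple of 4. *)
Lemma std_edge_no_loop k i g : GSp4 g -> target (std_edge k i g) <> source (std_edge k i g).
Proof.
move=> hg e; have : source (std_edge k i g) (vtx (g *m td (line_wt k i.+1))).
  rewrite -e; exists (vtx (g *m td (line_wt k i)), vtx (g *m td (line_wt k i.+1))) => //.
  exists 1%:M; first exact: Gamma1.
  by rewrite !vtx_act !mul1mx.
move=> [_ [gam hgam <-] /=]; rewrite vtx_act mulmxA.
have ug := GSp4_unit hg; have um := Gamma_unit hG hgam.
move=> /(vtx_det hF); rewrite !unitmx_mul um ug !(td_unit hpi) => /(_ isT isT)[m].
have [_ /dvdzP[q hq]] := hG0 hgam.
have nz (A : 'M[F]_4) : A \in unitmx -> \det A != 0 by rewrite unitmxE unitfE.
rewrite !(ord_det_td hF hpi) ?unitmx_mul ?um ?ug// det_mulmx (ordMn0 hF) ?nz// hq.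
clear; move: (ord _) => d; case: k => [b|]; rewrite ?wt_ax ?wt_hyp /=.
  have e := odd_double_half i; rewrite uphalf_half; case: b; move: e; case: (odd i) => /= e; lia.
lia.
Qed.

Lemma cycleP (T : eqType) (e : rel T) (x0 : T) (c : seq T) : c <> [::] ->
  (cycle e c <-> forall k, (k < size c)%N -> e (nth x0 c k) (nth x0 c (k.+1 %% size c)%N)).
Proof.
case: c => // x s _; rewrite /cycle.
have nE k : (k < (size s).+1)%N -> nth x0 (x :: rcons s x) k = nth x0 (x :: s) k /\
    nth x0 (rcons s x) k = nth x0 (x :: s) (k.+1 %% (size s).+1)%N.
  move=> hk; split.
    by case: k hk => // k hk /=; rewrite nth_rcons -ltnS hk.
  rewrite nth_rcons; case: ltnP => h; first by rewrite modn_small.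
  have -> : k = size s by apply/eqP; rewrite eqn_leq h -ltnS hk.
  by rewrite eqxx modnn.
split=> [/(pathP x0) h k hk|h].
  by have [<- <-] := nE k hk; apply: h; rewrite size_rcons.
by apply/(pathP x0) => k; rewrite size_rcons => hk; have [-> ->] := nE k hk; exact: h.
Qed.

Lemma nth_rot_01 (T : Type) (x0 : T) (c : seq T) k : (k < size c)%N -> (1 < size c)%N ->
  nth x0 (rot k c) 0 = nth x0 c k /\ nth x0 (rot k c) 1 = nth x0 c (k.+1 %% size c)%N.
Proof.
move=> hk h1; rewrite /rot (drop_nth x0 hk) /=; split=> //.
have [h|h] := ltnP k.+1 (size c); first by rewrite (drop_nth x0 h) modn_small.
have e : k.+1 = size c by apply/eqP; rewrite eqn_leq h hk.
rewrite (drop_oversize h) /= e modnn nth_take//.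
by rewrite -ltnS e.
Qed.

Lemma geodesic_cycle_edge_step c : c <> [::] -> cycle edge_step c -> geodesic_cycle ord pi R Gamma c.
Proof.
move=> c0 hc; have n0 : (0 < size c)%N by rewrite lt0n size_eq0; apply/eqP.
have ht := proj1 (cycleP edge_step set0 c0) hc.
pose es i := nth set0 c (i %% size c).
have [|g [k [i0 [hg hv he]]]] := edge_step_chain hF hpi hG hG0 (es := es) (n := size c) _ n0.
  by move=> i hi; have := ht i hi; rewrite /es (modn_small hi).
have ce i : (i < size c)%N -> nth set0 c i = std_edge k (i0 + i) g.
  by move=> hi; rewrite -(he i (ltnW hi)) /es (modn_small hi).
split.
  split=> // [e /(nthP set0)[i hi <-]|].
    rewrite (ce i hi); exists (vtx (g *m td (line_wt k (i0 + i)%N))), (vtx (g *m td (line_wt k (i0 + i.+1)%N))).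
    by rewrite addnS; split; [exact: std_adjacent|].
  apply/(cycleP _ set0 c0) => i hi; apply/asboolP/edge_step_target; exact: ht.
exists (fun i => vtx (g *m td (line_wt k (i0 + i)%N))); first exact: std_geodesic.
by move=> i hi; rewrite (ce i hi) addnS.
Qed.

Lemma tailless_edge_step c : tailless ord pi R Gamma c -> cycle edge_step c.
Proof.
move=> ht; have := ht 0%N; rewrite rot0 => -[[c0 _ cc] [v gv ce]].
have n0 : (0 < size c)%N by rewrite lt0n size_eq0; apply/eqP.
(* A cycle of length one would be a loop. Its rotations show no pair of successive edges, so it must
   be excluded separately. *)
have [h1|h1] := leqP (size c) 1.
  have [g [k [i0 [hg _ hv]]]] := geodesic_std hF hpi n0 gv.
  have e1 : size c = 1%N by apply/eqP; rewrite eqn_leq h1.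
  have := proj1 (cycleP _ set0 c0) cc 0%N n0.
  rewrite e1 modnn (ce 0%N n0) (hv 0%N isT) (hv 1%N n0) addn0 addn1 => /asboolP.
  by move=> /(@std_edge_no_loop k i0 g hg).
apply/(cycleP _ set0 c0) => j hj.
(* Rotating by j brings the edges j and j + 1 (cyclically) to the front, where they are the first
   two edges of a straight path. *)
have [_ [u gu ue]] := ht j; rewrite size_rot in gu ue.
have [g [k [i0 [hg hvv hu]]]] := geodesic_std hF hpi n0 gu.
have [<- <-] := nth_rot_01 set0 hj h1.
apply/asboolP; exists g, k, i0; split=> //.
  by rewrite (ue 0%N n0) (hu 0%N isT) (hu 1%N n0) addn0 addn1.
by rewrite (ue 1%N h1) (hu 1%N n0) (hu 2%N h1) addn1 addn2.
Qed.

Lemma prime_classesE : prime_classes ord pi R Gamma = prime_cycles edge_step.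
Proof.
apply/seteqP; split=> _ [c hc <-]; exists c => //.
  by have [[[c0 _ _] _] [ht hp]] := hc; split=> //; exact: tailless_edge_step.
have [c0 cc pc] := hc; split; first exact: geodesic_cycle_edge_step.
split=> // j; apply: geodesic_cycle_edge_step; last by rewrite rot_cycle.
by move=> e; apply: c0; apply: size0nil; rewrite -(size_rot j) e.
Qed.

End PrimeClasses.

(** * Assembling the determinant formula *)

Lemma translation_false (F : fieldType) (pi : F) : translation pi false = diag4 1 1 pi pi.
Proof.
congr diag_mx; apply/matrixP => i j; rewrite (ord1 i); move: j; apply: ord4_ind;
by rewrite !mxE /= ?expr0z ?expr1z.
Qed.

Lemma translation_true (F : fieldType) (pi : F) : translation pi true = diag4 1 pi pi (pi ^+ 2).
Proof.
congr diag_mx; apply/matrixP => i j; rewrite (ord1 i); move: j; apply: ord4_ind;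
by rewrite !mxE /= ?expr0z ?expr1z.
Qed.

Theorem theorem4p1 (R : realType) (F : fieldType) (ord : F -> int) (pi : F)
    (Gamma : set 'M[F]_4) :
  nonarch_local_field ord ->
  uniformizer ord pi ->
  is_subgroup Gamma ->
  discrete ord Gamma ->
  torsion_free_mod_center Gamma ->
  Gamma `<=` G0 ord ->
  cocompact_mod_center ord Gamma ->
  exists (Z : nat -> R[i]) (D1 D2 : {poly R[i]}),
    [/\ is_zeta ord pi Gamma Z,
        is_det_1sub (automorphic Gamma (P1 ord)) (L_P1 ord pi) 'X D1,
        is_det_1sub (automorphic Gamma (P2 ord)) (L_P2 ord pi) 'X^2 D2
      & fps_mul Z (fps_of_poly (D1 * D2)) = fps_one _].
Proof.
move=> hF hpi hG hd htf hG0 hcc.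
have fin ax i h := finite_seq_enum (finite_edge_kind_set hF hpi hG hG0 hcc ax (i := i) h).
have [m1 [eps1 [inj1 ran1]]] := fin false 0%N isT.
have [m2 [eps2 [inj2 ran2]]] := fin true 0%N isT.
have [m3 [eps3 [inj3 ran3]]] := fin true 1%N isT.
(* The edges are listed by kind: diagonal edges, axis edges leaving a special vertex, axis edges
   leaving a non-special one. The transition matrix then has the expected block form. *)
pose eps (i : 'I_(m1 + (m2 + m3))) := match fintype.split i with
  | inl a => eps1 a
  | inr b => match fintype.split b with inl a => eps2 a | inr a => eps3 a end end.
have epsl a : eps (lshift _ a) = eps1 a by rewrite /eps (unsplitK (inl a)).
have epsrl a : eps (rshift _ (lshift _ a)) = eps2 a.
  by rewrite /eps (unsplitK (inr _)) (unsplitK (inl a)).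
have epsrr a : eps (rshift _ (rshift _ a)) = eps3 a.
  by rewrite /eps (unsplitK (inr _)) (unsplitK (inr a)).
have in1 a : edge_set ord pi Gamma (edge_kind ord false) 0 (eps1 a) by apply/ran1; exists a.
have in2 a : edge_set ord pi Gamma (edge_kind ord true) 0 (eps2 a) by apply/ran2; exists a.
have in3 a : edge_set ord pi Gamma (edge_kind ord true) 1 (eps3 a) by apply/ran3; exists a.
have dis := edge_set_disjoint hF hpi hG hG0.
have d12 a b : eps1 a <> eps2 b.
  by move=> e; have := in1 a; rewrite e => h; have [] := dis false true 0%N 0%N _ isT isT h (in2 b).
have d13 a b : eps1 a <> eps3 b.
  by move=> e; have := in1 a; rewrite e => h; have [] := dis false true 0%N 1%N _ isT isT h (in3 b).
have d23 a b : eps2 a <> eps3 b.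
  by move=> e; have := in2 a; rewrite e => h; have [_ /(_ isT)] := dis true true 0%N 1%N _ isT isT h (in3 b).
have eps_inj : injective eps.
  move=> i j; case: (split_ordP i) => a ->; [|case: (split_ordP a) => a' ->];
  (case: (split_ordP j) => b ->; [|case: (split_ordP b) => b' ->]);
  rewrite ?epsl ?epsrl ?epsrr.
  - by move/inj1 ->.
  - by move/d12.
  - by move/d13.
  - by move/esym/d12.
  - by move/inj2 ->.
  - by move/d23.
  - by move/esym/d13.
  - by move/esym/d23.
  - by move/inj3 ->.
pose edge_step := edge_step ord pi Gamma.
have step_ran x y : edge_step x y -> exists i, x = eps i.
  move=> /asboolP[g [k [i [hg hv -> _]]]]; have := std_edge_in_set Gamma hF hpi i hg hv.
  case: k hv => [b|] _ /=; last by move/ran1 => [a ->]; exists (lshift _ a).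
  case: (odd i) => [/ran3|/ran2] [a ->].
    by exists (rshift _ (rshift _ a)).
  by exists (rshift _ (lshift _ a)).
(* A step keeps the kind of line and along an axis flips the phase; all the other blocks vanish. *)
have off ax i ax' i' x y : (i <= 1)%N -> (i' <= 1)%N -> edge_set ord pi Gamma (edge_kind ord ax) i x ->
    edge_set ord pi Gamma (edge_kind ord ax') i' y -> edge_step x y ->
    ax = ax' /\ (ax -> (1 - i)%N = i').
  move=> hi hi' hx hy /(edge_step_in_set hF hpi hG hG0 hi)/(_ hx) h.
  have i1 : ((if ax then 1 - i else 0) <= 1)%N by case: (ax); rewrite ?leq_subr.
  have [e1 e2] := dis _ _ _ _ _ i1 hi' h hy.
  by split=> // axt; move: e2; rewrite axt; apply.
have [Z [hZ eZ]] := euler_product_det eps_inj step_ran R[i].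
pose A : 'M[R[i]]_m1 := \matrix_(i, j) (edge_step (eps1 i) (eps1 j))%:R.
pose X : 'M[R[i]]_(m2, m3) := \matrix_(i, j) (edge_step (eps2 i) (eps3 j))%:R.
pose Y : 'M[R[i]]_(m3, m2) := \matrix_(i, j) (edge_step (eps3 i) (eps2 j))%:R.
exists Z, (\det (1%:M - 'X *: map_mx polyC A)), (\det (1%:M - 'X^2 *: map_mx polyC (X *m Y))); split.
- by rewrite /is_zeta (prime_classesE R hF hpi hG hG0).
- rewrite /L_P1 -translation_false; exact: (Hecke_det1 hF hpi hG hd htf hG0 hcc 'X inj1 ran1).
- rewrite /L_P2 -translation_true; exact: (Hecke_det2 hF hpi hG hd htf hG0 hcc 'X^2 inj2 inj3 ran2 ran3).
- rewrite -eZ; congr (fps_mul Z (fps_of_poly _)).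
rewrite -det_1sub_block; congr (\det (_ - _ *: map_mx _ _)).
have z x y : (edge_step x y -> False) -> (edge_step x y)%:R = 0 :> R[i] by case: (edge_step x y) => // /(_ isT).
apply/matrixP => i j; rewrite [RHS]mxE.
case: (split_ordP i) => a ->; [|case: (split_ordP a) => a' ->];
(case: (split_ordP j) => b ->; [|case: (split_ordP b) => b' ->]);
rewrite !(block_mxEul, block_mxEur, block_mxEdl, block_mxEdr) ?[in LHS]mxE ?epsl ?epsrl ?epsrr //;
apply/esym/z => h.
- by have [] := off false 0%N true 0%N _ _ isT isT (in1 _) (in2 _) h.
- by have [] := off false 0%N true 1%N _ _ isT isT (in1 _) (in3 _) h.
- by have [] := off true 0%N false 0%N _ _ isT isT (in2 _) (in1 _) h.
- by have [_ /(_ isT)] := off true 0%N true 0%N _ _ isT isT (in2 _) (in2 _) h.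
- by have [] := off true 1%N false 0%N _ _ isT isT (in3 _) (in1 _) h.
- by have [_ /(_ isT)] := off true 1%N true 1%N _ _ isT isT (in3 _) (in3 _) h.
Qed.
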